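(* In the setting and under Assumptions 1-7 given in the context, let $\alpha\in(0,1)$ and $\epsilon>0$. Then $\hat I_n=\big[0,\hat d_1-\hat q_{0,\alpha}/\sqrt n\big)$ is an asymptotic $(1-\alpha)$ confidence interval for $d_1$, that is, $$\lim_{n\to\infty}\mathbb P\big(d_1\in\hat I_n\big)=\lim_{n\to\infty}\mathbb P\Big(d_1\in\Big[0,\hat d_1-\frac{\hat q_{0,\alpha}}{\sqrt n}\Big)\Big)=1-\alpha .$$ Moreover, the test which rejects $H_0:d_1\ge\epsilon$ in favour of $H_1:d_1<\epsilon$ whenever $\hat d_1<\epsilon+\hat q_{0,\alpha}/\sqrt n$ is a consistent and asymptotic level $\alpha$ test, that is: (1) if $d_1\ge\epsilon$, then $\limsup_{n\to\infty}\mathbb P\big(\hat d_1<\epsilon+\frac{\hat q_{0,\alpha}}{\sqrt n}\big)\le\alpha$; (2) if $d_1<\epsilon$, then $\liminf_{n\to\infty}\mathbb P\big(\hat d_1<\epsilon+\frac{\hat q_{0,\alpha}}{\sqrt n}\big)=1$.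
   Context: Model. There are two independent samples ($\ell=1,2$) of sizes $n_1,n_2$, and $n=n_1+n_2$. In group $\ell$ there are $k_\ell$ different covariates $x_{\ell,1},\dots,x_{\ell,k_\ell}\in\mathcal X\subset\mathbb R^d$, and at $x_{\ell,i}$ one has $n_{\ell,i}$ observations, $n_\ell=\sum_{i=1}^{k_\ell}n_{\ell,i}$, given by $$Y_{\ell,i,j}=m_\ell(x_{\ell,i},\beta_\ell)+\eta_{\ell,i,j},\quad j=1,\dots,n_{\ell,i},\ i=1,\dots,k_\ell,$$ where $m_\ell(\cdot,\beta_\ell)\in\ell^\infty(\mathcal X)$ (bounded real functions on $\mathcal X$) is a regression function with parameter $\beta_\ell\in\mathbb R^{p_\ell}$, and the errors $\eta_{\ell,i,j}$ are i.i.d. within group $\ell$ with mean $0$ and variance $\sigma_\ell^2>0$. Put $d_1=d_1(\beta_1,\beta_2)=\int_{\mathcal X}|m_1(x,\beta_1)-m_2(x,\beta_2)|\,dx$. $\hat\beta_1,\hat\beta_2$ are estimators of $\beta_1,\beta_2$ from the first and second sample, respectively, and $\hat d_1=d_1(\hat\beta_1,\hat\beta_2)$. Let $$\Sigma_\ell=\frac1{\sigma_\ell^2}\sum_{i=1}^{k_\ell}\zeta_{\ell,i}\Big(\tfrac{\partial}{\partial b_\ell}m_\ell(x_{\ell,i},b_\ell)\big|_{b_\ell=\beta_\ell}\Big)\Big(\tfrac{\partial}{\partial b_\ell}m_\ell(x_{\ell,i},b_\ell)\big|_{b_\ell=\beta_\ell}\Big)^\top,$$ with $\zeta_{\ell,i}$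 the limits in Assumption 6, and let $$\hat\Sigma_\ell=\frac1{\hat\sigma_\ell^2}\sum_{i=1}^{k_\ell}\frac{n_{\ell,i}}{n_\ell}\Big(\tfrac{\partial}{\partial b_\ell}m_\ell(x_{\ell,i},b_\ell)\big|_{b_\ell=\hat\beta_\ell}\Big)\Big(\tfrac{\partial}{\partial b_\ell}m_\ell(x_{\ell,i},b_\ell)\big|_{b_\ell=\hat\beta_\ell}\Big)^\top,$$ where $\hat\sigma_\ell^2$ are consistent estimators of $\sigma_\ell^2$. For a fixed constant $c>0$ let $$\hat{\mathcal N}=\Big\{x\in\mathcal X:\ |m_1(x,\hat\beta_1)-m_2(x,\hat\beta_2)|<c\sqrt{\tfrac{\log n}{n}}\Big\},$$ with complement $\hat{\mathcal N}^c$ in $\mathcal X$. Let $Z_1,Z_2$ be independent $p_1$- and $p_2$-dimensional standard normal vectors, independent of the data, and, with $\hat\kappa=n/n_1$, $$\hat G(x)=\Big(\tfrac{\partial}{\partial b_1}m_1(x,b_1)\big|_{b_1=\hat\beta_1}\Big)^\top\sqrt{\hat\kappa}\,\hat\Sigma_1^{-1/2}Z_1-\Big(\tfrac{\partial}{\partial b_2}m_2(x,b_2)\big|_{b_2=\hat\beta_2}\Big)^\top\sqrt{\tfrac{\hat\kappa}{\hat\kappa-1}}\,\hat\Sigma_2^{-1/2}Z_2,$$ $$\hat T=\int_{\hat{\mathcal N}^c}\operatorname{sgn}\big(m_1(x,\hat\beta_1)-m_2(x,\hat\beta_2)\big)\hat G(x)\,dx+\int_{\hat{\mathcal N}}|\hat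 G(x)|\,dx .$$ $\hat q_{0,\alpha}$ is the $\alpha$-quantile of the conditional distribution of $\hat T$ given the data (i.e. with the estimates held fixed and only $Z_1,Z_2$ random). Assumptions. 1. The errors $\eta_{\ell,i,j}$ have mean $0$ and finite variance $\sigma_\ell^2$. 2. $\mathcal X\subset\mathbb R^d$ is compact, and the number $k_\ell$ and location of the levels $x_{\ell,i}$ do not depend on $n_\ell$, $\ell=1,2$. 3. All estimators of $\beta_1,\beta_2$ are computed over compact sets $B_1\subset\mathbb R^{p_1}$, $B_2\subset\mathbb R^{p_2}$. 4. $m_1,m_2$ are twice continuously differentiable with respect to the parameters for all $b_1,b_2$ in neighbourhoods of the true parameters $\beta_1,\beta_2$ and all $x\in\mathcal X$. The functions $(x,b_\ell)\mapsto m_\ell(x,b_\ell)$ and their first two derivatives are continuous on $\mathcal X\times B_\ell$, $\ell=1,2$. 5. With $\psi^{(n)}_{a,\ell}(b)=\sum_{i=1}^{k_\ell}\frac{n_{\ell,i}}{n_\ell}(m_\ell(x_{\ell,i},a)-m_\ell(x_{\ell,i},b))^2$, for every $u>0$ there is $v_{u,\ell}>0$ with $\liminf_{n\to\infty}\inf_{a\in B_\ell}\inf_{b\in B_\ell,\,|b-a|\ge u}\psi^{(n)}_{a,\ell}(b)\ge v_{u,\ell}$, $\ell=1,2$. 6. The matrices $\Sigma_\ell$ are non-singular, and $n_1,n_2\to\infty$ such that $n_{\ell,i}/n_\ell\to\zeta_{\ell,i}\in(0,1)$ for $i=1,\dots,k_\ell$, $\ell=1,2$, and $n/n_1\to\kappa\in(1,\infty)$.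 Limits $n\to\infty$ are understood in this sense. 7. The estimators can be linearized: $\sqrt{n_\ell}(\hat\beta_\ell-\beta_\ell)=\frac1{\sqrt{n_\ell}}\sum_{i=1}^{k_\ell}\sum_{j=1}^{n_{\ell,i}}\phi_{\ell,i,j}+o_{\mathbb P}(1)$ as $n_\ell\to\infty$, with square integrable influence functions $\phi_{\ell,i,j}$ satisfying $\mathbb E[\phi_{\ell,i,j}]=0$; this means that $\sqrt{n_\ell}(\hat\beta_\ell-\beta_\ell)$ converges in distribution to a centred normal law with covariance matrix $\Sigma_\ell^{-1}=\sum_{i=1}^{k_\ell}\zeta_{\ell,i}\mathbb E[\phi_{\ell,i,j}\phi_{\ell,i,j}^\top]$, $\ell=1,2$. Moreover the variance estimators $\hat\sigma_1^2,\hat\sigma_2^2$ are consistent.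
   Formalization: The coverage claim, and claim (1) in the boundary case d_1 = ε, additionally assume that the α-quantile of the limit law T of √n(d̂_1 − d_1) is not an atom of T; without this both can fail (e.g. d_1 locally constant in the parameters). *)

(* Defs.v *)
From HB Require Import structures.
From mathcomp Require Import all_boot all_order all_algebra.
From mathcomp Require Import all_classical all_reals all_analysis.

Set Implicit Arguments.
Unset Strict Implicit.
Unset Printing Implicit Defensive.
Import Order.TTheory GRing.Theory Num.Theory.
Import numFieldNormedType.Exports.
Local Open Scope classical_set_scope.
Local Open Scope ring_scope.

(* Matrices (in particular the points of R^d and R^p) carry the product       *)
(* sigma-algebra, i.e. the one generated by the entries, as n.-tuple does.    *)
Section measurable_matrix.
Context {R : realType} {m n : nat}.

Definition mx_entries_preimages : set (set 'M[R]_(m, n)) :=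
  \bigcup_(ij in [set: 'I_m * 'I_n])
    preimage_set_system setT (fun M : 'M[R]_(m, n) => M ij.1 ij.2) measurable.

Let mx_measurable : set (set 'M[R]_(m, n)) := <<s mx_entries_preimages >>.

Let mx_measurable0 : mx_measurable set0.
Proof. exact: sigma_algebra0. Qed.

Let mx_measurableC A : mx_measurable A -> mx_measurable (~` A).
Proof. exact: sigma_algebraC. Qed.

Let mx_measurable_bigcup (F : (set 'M[R]_(m, n))^nat) :
  (forall i, mx_measurable (F i)) -> mx_measurable (\bigcup_i F i).
Proof. exact: sigma_algebra_bigcup. Qed.

HB.instance Definition _ := @isMeasurable.Build default_measure_display
  'M[R]_(m, n) mx_measurable mx_measurable0 mx_measurableC
  mx_measurable_bigcup.

End measurable_matrix.

Lemma measurable_entry (R : realType) (m n : nat) (i : 'I_m) (j : 'I_n) :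
  measurable_fun setT (fun M : 'M[R]_(m, n) => M i j).
Proof.
move=> _ A mA; apply: sub_sigma_algebra; exists (i, j) => //=.
by exists A.
Qed.

Lemma measurable_fun_mx d (T : measurableType d) (R : realType) (m n : nat)
    (f : T -> 'M[R]_(m, n)) :
  (forall i j, measurable_fun setT (fun t => f t i j)) -> measurable_fun setT f.
Proof.
move=> mf; apply: (measurability (mx_entries_preimages)) => //.
move=> _ [_ [[i j] _ [A mA <-]] <-].
by rewrite setTI; have := mf i j measurableT A mA; rewrite !setTI.
Qed.

(* d-dimensional Lebesgue measure: lebesgue_rV d.+1 is the product of the     *)
(* Lebesgue measure on the first coordinate with lebesgue_rV d on the others. *)
Section lebesgue_rV.
Context {R : realType}.

Definition cons_rV d (x : R * 'rV[R]_d) : 'rV[R]_d.+1 := row_mx x.1%:M x.2.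

Definition uncons_rV d (v : 'rV[R]_d.+1) : R * 'rV[R]_d :=
  (v 0 0, \row_j v 0 (lift 0 j)).

Lemma measurable_cons_rV d : measurable_fun setT (@cons_rV d).
Proof.
apply: measurable_fun_mx => i j; rewrite (ord1 i).
have [j' ->|j' ->] := @split_ordP 1 d j.
  rewrite (_ : (fun _ => _) = fst) ?measurable_fst//.
  apply/funext => x; apply: (etrans (row_mxEl _ _ _ _)).
  by rewrite mxE (ord1 j') mulr1n.
rewrite (_ : (fun _ => _) = (fun M : 'rV[R]_d => M 0 j') \o snd).
  by apply: measurableT_comp; [exact: measurable_entry|exact: measurable_snd].
by apply/funext => x; apply: (etrans (row_mxEr _ _ _ _)).
Qed.

Lemma measurable_uncons_rV d : measurable_fun setT (@uncons_rV d).
Proof.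
apply: measurable_fun_pair; first exact: measurable_entry.
apply: measurable_fun_mx => i j; under eq_fun do rewrite mxE.
exact: measurable_entry.
Qed.

Lemma cons_rVK d : cancel (@cons_rV d) (@uncons_rV d).
Proof.
move=> [x v]; congr pair.
  apply: (@etrans _ _ (row_mx x%:M v 0 (lshift d 0))).
    by congr (fun_of_matrix _ _ _); exact: val_inj.
  by rewrite row_mxEl mxE mulr1n.
apply/rowP => j; rewrite mxE.
apply: (@etrans _ _ (row_mx x%:M v 0 (rshift 1 j))).
  by congr (fun_of_matrix _ _ _); exact: val_inj.
by rewrite row_mxEr.
Qed.

Section cons_lebesgue.
Context {d : nat} (mu : {sigma_finite_measure set 'rV[R]_d -> \bar R}).

Definition cons_lebesgue : set 'rV[R]_d.+1 -> \bar R :=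
  pushforward (@lebesgue_measure R \x mu)%E (@cons_rV d).

HB.instance Definition _ := Measure.copy cons_lebesgue
  (measure_function_pushforward__canonical__measure_function_Measure
    (@lebesgue_measure R \x mu)%E (@measurable_cons_rV d)).

Let cons_lebesgue_sigma_finite : sigma_finite setT cons_lebesgue.
Proof.
have /sigma_finiteP[F [TF ndF Foo]] := sigma_finiteT (@lebesgue_measure R).
have /sigma_finiteP[G [TG ndG Goo]] := sigma_finiteT mu.
exists (fun n => @uncons_rV d @^-1` (F n `*` G n)).
  rewrite predeqE => v; split=> // _.
  have : (setT `*` setT) (uncons_rV v) by [].
  rewrite TF TG => -[[n _ Fn] [k _ Gk]]; exists (maxn n k) => //; split.
    by move: Fn; apply/subsetPset/ndF/leq_maxl.
  by move: Gk; apply/subsetPset/ndG/leq_maxr.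
move=> n; have [mF Fn] := Foo n; have [mG Gn] := Goo n; split.
  rewrite -[X in measurable X]setTI; apply: measurable_uncons_rV => //.
  exact: measurableX.
rewrite /cons_lebesgue /pushforward -comp_preimage.
rewrite (_ : _ \o _ = id) ?preimage_id; last exact/funext/cons_rVK.
rewrite product_measure1E//.
by rewrite lte_mul_pinfty// ge0_fin_numE.
Qed.

HB.instance Definition _ := Measure_isSigmaFinite.Build _ _ _ cons_lebesgue
  cons_lebesgue_sigma_finite.

End cons_lebesgue.

Fixpoint lebesgue_rV d : {sigma_finite_measure set 'rV[R]_d -> \bar R} :=
  if d is d'.+1 then cons_lebesgue (lebesgue_rV d') else \d_(0 : 'rV[R]_0).

Lemma lebesgue_rV_box d (A : 'I_d -> set R) : (forall i, measurable (A i)) ->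
  lebesgue_rV d [set v | forall i, A i (v 0 i)] =
  (\prod_(i < d) @lebesgue_measure R (A i))%E.
Proof.
elim: d A => [|d IH] A mA.
  by rewrite big_ord0 /= diracE mem_set// => -[].
have mB : measurable [set v : 'rV[R]_d | forall i, A (lift 0 i) (v 0 i)].
  rewrite (_ : [set _ | _] =
    \bigcap_(i in [set: 'I_d]) ((fun v : 'rV[R]_d => v 0 i) @^-1` A (lift 0 i))).
    apply: fin_bigcap_measurable; first exact: finite_finset.
    move=> i _; rewrite -[X in measurable X]setTI.
    exact: measurable_entry.
  by apply/seteqP; split => v /= vA i => [_|]; exact: vA.
rewrite big_ord_recl -IH// -product_measure1E//=; last exact: mA.
rewrite /cons_lebesgue /pushforward; congr (product_measure1 _ _ _).
apply/seteqP; split => [x /= xA|x /= [x0 xA] i].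
  have [/= e1 e2] : (uncons_rV (cons_rV x)).1 = x.1 /\
    (uncons_rV (cons_rV x)).2 = x.2 by rewrite cons_rVK.
  by split => [|i]; [rewrite -e1; exact: xA|rewrite -e2 mxE; exact: xA].
have [/= e1 e2] : (uncons_rV (cons_rV x)).1 = x.1 /\
  (uncons_rV (cons_rV x)).2 = x.2 by rewrite cons_rVK.
case: (unliftP 0 i) => [j ->|->]; last by rewrite e1.
by have := xA j; rewrite -e2 mxE.
Qed.

End lebesgue_rV.

Section vector_notions.
Context {R : realType}.

Definition enorm p (v : 'cV[R]_p) : R := Num.sqrt (\sum_i v i 0 ^+ 2).

Definition grad p (f : 'cV[R]_p -> R) (b : 'cV[R]_p) : 'cV[R]_p :=
  \col_i 'D_(delta_mx i 0) f b.

Definition C2_on d p (X : set 'rV[R]_d) (D : set 'cV[R]_p)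
    (f : 'rV[R]_d -> 'cV[R]_p -> R) : Prop :=
  [/\ forall x b, X x -> D b -> differentiable (f x) b /\
        forall i, differentiable (fun c => grad (f x) c i 0) b,
      {within X `*` D, continuous
        (fun xb : 'rV[R]_d * 'cV[R]_p => f xb.1 xb.2)},
      forall i, {within X `*` D, continuous
        (fun xb : 'rV[R]_d * 'cV[R]_p => grad (f xb.1) xb.2 i 0)} &
      forall i j, {within X `*` D, continuous
        (fun xb : 'rV[R]_d * 'cV[R]_p =>
           grad (fun c => grad (f xb.1) c i 0) xb.2 j 0)}].

Definition psd p (B : 'M[R]_p) : Prop :=
  B^T = B /\ forall v : 'cV[R]_p, 0 <= (v^T *m B *m v) 0 0.

(* The positive semidefinite square root, unique when it exists; 0 otherwise. *)
Definition sqrtmx p (A : 'M[R]_p) : 'M[R]_p :=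
  xget 0 [set B | psd B /\ B *m B = A].

Definition invsqrtmx p (A : 'M[R]_p) : 'M[R]_p := sqrtmx (invmx A).

End vector_notions.

Section probability_notions.
Context {dO : measure_display} {Omega : measurableType dO} {R : realType}.
Variable P : probability Omega R.

Definition mutual_indep (I : eqType) (X : I -> Omega -> R) : Prop :=
  forall (s : seq I) (A : I -> set R), uniq s ->
    (forall i, measurable (A i)) ->
    P (\bigcap_(i in [set` s]) (X i @^-1` A i)) =
    (\prod_(i <- s) P (X i @^-1` A i))%E.

Definition cvg_in_probability (X : nat -> Omega -> R) (c : R) : Prop :=
  forall e : R, 0 < e ->
    P [set w | e <= `|X N w - c|] @[N --> \oo] --> 0%E.

Definition cvg_in_law p (X : nat -> Omega -> 'cV[R]_p) (Y : Omega -> 'cV[R]_p)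
    : Prop :=
  forall f : 'cV[R]_p -> R, continuous f -> bounded_fun f ->
    ('E_P[fun w => f (X N w)])%E @[N --> \oo] --> ('E_P[fun w => f (Y w)])%E.

Definition quantile (X : Omega -> R) (alpha : R) : R :=
  inf [set t | (alpha%:E <= P [set w | (X w <= t)%R])%E].

Definition std_normal_coords p (Z : {RV P >-> 'cV[R]_p}) : Prop :=
  forall (a : 'I_p) (A : set R), measurable A ->
    P [set w | A (Z w a 0)] = normal_prob 0 1 A.

(* Generates the sigma-algebra sigma(X_i, i in D). *)
Definition preimages_of (I : Type) (D : set I) (X : I -> Omega -> R)
    : set (set Omega) :=
  \bigcup_(i in D) preimage_set_system setT (X i) measurable.

(* f is a statistic, i.e. a measurable function of the observations that      *)
(* generate <<s G >>.                                                         *)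
Definition statistic_of d' (T : measurableType d') (G : set (set Omega))
    (f : Omega -> T) : Prop :=
  forall A, measurable A -> <<s G >> (f @^-1` A).

End probability_notions.

(* One of the two groups. The index N : nat of the sample sizes and of the    *)
(* estimators numbers the stages of the asymptotics "n -> oo"; n, n_1, n_2    *)
(* are the sample sizes at stage N.                                           *)
Record group (dO : measure_display) (Omega : measurableType dO) (R : realType)
    (P : probability Omega R) (d : nat) := Group {
  ncov : nat;                                      (* k_l *)
  npar : nat;                                      (* p_l *)
  cov : 'I_ncov -> 'rV[R]_d;                       (* x_{l,i} *)
  nobs : nat -> 'I_ncov -> nat;                    (* n_{l,i} *)
  reg : 'rV[R]_d -> 'cV[R]_npar -> R;              (* m_l *)
  par : 'cV[R]_npar;                               (* beta_l *)
  err : 'I_ncov -> nat -> {RV P >-> R};            (* eta_{l,i,j} *)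
  var : R;                                         (* sigma_l^2 *)
  parset : set 'cV[R]_npar;                        (* B_l *)
  est : nat -> Omega -> 'cV[R]_npar;               (* \hat beta_l *)
  varest : nat -> Omega -> R;                      (* \hat sigma_l^2 *)
  zeta : 'I_ncov -> R;                             (* zeta_{l,i} *)
  infl : 'I_ncov -> nat -> {RV P >-> 'cV[R]_npar}  (* phi_{l,i,j} *)
}.
Arguments ncov {dO Omega R P d} g.
Arguments npar {dO Omega R P d} g.
Arguments cov {dO Omega R P d} g.
Arguments nobs {dO Omega R P d} g.
Arguments reg {dO Omega R P d} g.
Arguments par {dO Omega R P d} g.
Arguments err {dO Omega R P d} g.
Arguments var {dO Omega R P d} g.
Arguments parset {dO Omega R P d} g.
Arguments est {dO Omega R P d} g.
Arguments varest {dO Omega R P d} g.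
Arguments zeta {dO Omega R P d} g.
Arguments infl {dO Omega R P d} g.

Section one_group.
Context {dO : measure_display} {Omega : measurableType dO} {R : realType}
  {P : probability Omega R} {d : nat}.
Variable g : group P d.

Definition size_of (N : nat) : nat := (\sum_i nobs g N i)%N.

Definition frac (N : nat) (i : 'I_(ncov g)) : R :=
  (nobs g N i)%:R / (size_of N)%:R.

Definition obs (ij : 'I_(ncov g) * nat) (w : Omega) : R :=
  reg g (cov g ij.1) (par g) + err g ij.1 ij.2 w.

Definition sample (N : nat) : set (set Omega) :=
  preimages_of [set ij | (ij.2 < nobs g N ij.1)%N] obs.

Definition information (s : R) (u : 'I_(ncov g) -> R) (b : 'cV[R]_(npar g))
    : 'M[R]_(npar g) :=
  s^-1 *: \sum_i u i *:
    (grad (reg g (cov g i)) b *m (grad (reg g (cov g i)) b)^T).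

Definition Sigma : 'M[R]_(npar g) := information (var g) (zeta g) (par g).

Definition Sigma_hat (N : nat) (w : Omega) : 'M[R]_(npar g) :=
  information (varest g N w) (frac N) (est g N w).

(* psi^{(n)}_a(b) *)
Definition contrast (N : nat) (a b : 'cV[R]_(npar g)) : R :=
  \sum_i frac N i * (reg g (cov g i) a - reg g (cov g i) b) ^+ 2.

Definition design (X : set 'rV[R]_d) : Prop :=
  [/\ injective (cov g), forall i, X (cov g i) &
      [bounded reg g x (par g) | x in X]].

Definition assumption1 : Prop :=
  [/\ 0 < var g,
      forall i j i' j' (A : set R), measurable A ->
        P (err g i j @^-1` A) = P (err g i' j' @^-1` A),
      forall i j, (err g i j : Omega -> R) \in Lfun P 2%:E,
      forall i j, ('E_P[err g i j] = 0)%E &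
      forall i j, ('V_P[err g i j] = (var g)%:E)%E].

Definition assumption3 : Prop :=
  compact (parset g) /\ forall N w, parset g (est g N w).

Definition assumption4 (X : set 'rV[R]_d) : Prop :=
  (exists U, [/\ open U, U (par g) & C2_on X U (reg g)]) /\
  C2_on X (parset g) (reg g).

Definition assumption5 : Prop :=
  forall u : R, 0 < u -> exists2 v : R, 0 < v &
    (v%:E <= limn_einf (fun N => ereal_inf
       [set ereal_inf [set (contrast N a b)%:E | b in
                        [set b | parset g b /\ (u <= enorm (b - a))%R]]
        | a in parset g]))%E.

Definition assumption6 : Prop :=
  [/\ Sigma \in unitmx,
      size_of N @[N --> \oo] --> \oo,
      forall i, frac N i @[N --> \oo] --> zeta g i &
      forall i, 0 < zeta g i < 1].

(* Sigma^{-1/2} Z, with Z standard normal, has the law N(0, Sigma^{-1}).      *)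
Definition assumption7 (Z : {RV P >-> 'cV[R]_(npar g)}) : Prop :=
  [/\ forall i j a, (fun w => infl g i j w a 0) \in Lfun P 2%:E,
      forall i j a, ('E_P[fun w => infl g i j w a 0%R] = 0)%E,
      forall j, invmx Sigma = \sum_i zeta g i *: \matrix_(a, b)
        fine ('E_P[fun w => (infl g i j w a 0 * infl g i j w b 0)%R])%E,
      cvg_in_probability P (fun N w => enorm
        (Num.sqrt (size_of N)%:R *: (est g N w - par g) -
         (Num.sqrt (size_of N)%:R)^-1 *:
           \sum_i \sum_(j < nobs g N i) infl g i j w)) 0 &
      cvg_in_law P
        (fun N w => Num.sqrt (size_of N)%:R *: (est g N w - par g))
        (fun w => invsqrtmx Sigma *m Z w)]
  /\ cvg_in_probability P (varest g) (var g).

End one_group.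

Arguments size_of {dO Omega R P d} g.
Arguments frac {dO Omega R P d} g.
Arguments obs {dO Omega R P d} g.
Arguments sample {dO Omega R P d} g.
Arguments information {dO Omega R P d} g.
Arguments Sigma {dO Omega R P d} g.
Arguments Sigma_hat {dO Omega R P d} g.
Arguments contrast {dO Omega R P d} g.
Arguments design {dO Omega R P d} g.
Arguments assumption1 {dO Omega R P d} g.
Arguments assumption3 {dO Omega R P d} g.
Arguments assumption4 {dO Omega R P d} g.
Arguments assumption5 {dO Omega R P d} g.
Arguments assumption6 {dO Omega R P d} g.
Arguments assumption7 {dO Omega R P d} g.

Section two_groups.
Context {dO : measure_display} {Omega : measurableType dO} {R : realType}
  {P : probability Omega R} {d : nat}.
Variables (g1 g2 : group P d) (X : set 'rV[R]_d).
Variables (Z1 : {RV P >-> 'cV[R]_(npar g1)}) (Z2 : {RV P >-> 'cV[R]_(npar g2)}).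

Definition total_size (N : nat) : nat := (size_of g1 N + size_of g2 N)%N.

(* The joint independence of this family makes the errors of each group       *)
(* independent, the two samples independent of each other, Z1 and Z2          *)
(* independent vectors with independent coordinates, and (Z1, Z2) independent *)
(* of the data.                                                               *)
Definition noise
    (i : ('I_(ncov g1) * nat + 'I_(ncov g2) * nat) +
         ('I_(npar g1) + 'I_(npar g2))) : Omega -> R :=
  match i with
  | inl (inl ij) => err g1 ij.1 ij.2
  | inl (inr ij) => err g2 ij.1 ij.2
  | inr (inl a) => fun w => Z1 w a 0
  | inr (inr a) => fun w => Z2 w a 0
  end.

Definition estimators : Prop :=
  [/\ forall N, statistic_of (sample g1 N) (est g1 N),
      forall N, statistic_of (sample g2 N) (est g2 N),
      forall N, statistic_of (sample g1 N `|` sample g2 N) (varest g1 N) &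
      forall N, statistic_of (sample g1 N `|` sample g2 N) (varest g2 N)].

Definition dist1 (b1 : 'cV[R]_(npar g1)) (b2 : 'cV[R]_(npar g2)) : R :=
  \int[lebesgue_rV d]_(x in X) `|reg g1 x b1 - reg g2 x b2|.

(* The Gaussian process G(x) and the statistic T, evaluated at z1, z2, as     *)
(* functions of the quantities k, S1, S2, b1, b2 and of the set N, so as to   *)
(* cover both the estimated objects and their limits.                         *)
Definition Gproc (k : R) (S1 : 'M[R]_(npar g1)) (S2 : 'M[R]_(npar g2))
    (b1 : 'cV[R]_(npar g1)) (b2 : 'cV[R]_(npar g2))
    (z1 : 'cV[R]_(npar g1)) (z2 : 'cV[R]_(npar g2)) (x : 'rV[R]_d) : R :=
  ((grad (reg g1 x) b1)^T *m (Num.sqrt k *: (invsqrtmx S1 *m z1))) 0 0 -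
  ((grad (reg g2 x) b2)^T *m
    (Num.sqrt (k / (k - 1)) *: (invsqrtmx S2 *m z2))) 0 0.

Definition Tstat (M : set 'rV[R]_d) (k : R)
    (S1 : 'M[R]_(npar g1)) (S2 : 'M[R]_(npar g2))
    (b1 : 'cV[R]_(npar g1)) (b2 : 'cV[R]_(npar g2))
    (z1 : 'cV[R]_(npar g1)) (z2 : 'cV[R]_(npar g2)) : R :=
  \int[lebesgue_rV d]_(x in X `\` M)
     (Num.sg (reg g1 x b1 - reg g2 x b2) * Gproc k S1 S2 b1 b2 z1 z2 x) +
  \int[lebesgue_rV d]_(x in M) `|Gproc k S1 S2 b1 b2 z1 z2 x|.

Definition N_hat (c : R) (N : nat) (w : Omega) : set 'rV[R]_d :=
  [set x | X x /\ `|reg g1 x (est g1 N w) - reg g2 x (est g2 N w)| <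
     c * Num.sqrt (ln (total_size N)%:R / (total_size N)%:R)].

Definition kappa_hat (N : nat) : R := (total_size N)%:R / (size_of g1 N)%:R.

(* The data are those of the outcome w, the normal vectors those of w'. *)
Definition T_hat (c : R) (N : nat) (w w' : Omega) : R :=
  Tstat (N_hat c N w) (kappa_hat N) (Sigma_hat g1 N w) (Sigma_hat g2 N w)
    (est g1 N w) (est g2 N w) (Z1 w') (Z2 w').

(* Conditional quantile given the data: w is held fixed, Z1, Z2 vary. *)
Definition q_hat (c alpha : R) (N : nat) (w : Omega) : R :=
  quantile P (T_hat c N w) alpha.

Definition d_hat (N : nat) (w : Omega) : R := dist1 (est g1 N w) (est g2 N w).

(* The limit in law of sqrt n (d_hat - d_1). *)
Definition T_limit (kappa : R) (w : Omega) : R :=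
  Tstat [set x | X x /\ reg g1 x (par g1) = reg g2 x (par g2)] kappa
    (Sigma g1) (Sigma g2) (par g1) (par g2) (Z1 w) (Z2 w).

End two_groups.

Arguments total_size {dO Omega R P d} g1 g2.
Arguments kappa_hat {dO Omega R P d} g1 g2.
Arguments dist1 {dO Omega R P d} g1 g2.
Arguments d_hat {dO Omega R P d} g1 g2.

(* Main.v *)
From HB Require Import structures.
Require Import Defs.
From mathcomp Require Import all_boot all_order all_algebra.
From mathcomp Require Import all_classical all_reals all_analysis.
From mathcomp Require Import measurable_realfun ring lra.
From mathcomp Require spectral sesquilinear complex.

(** Write [H_l = sqrt n_l (est_l - par_l)], let [D0 = m_1 - m_2] be the difference
    of the regression functions at the true parameters, and let [q] be the
    [alpha]-quantile of [T = T_limit]. The theorem follows from two facts: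
    [sqrt n (d_hat - d_1)] converges in law to [T], and [q_hat] converges to [q]
    in probability.

    The L1 distance is not differentiable in the parameters where [D0] has zeros
    of positive measure, but it has a directional derivative [dist_deriv]: in the
    direction in which [D0] moves by [v], it is the integral of [sg D0 * v] where
    [D0 <> 0] and of [|v|] where [D0 = 0]. This functional is Lipschitz, and a delta
    method holds: [dist_expansion] says that, uniformly over bounded [H_1], [H_2],
    the error [sqrt n (d_hat - d_1)] is [dist_deriv] at [sqrt kappa H_1] and
    [sqrt (kappa / (kappa - 1)) H_2], up to [o(1)]. The two estimators depend on
    disjoint sets of independent errors ([indep_est]), and convergence in law of the
    two marginals of an independent pair gives that of the pair
    ([cvg_in_law_joint]); the limit [T] is [dist_deriv] at the two normal limits.

    For the quantile, the data are held fixed. The threshold in the definition of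
    [N_hat] is of larger order than the error of the estimated difference, and
    tends to 0; hence [N_hat] is the zero set of [D0] up to a set of small measure,
    outside which the sign of [D0] is estimated correctly. With the continuity of
    the inverse square root of a positive definite matrix ([cvg_invsqrtmx]) this
    bounds [T_hat - T] by a small multiple of [|Z_1| + |Z_2|]
    ([T_hat_expansion]). A quantile is continuous at a law whose distribution
    function exceeds [alpha] immediately to the right of it ([quantile_stable]).
    That of [T] does: [T] is a continuous function of a normal vector, whose law
    has full support, so that the values of [T] leave no gap
    ([gaussian_quantile_lt]).

    These expansions hold pointwise on the outcomes at which [H_1] and [H_2] are
    bounded and the variance estimators are close to their limits. As convergent
    laws are tight, they hold in probability ([controlled_in_probability]).

    All three claims concern the probability that [sqrt n (d_hat - d_1)] is below
    [q_hat + M], where [M] is [0] for the interval and [sqrt n (epsilon - d_1)] for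
    the test. [near_prob_le] and [near_prob_ge] compare it, for fixed [M], with the
    probability that [T] is below [q + M]. For [M = 0] the latter is [alpha] if
    [q] is not an atom; it is less than [alpha] for [M < 0] by definition of the
    quantile, and tends to 1 as [M] tends to infinity. *)

Set Implicit Arguments.
Unset Strict Implicit.
Unset Printing Implicit Defensive.
Import Order.TTheory GRing.Theory Num.Theory.
Import numFieldNormedType.Exports.
Local Open Scope classical_set_scope.
Local Open Scope ring_scope.

(** * Matrices: norm, convergence and measurability *)

Section matrix_norm.
Context {R : realType}.
Implicit Types (m n k : nat).

Lemma mx_norm_leP m n (M : 'M[R]_(m, n)) (e : R) : 0 <= e ->
  `|M| <= e <-> forall i j, `|M i j| <= e.
Proof.
move=> e0; rewrite {1}/Num.Def.normr/= mx_normrE; split=> [/bigmax_leP[_ +] i j|h].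
  by move=> /(_ (i, j) erefl).
by apply/bigmax_leP; split => // -[i j] _; exact: h.
Qed.

Lemma mx_norm_entry m n (M : 'M[R]_(m, n)) i j : `|M i j| <= `|M|.
Proof. by move: i j; apply/mx_norm_leP. Qed.

Lemma mx_norm_ltP m n (M : 'M[R]_(m, n)) (e : R) : 0 < e ->
  `|M| < e <-> forall i j, `|M i j| < e.
Proof.
move=> e0; rewrite {1}/Num.Def.normr/= mx_normrE; split=> [/bigmax_ltP[_ +] i j|h].
  by move=> /(_ (i, j) erefl).
by apply/bigmax_ltP; split => // -[i j] _; exact: h.
Qed.

Lemma cvg_mxP (T : Type) (F : set_system T) {FF : Filter F} m n
    (f : T -> 'M[R]_(m, n)) (M : 'M[R]_(m, n)) :
  f x @[x --> F] --> M <-> forall i j, f x i j @[x --> F] --> M i j.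
Proof.
split=> [fM i j|fM].
  have h := @coord_continuous R m n i j M.
  by apply: (cvg_comp f (fun A : 'M[R]_(m, n) => A i j) fM h).
apply/cvgrPdist_lt => e e0.
have : \forall x \near F, forall ij : 'I_m * 'I_n,
    `|M ij.1 ij.2 - f x ij.1 ij.2| < e.
  apply: filter_forall => -[i j]/=.
  by have /cvgrPdist_lt/(_ _ e0) := fM i j.
apply: filterS => x h; apply/mx_norm_ltP => // i j.
by rewrite !mxE; exact: (h (i, j)).
Qed.

Lemma norm_mulmx_le m n k (A : 'M[R]_(m, n)) (B : 'M[R]_(n, k)) :
  `|A *m B| <= n%:R * `|A| * `|B|.
Proof.
apply/mx_norm_leP; first by rewrite !mulr_ge0.
move=> i j; rewrite mxE (le_trans (ler_norm_sum _ _ _))//.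
have -> : n%:R * `|A| * `|B| = \sum_(l < n) `|A| * `|B|.
  by rewrite sumr_const card_ord -mulrA mulr_natl.
by apply: ler_sum => l _; rewrite normrM ler_pM// mx_norm_entry.
Qed.

End matrix_norm.

Lemma lipschitz_continuous (R : realType) (V : normedModType R) (f : V -> R) (L : R) :
  0 <= L -> (forall x y, `|f x - f y| <= L * `|x - y|) -> continuous f.
Proof.
move=> L0 fL x; have L1 : 0 < L + 1 by rewrite ltr_wpDl.
apply/cvgrPdist_lt => e e0; near=> y.
rewrite (le_lt_trans (fL _ _))//.
apply: (@le_lt_trans _ _ ((L + 1) * `|x - y|)); first by rewrite ler_wpM2r// lerDl.
rewrite -ltr_pdivlMl// mulrC; near: y.
have := nbhsx_ballx x _ (divr_gt0 e0 L1).
by apply: filterS => z; rewrite -ball_normE.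
Unshelve. all: by end_near. Qed.

(** An open set is the union of the balls that it contains among those with
    center in a countable dense family and radius [1 / j]. The family [S] plays
    the part of the sigma-algebra, so that one proof serves for matrices and
    for pairs of matrices. *)
Lemma open_in_sigma (R : realType) (T : pseudoMetricType R)
    (S : set (set T)) (q : nat -> T) :
  S set0 ->
  (forall F : nat -> set T, (forall i, S (F i)) -> S (\bigcup_i F i)) ->
  (forall x e, 0 < e -> exists k, ball (q k) e x) ->
  (forall k e, 0 < e -> S (ball (q k) e)) ->
  forall U, open U -> S U.
Proof.
move=> S0 SU qd Sb U oU.
pose r j : R := j.+1%:R^-1.
pose F (n : nat) : set T := if unpickle n is Some (k, j) then
  if `[< ball (q k) (r j) `<=` U >] then ball (q k) (r j) else set0 else set0.
have -> : U = \bigcup_n F n.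
  apply/seteqP; split => [x Ux|x [n _]]; last first.
    by rewrite /F; case: unpickle => [[k j]|//]; case: asboolP => // h /h.
  have /nbhs_ballP[e/= e0 eU] : nbhs x U by exact: open_nbhs_nbhs.
  have [j je] : exists j, r j < e / 2.
    have /ltr_add_invr[j] : 0 < e / 2 by rewrite divr_gt0.
    by rewrite add0r => je; exists j.
  have r0 : 0 < r j by rewrite invr_gt0.
  have [k kx] := qd x _ r0.
  exists (pickle (k, j)) => //; rewrite /F pickleK; case: asboolP => // -[].
  move=> y ky; apply: eU; apply: (@le_ball _ _ _ (r j + r j)).
    by rewrite (splitr e) ltW// ltrD.
  by apply: ball_triangle ky; exact: ball_sym.
apply: SU => n; rewrite /F; case: unpickle => [[k j]|//].
by case: asboolP => // _; apply: Sb; rewrite invr_gt0.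
Qed.

Definition rat_mx (R : realType) m n (k : nat) : 'M[R]_(m, n) :=
  if unpickle k is Some M then map_mx ratr (M : 'M[rat]_(m, n)) else 0.

Lemma rat_mx_dense (R : realType) m n (x : 'M[R]_(m, n)) (e : R) : 0 < e ->
  exists k, ball (rat_mx R m n k) e x.
Proof.
move=> e0.
have /choice[g gP] : forall ij : 'I_m * 'I_n, exists a : rat,
    `|ratr a - x ij.1 ij.2| < e.
  move=> [i j]; have : x i j - e < x i j + e by rewrite ltrD2l gtrN.
  move=> /rat_in_itvoo[a]; rewrite in_itv/= => /andP[h1 h2].
  by exists a; rewrite distrC ltr_distlC h1.
exists (pickle (\matrix_(i, j) g (i, j) : 'M[rat]_(m, n))).
rewrite /rat_mx pickleK -ball_normE/=; apply/mx_norm_ltP => // i j.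
by rewrite !mxE; exact: (gP (i, j)).
Qed.

Lemma measurable_mx_ball (R : realType) m n (M : 'M[R]_(m, n)) (e : R) :
  0 < e -> measurable (ball M e).
Proof.
move=> e0; have -> : ball M e = \bigcap_(ij in [set: 'I_m * 'I_n])
    ((fun A : 'M[R]_(m, n) => A ij.1 ij.2) @^-1` ball (M ij.1 ij.2) e).
  rewrite -!ball_normE/=; apply/seteqP; split => [A/= /mx_norm_ltP h [i j] _|].
    by rewrite /= ; have := h e0 i j; rewrite !mxE.
  move=> A/= h; apply/mx_norm_ltP => // i j; rewrite !mxE.
  exact: (h (i, j) Logic.I).
apply: fin_bigcap_measurable; first exact: finite_finset.
move=> ij _; rewrite -[X in measurable X]setTI.
apply: (measurable_entry ij.1 ij.2 measurableT).
by apply: open_measurable; exact: ball_open.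
Qed.

Lemma open_measurable_mx (R : realType) m n (U : set 'M[R]_(m, n)) :
  open U -> measurable U.
Proof.
apply: (open_in_sigma (q := rat_mx R m n)) => //.
- exact: bigcupT_measurable.
- exact: rat_mx_dense.
- by move=> k e; exact: measurable_mx_ball.
Qed.

Lemma closed_measurable_mx (R : realType) m n (U : set 'M[R]_(m, n)) :
  closed U -> measurable U.
Proof.
by move=> cU; rewrite -(setCK U); apply: measurableC; apply: open_measurable_mx; exact: closed_openC.
Qed.

Lemma compact_measurable_mx (R : realType) m n (K : set 'M[R]_(m, n)) :
  compact K -> measurable K.
Proof.
move=> cK; apply: closed_measurable_mx; exact: compact_closed.
Qed.

Lemma open_measurable_mx_pair (R : realType) m n m' n'
    (U : set ('M[R]_(m, n) * 'M[R]_(m', n'))) : open U -> measurable U.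
Proof.
pose q k := if unpickle k is Some (i, j) then
  (rat_mx R m n i, rat_mx R m' n' j) else (0, 0).
apply: (open_in_sigma (q := q)) => //.
- exact: bigcupT_measurable.
- move=> [x y] e e0; have [i ix] := rat_mx_dense x e0.
  have [j jy] := rat_mx_dense y e0.
  by exists (pickle (i, j)); rewrite /q pickleK.
- move=> k e e0; rewrite (_ : ball _ _ = ball (q k).1 e `*` ball (q k).2 e)//.
  by apply: measurableX; exact: measurable_mx_ball.
Qed.

Lemma within_continuous_measurable_mx (R : realType) m n (D : set 'M[R]_(m, n))
    (f : 'M[R]_(m, n) -> R) :
  measurable D -> {within D, continuous f} -> measurable_fun D f.
Proof.
move=> mD /continuousP cf; apply: (measurability _ (RGenOpens.measurableE R)).
move=> _ [_ [a [b ->] <-]].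
have /open_subspaceP[V oV] := cf _ (@interval_open R (BRight a) (BLeft b) isT isT).
move=> VD; rewrite setIC; have -> : f @^-1` `]a, b[ `&` D = V `&` D by [].
apply: measurableI => //.
exact: open_measurable_mx.
Qed.

Lemma continuous_measurable_mx (R : realType) m n (f : 'M[R]_(m, n) -> R) :
  continuous f -> measurable_fun setT f.
Proof.
move=> cf; apply: within_continuous_measurable_mx => //.
exact: continuous_subspaceT.
Qed.

Lemma within_continuous_measurable_mx_pair (R : realType) m n m' n'
    (D : set ('M[R]_(m, n) * 'M[R]_(m', n'))) (f : _ -> R) :
  measurable D -> {within D, continuous f} -> measurable_fun D f.
Proof.
move=> mD /continuousP cf; apply: (measurability _ (RGenOpens.measurableE R)).
move=> _ [_ [a [b ->] <-]].
have /open_subspaceP[V oV] := cf _ (@interval_open R (BRight a) (BLeft b) isT isT).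
move=> VD; rewrite setIC; have -> : f @^-1` `]a, b[ `&` D = V `&` D by [].
apply: measurableI => //.
exact: open_measurable_mx_pair.
Qed.

(** * Independence of generated sigma-algebras *)

Section independence.
Context {dO : measure_display} {Omega : measurableType dO} {R : realType}.
Variable P : probability Omega R.
Local Open Scope ereal_scope.

(** Dynkin's argument: the events independent of [B] form a lambda-system. *)
Lemma indep_g_sigma (G : set (set Omega)) (B : set Omega) :
  setI_closed G -> G `<=` measurable -> measurable B ->
  (forall A, G A -> P (A `&` B) = P A * P B) ->
  forall A, <<s G >> A -> P (A `&` B) = P A * P B.
Proof.
move=> GI Gm mB GB.
pose H := [set A | measurable A /\ P (A `&` B) = P A * P B].
suff HG : <<s G >> `<=` H by move=> A /HG[].
apply: lambda_system_subset => //; last by move=> A GA; split; [exact: Gm|exact: GB].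
split => //.
- by split => //; rewrite setTI probability_setT mul1e.
- move=> A C CA [mA PA] [mC PC]; split; first exact: measurableD.
  rewrite (_ : (A `\` C) `&` B = (A `&` B) `\` (C `&` B)); last first.
    apply/seteqP; split => [x [[Ax nC] Bx]|x [[Ax Bx] nC]].
      by split => // -[].
    by do 2?split => //; move=> Cx; exact: nC.
  have mCB : measurable (C `&` B) by exact: measurableI.
  have mAB : measurable (A `&` B) by exact: measurableI.
  rewrite measureD//; last by rewrite (le_lt_trans (probability_le1 P mAB))// ltry.
  rewrite measureD//; last by rewrite (le_lt_trans (probability_le1 P mA))// ltry.
  have -> : A `&` B `&` (C `&` B) = C `&` B.
    by apply/setIidr; apply: setSI.
  rewrite (setIidr CA) [X in X - _]PA [X in _ - X]PC.
  rewrite muleBl//; first exact: fin_num_measure.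
  by rewrite fin_num_adde_defr//; exact: fin_num_measure.
- move=> F ndF FH; have mF i : measurable (F i) by have [] := FH i.
  split; first exact: bigcupT_measurable.
  have c1 : P (F n `&` B) @[n --> \oo] --> P (\bigcup_n F n `&` B).
    rewrite setI_bigcupl; apply: nondecreasing_cvg_mu.
    - by move=> i; exact: measurableI.
    - by apply: bigcupT_measurable => i; exact: measurableI.
    - by move=> m n mn; apply/subsetPset; apply: setSI; apply/subsetPset/ndF.
  have c2 : P (F n) * P B @[n --> \oo] --> P (\bigcup_n F n) * P B.
    apply: cvgeZr; first exact: fin_num_measure.
    by apply: nondecreasing_cvg_mu => //; exact: bigcupT_measurable.
  rewrite (_ : (fun n => P (F n) * P B) = (fun n => P (F n `&` B))) in c2.
    exact: cvg_unique c1 c2.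
  by apply/funext => n; have [_ ->] := FH n.
Qed.

Context (I : eqType) (X : I -> Omega -> R).
Hypothesis mX : forall i, measurable_fun setT (X i).

(** The pi-system generating sigma(X_i, i in s) on which mutual independence is
    the product rule. *)
Definition cylinders (s : seq I) : set (set Omega) :=
  [set \bigcap_(i in [set` s]) (X i @^-1` A i) | A in
     [set A : I -> set R | forall i, measurable (A i)]].

Lemma measurable_cylinder s : cylinders s `<=` measurable.
Proof.
move=> _ [A mA <-]; apply: fin_bigcap_measurable => //.
by move=> i _; rewrite -[X in measurable X]setTI; exact: mX.
Qed.

Lemma cylinders_setI s : setI_closed (cylinders s).
Proof.
move=> _ _ [A mA <-] [B mB <-]; exists (fun i => A i `&` B i).
  by move=> i; exact: measurableI.
by rewrite -bigcapI.
Qed.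

Lemma preimages_of_cylinders (s : seq I) :
  preimages_of [set` s] X `<=` cylinders s.
Proof.
move=> _ [i si [B mB <-]]; exists (fun j => if j == i then B else setT).
  by move=> j; case: ifP.
rewrite setTI; apply/seteqP; split => [w /(_ i si)/=|w /= Bw j _].
  by rewrite eqxx.
by rewrite /=; case: eqVneq => // ->.
Qed.

(** Dynkin's argument is applied once to each of the two sigma-algebras. *)
Lemma mutual_indep_sigma (s1 s2 : seq I) : mutual_indep P X ->
  uniq (s1 ++ s2) ->
  forall A B, <<s preimages_of [set` s1] X >> A ->
    <<s preimages_of [set` s2] X >> B -> P (A `&` B) = P A * P B.
Proof.
move=> iX us A B sA sB.
have {}sA : <<s cylinders s1 >> A.
  exact: (sub_sigma_algebra2 (@preimages_of_cylinders s1)) sA.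
have {}sB : <<s cylinders s2 >> B.
  exact: (sub_sigma_algebra2 (@preimages_of_cylinders s2)) sB.
have sm s : <<s cylinders s >> `<=` measurable.
  apply: smallest_sub; last exact: measurable_cylinder.
  exact: sigma_algebra_measurable.
apply: (indep_g_sigma (@cylinders_setI s1) (@measurable_cylinder s1)) (sA).
  exact: (sm s2).
move=> C cC; rewrite setIC muleC.
apply: (indep_g_sigma (@cylinders_setI s2) (@measurable_cylinder s2)) (sB).
  exact: measurable_cylinder cC.
move=> D cD; rewrite setIC muleC.
case: cC => A1 mA1 <-; case: cD => A2 mA2 <-.
pose A3 i := if i \in s1 then A1 i else A2 i.
move: us; rewrite cat_uniq => /and3P[u1 s12 u2].
have e1 : \bigcap_(i in [set` s1]) X i @^-1` A1 i =
    \bigcap_(i in [set` s1]) X i @^-1` A3 i.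
  by apply: eq_bigcapr => i /= si; rewrite /A3 si.
have e2 : \bigcap_(i in [set` s2]) X i @^-1` A2 i =
    \bigcap_(i in [set` s2]) X i @^-1` A3 i.
  apply: eq_bigcapr => i /= si; rewrite /A3 ifN//.
  by apply: contra s12 => si1; apply/hasP; exists i.
have mA3 i : measurable (A3 i) by rewrite /A3; case: ifP.
rewrite e1 e2 !iX// -big_cat/= -iX//; last by rewrite cat_uniq u1 s12.
rewrite -bigcap_setU; congr (P (bigcap _ _)).
by apply/seteqP; split => i /=; rewrite mem_cat => /orP.
Qed.

End independence.

(** * Bounded measurable functions and independent variables *)

Section bounded_measurable.
Context d (T : measurableType d) (R : realType).
Implicit Types (D A : set T) (f g : T -> R).

Definition bounded_measurable D f :=
  measurable_fun D f /\ exists C, forall x, D x -> `|f x| <= C.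

Lemma bounded_measurableD D f g : bounded_measurable D f ->
  bounded_measurable D g -> bounded_measurable D (fun x => f x + g x).
Proof.
move=> [mf [C fC]] [mg [K gK]]; split; first exact: measurable_funD.
exists (C + K) => x Dx; rewrite (le_trans (ler_normD _ _))// lerD//.
  exact: fC.
exact: gK.
Qed.

Lemma bounded_measurableM D f g : bounded_measurable D f ->
  bounded_measurable D g -> bounded_measurable D (fun x => f x * g x).
Proof.
move=> [mf [C fC]] [mg [K gK]]; split; first exact: measurable_funM.
exists (C * K) => x Dx; rewrite normrM ler_pM//.
  exact: fC.
exact: gK.
Qed.

Lemma bounded_measurable_cst D (c : R) : bounded_measurable D (fun=> c).
Proof. by split; [exact: measurable_cst|exists `|c|]. Qed.

Lemma bounded_measurableN D f : bounded_measurable D f ->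
  bounded_measurable D (fun x => - f x).
Proof.
move=> [mf [C fC]]; split; first exact: measurableT_comp.
by exists C => x Dx; rewrite normrN; exact: fC.
Qed.

Lemma bounded_measurableB D f g : bounded_measurable D f ->
  bounded_measurable D g -> bounded_measurable D (fun x => f x - g x).
Proof. by move=> bf bg; exact/bounded_measurableD/bounded_measurableN. Qed.

Lemma bounded_measurable_norm D f : bounded_measurable D f ->
  bounded_measurable D (fun x => `|f x|).
Proof.
move=> [mf [C fC]]; split; first exact: measurableT_comp.
by exists C => x Dx; rewrite normr_id; exact: fC.
Qed.

Lemma bounded_measurable_indic D A : measurable A ->
  bounded_measurable D (\1_A : T -> R).
Proof.
move=> mA; split; first exact: measurable_indic.
by exists 1 => x Dx; rewrite indicE; case: (x \in A); rewrite ?normr1 ?normr0.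
Qed.

Lemma bounded_measurable_sum D (I : Type) (s : seq I) (F : I -> T -> R) :
  (forall i, bounded_measurable D (F i)) ->
  bounded_measurable D (fun x => \sum_(i <- s) F i x).
Proof.
move=> bF; elim: s => [|i s ih].
  by under eq_fun do rewrite big_nil; exact: bounded_measurable_cst.
by under eq_fun do rewrite big_cons; exact: bounded_measurableD.
Qed.

Variables (mu : {measure set T -> \bar R}) (D : set T).
Hypotheses (mD : measurable D) (muD : (mu D < +oo)%E).

Lemma bounded_measurable_integrable f : bounded_measurable D f ->
  mu.-integrable D (EFin \o f).
Proof.
move=> [mf [C fC]]; apply: measurable_bounded_integrable => //.
exists C; split; first exact: num_real.
by move=> y Cy x Dx; exact: (le_trans (fC x Dx) (ltW Cy)).
Qed.

Lemma Rintegral_dist f g h : bounded_measurable D f ->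
  bounded_measurable D g -> bounded_measurable D h ->
  (forall x, D x -> `|f x - g x| <= h x) ->
  `|\int[mu]_(x in D) f x - \int[mu]_(x in D) g x| <= \int[mu]_(x in D) h x.
Proof.
move=> bf bg bh fgh; rewrite -RintegralB//; try exact: bounded_measurable_integrable.
apply: le_trans.
  apply: le_normr_Rintegral => //.
  exact/bounded_measurable_integrable/bounded_measurableB.
apply: le_Rintegral => //; last exact: bounded_measurable_integrable.
exact/bounded_measurable_integrable/bounded_measurable_norm/bounded_measurableB.
Qed.

Lemma Rintegral_indic A : measurable A ->
  \int[mu]_(x in D) \1_A x = fine (mu (A `&` D)).
Proof. by move=> mA; rewrite /Rintegral integral_indic. Qed.

(** To be used with [A] a small set outside which [f] and [g] are close. *)
Lemma Rintegral_dist_indic f g (e C : R) A : measurable A ->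
  bounded_measurable D f -> bounded_measurable D g ->
  (forall x, D x -> `|f x - g x| <= e + C * \1_A x) ->
  `|\int[mu]_(x in D) f x - \int[mu]_(x in D) g x| <=
    e * fine (mu D) + C * fine (mu (A `&` D)).
Proof.
move=> mA bf bg fgh.
have b1 : bounded_measurable D (fun x => C * \1_A x).
  apply: bounded_measurableM; first exact: bounded_measurable_cst.
  exact: bounded_measurable_indic.
have b2 := bounded_measurable_cst D e.
have -> : e * fine (mu D) + C * fine (mu (A `&` D)) =
    \int[mu]_(x in D) (e + C * \1_A x).
  rewrite RintegralD//; try exact: bounded_measurable_integrable.
  rewrite Rintegral_cst// RintegralZl//; last first.
    exact/bounded_measurable_integrable/bounded_measurable_indic.
  by rewrite Rintegral_indic.
by apply: Rintegral_dist => //; exact: bounded_measurableD.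
Qed.

Lemma Rintegral_sum (I : Type) (s : seq I) (F : I -> T -> R) :
  (forall i, bounded_measurable D (F i)) ->
  \int[mu]_(x in D) (\sum_(i <- s) F i x) =
  \sum_(i <- s) \int[mu]_(x in D) F i x.
Proof.
move=> bF; elim: s => [|i s ih].
  under eq_Rintegral do rewrite big_nil.
  by rewrite Rintegral_cst// mul0r big_nil.
under eq_Rintegral do rewrite big_cons.
rewrite big_cons -ih RintegralD//; try exact: bounded_measurable_integrable.
exact/bounded_measurable_integrable/bounded_measurable_sum.
Qed.

End bounded_measurable.

Section indep_variables.
Context {dO : measure_display} {Omega : measurableType dO} {R : realType}.
Variable P : probability Omega R.

Definition indep_var d1 d2 (T1 : measurableType d1) (T2 : measurableType d2)
    (U : Omega -> T1) (V : Omega -> T2) :=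
  forall A B, measurable A -> measurable B ->
    P (U @^-1` A `&` V @^-1` B) = (P (U @^-1` A) * P (V @^-1` B))%E.

Lemma indep_var_comp d1 d2 (T1 : measurableType d1) (T2 : measurableType d2)
    d1' d2' (T1' : measurableType d1') (T2' : measurableType d2')
    (U : Omega -> T1) (V : Omega -> T2) (f : T1 -> T1') (g : T2 -> T2') :
  measurable_fun setT f -> measurable_fun setT g ->
  indep_var U V -> indep_var (f \o U) (g \o V).
Proof.
move=> mf mg UV A B mA mB; apply: (UV (f @^-1` A) (g @^-1` B)).
  by rewrite -[X in measurable X]setTI; exact: mf.
by rewrite -[X in measurable X]setTI; exact: mg.
Qed.

(** The law of an independent pair is the product of the two laws, so that
    Tonelli's theorem factors the expectation. *)
Lemma indep_var_Rintegral (U V : Omega -> R) :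
  bounded_measurable setT U -> bounded_measurable setT V ->
  (forall w, 0 <= U w) -> (forall w, 0 <= V w) -> indep_var U V ->
  \int[P]_w (U w * V w) = \int[P]_w U w * \int[P]_w V w.
Proof.
move=> bU bV U0 V0 UV; have [mU _] := bU; have [mV _] := bV.
have PT : (P setT < +oo)%E by rewrite probability_setT ltry.
pose Um : {RV P >-> R} := HB.pack U (isMeasurableFun.Build _ _ _ _ U mU).
pose Vm : {RV P >-> R} := HB.pack V (isMeasurableFun.Build _ _ _ _ V mV).
have mUV : measurable_fun setT (fun w => (U w, V w)) by exact: measurable_fun_pair.
pose W : {RV P >-> (R * R)%type} :=
  HB.pack (fun w => (U w, V w)) (isMeasurableFun.Build _ _ _ _ _ mUV).
pose h (x : R) : \bar R := (Num.max x 0)%:E.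
have mh : measurable_fun setT h.
  by apply/measurable_EFinP; exact: measurable_maxr.
have h0 x : (0 <= h x)%E by rewrite lee_fin le_max lexx orbT.
have hE x : 0 <= x -> h x = x%:E by move=> x0; rewrite /h max_l.
have hUV : (\int[P]_w (U w * V w)%:E =
    \int[P]_w (U w)%:E * \int[P]_w (V w)%:E)%E.
  transitivity (\int[P]_w ((fun z : R * R => h z.1 * h z.2) \o W) w)%E.
    by apply: eq_integral => w _ /=; rewrite !hE// EFinM.
  have mhh : measurable_fun setT (fun z : R * R => h z.1 * h z.2)%E.
    apply: emeasurable_funM; apply: measurableT_comp => //.
  rewrite -ge0_integral_distribution//; last by move=> z; exact: mule_ge0.
  rewrite (eq_measure_integral (distribution P Um \x distribution P Vm)%E); last first.
    move=> A mA _; symmetry.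
    apply: (@product_measure_unique _ _ _ _ _ (distribution P Um)
      (distribution P Vm) (distribution P W)) => //.
  rewrite fubini_tonelli1; [|exact: mhh|by move=> z; exact: mule_ge0].
  rewrite /fubini_F/=.
  under eq_integral do rewrite ge0_integralZl//.
  rewrite ge0_integralZr//; last by apply: integral_ge0.
  rewrite !ge0_integral_distribution//; congr (_ * _)%E.
    by apply: eq_integral => w _ /=; rewrite hE.
  by apply: eq_integral => w _ /=; rewrite hE.
rewrite /Rintegral hUV fineM//; apply: integrable_fin_num => //.
  exact: (bounded_measurable_integrable measurableT PT bU).
exact: (bounded_measurable_integrable measurableT PT bV).
Qed.

End indep_variables.

(** * Joint convergence in law of independent vectors *)

Lemma cvg_maxr (R : realType) (T : Type) (F : set_system T) {FF : Filter F}
    (f g : T -> R) (a b : R) :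
  f x @[x --> F] --> a -> g x @[x --> F] --> b ->
  Num.max (f x) (g x) @[x --> F] --> Num.max a b.
Proof.
move=> fa gb; under eq_cvg do rewrite maxr_absE.
rewrite maxr_absE; apply: cvgMr_tmp; apply: cvgD; first exact: cvgD.
by apply: cvg_norm; exact: cvgB.
Qed.

Lemma cvg_sumr (R : realType) (T I : Type) (F : set_system T) {FF : Filter F}
    (s : seq I) (f : I -> T -> R) (a : I -> R) :
  (forall i, f i x @[x --> F] --> a i) ->
  \sum_(i <- s) f i x @[x --> F] --> \sum_(i <- s) a i.
Proof.
move=> fa; elim: s => [|i s ih].
  by under eq_cvg do rewrite big_nil; rewrite big_nil; exact: cvg_cst.
by under eq_cvg do rewrite big_cons; rewrite big_cons; exact: cvgD.
Qed.

Section joint_law.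
Context {dO : measure_display} {Omega : measurableType dO} {R : realType}.
Variable P : probability Omega R.

Lemma P_setT_lty : (P setT < +oo)%E.
Proof. by rewrite probability_setT ltry. Qed.

Lemma cvg_in_law_Rintegral p (X : nat -> Omega -> 'cV[R]_p)
    (Y : Omega -> 'cV[R]_p) (f : 'cV[R]_p -> R) (C : R) :
  (forall N, measurable_fun setT (X N)) -> measurable_fun setT Y ->
  cvg_in_law P X Y -> continuous f -> (forall x, `|f x| <= C) ->
  \int[P]_w f (X N w) @[N --> \oo] --> \int[P]_w f (Y w).
Proof.
move=> mX mY XY cf fC.
have mf := continuous_measurable_mx cf.
have ifg (g : Omega -> 'cV[R]_p) : measurable_fun setT g ->
    P.-integrable setT (EFin \o (f \o g)).
  move=> mg; apply: bounded_measurable_integrable => //; first exact: P_setT_lty.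
  by split; [exact: measurableT_comp|exists C => w _; exact: fC].
apply: fine_cvg; rewrite fineK; last exact: integrable_fin_num (ifg _ mY).
have := XY f cf; rewrite unlock; apply.
exists C; split; first exact: num_real.
by move=> y Cy x _; exact: (le_trans (fC x) (ltW Cy)).
Qed.

Section bumps.
Context (p : nat) (dl : R).
Hypothesis dl_gt0 : 0 < dl.

Definition bump (j : nat) (h : 'cV[R]_p) : R :=
  Num.max 0 (2 * dl - `|h - rat_mx R p 1 j|).

(** The normalization by the maximum with [dl] makes the functions sum to 1
    only where some bump exceeds [dl], but keeps them continuous everywhere. *)
Definition partition_fun (n j : nat) (h : 'cV[R]_p) : R :=
  bump j h / Num.max dl (\sum_(i < n) bump i h).

Let D_gt0 n h : 0 < Num.max dl (\sum_(i < n) bump i h).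
Proof. by rewrite lt_max dl_gt0. Qed.

Lemma bump_ge0 j h : 0 <= bump j h.
Proof. by rewrite le_max lexx. Qed.

Lemma bump_continuous j : continuous (bump j).
Proof.
move=> h; set a := rat_mx R p 1 j.
suff : Num.max 0 (2 * dl - `|x - a|) @[x --> h] -->
    Num.max 0 (2 * dl - `|h - a|) by [].
apply: (@cvg_maxr _ _ (nbhs h)); first exact: cvg_cst.
apply: cvgB; first exact: cvg_cst.
by apply: cvg_norm; apply: cvgB; [exact: cvg_id|exact: cvg_cst].
Qed.

Lemma partition_fun_ge0 n j h : 0 <= partition_fun n j h.
Proof. by rewrite divr_ge0// ?bump_ge0// ltW. Qed.

Lemma partition_fun_continuous n j : continuous (partition_fun n j).
Proof.
move=> h; apply: continuousM; first exact: bump_continuous.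
apply: continuousV; first by rewrite gt_eqF.
apply: (@cvg_maxr _ _ (nbhs h)); first exact: cvg_cst.
by apply: (@cvg_sumr _ _ _ (nbhs h)) => i; exact: bump_continuous.
Qed.

Lemma partition_fun_sum_le1 n h : \sum_(j < n) partition_fun n j h <= 1.
Proof.
by rewrite -mulr_suml ler_pdivrMr// mul1r le_max lexx orbT.
Qed.

Lemma partition_fun_le1 n (j : 'I_n) h : partition_fun n j h <= 1.
Proof.
apply: le_trans (partition_fun_sum_le1 n h); rewrite (bigD1 j)//= lerDl.
by apply: sumr_ge0 => i _; exact: partition_fun_ge0.
Qed.

Lemma partition_fun_sum1 n (i : 'I_n) h : ball (rat_mx R p 1 i) dl h ->
  \sum_(j < n) partition_fun n j h = 1.
Proof.
rewrite -ball_normE/= distrC => hi.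
have bi : dl <= \sum_(j < n) bump j h.
  rewrite (bigD1 i)//= (@le_trans _ _ (bump i h))//.
    by rewrite le_max; apply/orP; right; lra.
  by rewrite lerDl; apply: sumr_ge0 => j _; exact: bump_ge0.
by rewrite -mulr_suml max_r// divff// gt_eqF// (lt_le_trans dl_gt0).
Qed.

Lemma partition_fun_near n j h : 2 * dl <= `|h - rat_mx R p 1 j| ->
  partition_fun n j h = 0.
Proof.
move=> hj; suff b0 : bump j h = 0 by rewrite /partition_fun b0 mul0r.
by rewrite /bump max_l// subr_le0.
Qed.

End bumps.

Context (p1 p2 : nat).
Implicit Types (U : Omega -> 'cV[R]_p1) (V : Omega -> 'cV[R]_p2).

Variables (f : 'cV[R]_p1 -> 'cV[R]_p2 -> R) (L : R).
Hypotheses (f01 : forall x y, 0 <= f x y <= 1) (L_ge0 : 0 <= L)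
  (fL : forall x y x' y', `|f x y - f x' y'| <= L * `|x - x'| + L * `|y - y'|).

Lemma lipschitz_continuous_pair :
  continuous (fun z : 'cV[R]_p1 * 'cV[R]_p2 => f z.1 z.2).
Proof.
apply: (@lipschitz_continuous _ ('cV[R]_p1 * 'cV[R]_p2)%type _ (L + L)).
  exact: addr_ge0.
move=> [x y] [x' y']; rewrite (le_trans (fL _ _ _ _))//= prod_normE mulrDl.
by apply: lerD; rewrite ler_wpM2l// le_max lexx ?orbT.
Qed.

Lemma lipschitz_continuous_r x : continuous (f x).
Proof.
apply: (lipschitz_continuous L_ge0) => y y'.
by rewrite (le_trans (fL _ _ _ _))// subrr normr0 mulr0 add0r.
Qed.

Lemma bounded_measurable_joint U V :
  measurable_fun setT U -> measurable_fun setT V ->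
  bounded_measurable setT (fun w => f (U w) (V w)).
Proof.
move=> mU mV; split; last first.
  by exists 1 => w _; rewrite ger0_norm; have /andP[] := f01 (U w) (V w).
have mf : measurable_fun setT (fun z : 'cV[R]_p1 * 'cV[R]_p2 => f z.1 z.2).
  apply: within_continuous_measurable_mx_pair => //.
  exact/continuous_subspaceT/lipschitz_continuous_pair.
exact: (measurableT_comp mf (measurable_fun_pair mU mV)).
Qed.

Lemma bounded_measurable_partition n dl j U : 0 < dl ->
  measurable_fun setT U ->
  (j < n)%N -> bounded_measurable setT (fun w => partition_fun dl n j (U w)).
Proof.
move=> dl0 mU jn; split.
  apply: measurableT_comp => //; apply: continuous_measurable_mx.
  exact: partition_fun_continuous.
exists 1 => w _; rewrite ger0_norm; last exact: partition_fun_ge0.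
exact: (@partition_fun_le1 _ _ dl0 n (Ordinal jn)).
Qed.

(** Where [partition_fun dl n j (U w)] is not zero, [U w] lies within [2 * dl] of
    the [j]-th center and may be replaced by it in [f]; the product of the two
    resulting variables then factors by independence. The last term is the price
    of the points that are far from the first [n] centers. *)
Lemma joint_law_approx n dl U V : 0 < dl ->
  measurable_fun setT U -> measurable_fun setT V -> indep_var P U V ->
  `|\int[P]_w f (U w) (V w) -
    \sum_(j < n) \int[P]_w partition_fun dl n j (U w) *
                 \int[P]_w f (rat_mx R p1 1 j) (V w)| <=
  2 * dl * L + \int[P]_w (1 - \sum_(j < n) partition_fun dl n j (U w)).
Proof.
move=> dl0 mU mV UV; pose a j := rat_mx R p1 1 j.
have bu (j : 'I_n) : bounded_measurable setT (fun w => partition_fun dl n j (U w)).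
  exact: bounded_measurable_partition.
have bf j : bounded_measurable setT (fun w => f (a j) (V w)).
  exact: (bounded_measurable_joint (measurable_cst (a j)) mV).
have bfUV := bounded_measurable_joint mU mV.
have PT := P_setT_lty.
have buf (j : 'I_n) : bounded_measurable setT
    (fun w => partition_fun dl n j (U w) * f (a j) (V w)).
  exact: bounded_measurableM.
have b1 : bounded_measurable setT (fun w => 1 - \sum_(j < n) partition_fun dl n j (U w)).
  apply: bounded_measurableB; first exact: bounded_measurable_cst.
  exact: bounded_measurable_sum.
have -> : \sum_(j < n) \int[P]_w partition_fun dl n j (U w) *
    \int[P]_w f (a j) (V w) =
    \int[P]_w \sum_(j < n) partition_fun dl n j (U w) * f (a j) (V w).
  rewrite Rintegral_sum//; apply: eq_bigr => j _.
  rewrite -indep_var_Rintegral//.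
  - by move=> w; exact: partition_fun_ge0.
  - by move=> w; have /andP[] := f01 (a j) (V w).
  - apply: (indep_var_comp _ _ UV).
      by apply: continuous_measurable_mx; exact: partition_fun_continuous.
    apply: (measurableT_comp (f := fun z : 'cV[R]_p1 * 'cV[R]_p2 => f z.1 z.2)
      (g := fun y => (a j, y))).
      apply: within_continuous_measurable_mx_pair => //.
      exact/continuous_subspaceT/lipschitz_continuous_pair.
    exact: measurable_fun_pair.
have -> : 2 * dl * L + \int[P]_w (1 - \sum_(j < n) partition_fun dl n j (U w)) =
    \int[P]_w (2 * dl * L + (1 - \sum_(j < n) partition_fun dl n j (U w))).
  have ic := bounded_measurable_integrable measurableT PT
    (bounded_measurable_cst setT (2 * dl * L)).
  have i1 := bounded_measurable_integrable measurableT PT b1.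
  have P1 : fine (P setT) = 1 by rewrite probability_setT.
  by rewrite [RHS]RintegralD// Rintegral_cst// [X in _ = _ * X + _]P1 mulr1.
apply: Rintegral_dist => //.
- exact: bounded_measurable_sum.
- by apply: bounded_measurableD => //; exact: bounded_measurable_cst.
move=> w _; set u := partition_fun dl n; set h := U w; set y := V w.
have u0 j : 0 <= u j h by exact: partition_fun_ge0.
have -> : f h y - \sum_(j < n) u j h * f (a j) y =
    \sum_(j < n) u j h * (f h y - f (a j) y) + (1 - \sum_(j < n) u j h) * f h y.
  under [in RHS]eq_bigr do rewrite mulrBr.
  by rewrite sumrB -mulr_suml mulrBl mul1r; ring.
apply: (le_trans (ler_normD _ _)); apply: lerD; last first.
  have s1 : 0 <= 1 - \sum_(j < n) u j h by rewrite subr_ge0 partition_fun_sum_le1.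
  have /andP[f0 f1] := f01 h y.
  by rewrite normrM (ger0_norm s1) (ger0_norm f0) ler_piMr.
apply: (le_trans (ler_norm_sum _ _ _)).
apply: (@le_trans _ _ (\sum_(j < n) u j h * (2 * dl * L))).
  apply: ler_sum => j _; rewrite normrM (ger0_norm (u0 j)).
  have [far|near] := leP (2 * dl) `|h - a j|.
    by rewrite /u partition_fun_near// !mul0r.
  rewrite ler_wpM2l// (le_trans (fL _ _ _ _))// subrr normr0 mulr0 addr0.
  by rewrite mulrC ler_wpM2r// ltW.
rewrite -mulr_suml ler_piMl ?partition_fun_sum_le1//.
by rewrite !mulr_ge0// ltW.
Qed.

(** A function of a pair of independent vectors is approximated by sums of
    products [u_j(x) g_j(y)], where the [u_j] form a partition of unity
    subordinate to small balls; each product converges by the convergence of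
    the two marginals. *)
Lemma cvg_in_law_joint (U_ : nat -> Omega -> 'cV[R]_p1)
    (V_ : nat -> Omega -> 'cV[R]_p2) U V :
  (forall N, measurable_fun setT (U_ N)) -> measurable_fun setT U ->
  (forall N, measurable_fun setT (V_ N)) -> measurable_fun setT V ->
  (forall N, indep_var P (U_ N) (V_ N)) -> indep_var P U V ->
  cvg_in_law P U_ U -> cvg_in_law P V_ V ->
  \int[P]_w f (U_ N w) (V_ N w) @[N --> \oo] --> \int[P]_w f (U w) (V w).
Proof.
move=> mU_ mU mV_ mV UV_ UV cU cV; apply/cvgrPdist_le => e e0.
pose dl := e / (8 * (L + 1)).
have L0 : 0 < L + 1 by rewrite ltr_wpDl.
have dl0 : 0 < dl by rewrite divr_gt0// mulr_gt0.
have dlL : 2 * dl * L <= e / 4.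
  rewrite /dl [leLHS](_ : _ = e / 4 * (L / (L + 1))); last by field; lra.
  apply: ler_piMr; first by rewrite divr_ge0// ltW.
  by rewrite ler_pdivrMr ?ltr_wpDl// mul1r lerDl.
pose A n := \bigcup_(j < n) (U @^-1` ball (rat_mx R p1 1 j) dl).
have mA n : measurable (A n).
  apply: bigcup_measurable => j _; rewrite -[X in measurable X]setTI.
  by apply: mU => //; exact: measurable_mx_ball.
(* Finitely many balls capture the limit U up to probability e / 8; this n is
   then fixed, and convergence in law carries the bound over to U_ N. *)
have [n An] : exists n, 1 - e / 8 <= fine (P (A n)).
  have : P (A n) @[n --> \oo] --> P (\bigcup_n A n).
    apply: nondecreasing_cvg_mu => //; first exact: bigcupT_measurable.
    move=> m n mn; apply/subsetPset => w [j /= jm jw].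
    by exists j => //=; exact: leq_trans mn.
  have -> : \bigcup_n A n = setT.
    apply/seteqP; split => // w _.
    by have [j jw] := rat_mx_dense (U w) dl0; exists j.+1 => //; exists j => /=.
  rewrite probability_setT => /fine_cvgP[_ /cvgrPdist_le/(_ (e / 8))].
  rewrite divr_gt0// => /(_ isT)[n _ /(_ n (leqnn n))] /=.
  by rewrite ler_norml => /andP[_ h]; exists n; lra.
pose r (U : Omega -> 'cV[R]_p1) := \int[P]_w (1 - \sum_(j < n) partition_fun dl n j (U w)).
have rU : r U <= e / 8.
  have -> : r U = \int[P]_w (1 - \sum_(j < n) partition_fun dl n j (U w)) by [].
  apply: (@le_trans _ _ (\int[P]_w \1_(~` A n) w)); last first.
    rewrite Rintegral_indic//; last exact: measurableC.
    rewrite setIT; apply: (@le_trans _ _ (fine (P (~` A n)))) => //.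
    rewrite probability_setC// fineB//; last exact: fin_num_measure.
    by rewrite /=; lra.
  apply: le_Rintegral => //.
  - apply: bounded_measurable_integrable => //; first exact: P_setT_lty.
    apply: bounded_measurableB; first exact: bounded_measurable_cst.
    by apply: bounded_measurable_sum => j; exact: bounded_measurable_partition.
  - apply: bounded_measurable_integrable => //; first exact: P_setT_lty.
    by apply: bounded_measurable_indic; exact: measurableC.
  - move=> w _; rewrite indicE; case: (boolP (w \in _)) => [_|].
      rewrite lerBlDr lerDl; apply: sumr_ge0 => j _; exact: partition_fun_ge0.
    rewrite notin_setE => /contrapT[j /= jn jw].
    by rewrite (@partition_fun_sum1 _ _ dl0 n (Ordinal jn))// subrr.
pose S (U : Omega -> 'cV[R]_p1) (V : Omega -> 'cV[R]_p2) :=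
  \sum_(j < n) \int[P]_w partition_fun dl n j (U w) *
               \int[P]_w f (rat_mx R p1 1 j) (V w).
have cr : r (U_ N) @[N --> \oo] --> r U.
  apply: (cvg_in_law_Rintegral (C := 1)
    (f := fun h => 1 - \sum_(j < n) partition_fun dl n j h)) => //.
    move=> h; apply: (@cvgB _ _ _ (nbhs h)); first exact: cvg_cst.
    by apply: (@cvg_sumr _ _ _ (nbhs h)) => j; exact: partition_fun_continuous.
  move=> h; rewrite ger0_norm ?subr_ge0 ?partition_fun_sum_le1//.
  by rewrite lerBlDr lerDl; apply: sumr_ge0 => j _; exact: partition_fun_ge0.
have cS : S (U_ N) (V_ N) @[N --> \oo] --> S U V.
  apply: cvg_sumr => j; apply: cvgM.
    apply: (cvg_in_law_Rintegral (C := 1)) => //.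
      exact: partition_fun_continuous.
    by move=> h; rewrite ger0_norm ?partition_fun_ge0 ?partition_fun_le1.
  apply: (cvg_in_law_Rintegral (C := 1)) => //; last first.
    by move=> y; rewrite ger0_norm; have /andP[] := f01 (rat_mx R p1 1 j) y.
  exact: lipschitz_continuous_r.
near=> N.
have a1 := joint_law_approx n dl0 mU mV UV.
have a2 := joint_law_approx n dl0 (mU_ N) (mV_ N) (UV_ N).
have a3 : `|S U V - S (U_ N) (V_ N)| <= e / 8.
  by near: N; move/cvgrPdist_le : cS; apply; rewrite divr_gt0.
have a4 : `|r U - r (U_ N)| <= e / 8.
  by near: N; move/cvgrPdist_le : cr; apply; rewrite divr_gt0.
move: a1 a2 a3 a4; rewrite -/(r U) -/(r (U_ N)) -/(S U V) -/(S (U_ N) (V_ N)).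
rewrite !ler_norml.
move: (\int[P]_w f (U w) (V w)) (\int[P]_w f (U_ N w) (V_ N w)) => x y.
move: (S U V) (S (U_ N) (V_ N)) (r U) (r (U_ N)) rU => s1 s2 r1 r2 rU.
move=> /andP[? ?] /andP[? ?] /andP[? ?] /andP[? ?].
apply/andP; split; lra.
Unshelve. all: by end_near. Qed.

End joint_law.

(** * The positive semidefinite square root *)

Lemma interpolation (F : fieldType) (g : F -> F) (s : seq F) :
  exists q : {poly F}, {in s, forall x, q.[x] = g x}.
Proof.
elim: s => [|x s [q qs]]; first by exists 0.
have [xs|xs] := boolP (x \in s).
  by exists q => y; rewrite inE => /predU1P[->|]; exact: qs.
pose r := \prod_(y <- s) ('X - y%:P).
have rx : r.[x] != 0 by rewrite -rootE root_prod_XsubC.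
exists (q + ((g x - q.[x]) / r.[x])%:P * r) => y; rewrite inE !hornerE.
move=> /predU1P[->|ys]; first by rewrite divfK// addrC subrK.
have /eqP -> : r.[y] == 0 by rewrite -rootE root_prod_XsubC.
by rewrite mulr0 addr0 qs.
Qed.

Section spectrum.
Context {R : realType}.
Import spectral sesquilinear complex.

(** A real symmetric matrix is annihilated by every polynomial that vanishes
    on its (real) spectrum: it is diagonalizable over the complex numbers, with
    real eigenvalues. *)
Lemma symmetric_horner_mx_eq0 n (A : 'M[R]_n.+1) : A^T = A ->
  exists s : seq R, {in s, forall a, eigenvalue A a} /\
    forall r : {poly R}, {in s, forall a, r.[a] = 0} -> horner_mx A r = 0.
Proof.
move=> symA; pose fc := real_complex R.
pose A' : 'M[R[i]]_n.+1 := map_mx fc A.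
have rA' : A' \is a realmx.
  by apply/mxOverP => i j; rewrite mxE complex_real.
have sA' : A' \is symmetricmx.
  apply/is_hermitianmxP; rewrite expr0 scale1r map_mx_id//.
  by rewrite /A' -{1}symA map_trmx.
have hA' := realsym_hermsym sA' rA'.
have /orthomx_spectralP := symmetric_normalmx sA' rA'.
have /mxOverP := hermitian_spectral_diag_real hA'.
have := spectral_unit A'.
move: (spectralmx A') (spectral_diag A') => P sp Pu sp_real A'E.
pose l i := complex.Re (sp 0 i).
have spE i : sp 0 i = fc (l i) by rewrite /fc RRe_real.
exists [seq l i | i <- enum 'I_n.+1]; split.
  move=> _ /mapP[i _ ->]; rewrite -(eigenvalue_map fc).
  apply/eigenvalueP; exists (row i P); last first.
    by apply/eqP => /(congr1 (mulmx^~ (invmx P))); rewrite -row_mul mulmxV// row1 mul0mx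
      => /matrixP/(_ 0 i); rewrite !mxE !eqxx => /eqP; rewrite oner_eq0.
  rewrite -/A' [in LHS]A'E -row_mul mulmxA mulmxA mulmxV// mul1mx.
  by rewrite row_mul row_diag_mx -scalemxAl -rowE spE.
move=> r rs; apply/eqP; rewrite -(map_mx_eq0 fc); apply/eqP.
rewrite map_horner_mx -/A' [X in horner_mx X _]A'E.
rewrite (@horner_mx_uconjC _ _ (map_poly fc r) P (diag_mx sp) Pu).
rewrite horner_mx_diag (_ : map_mx _ _ = 0) ?raddf0 ?mulmx0 ?mul0mx//.
apply/rowP => i; rewrite !mxE spE horner_map /=.
by rewrite rs ?rmorph0//; apply: map_f; rewrite mem_enum.
Qed.

End spectrum.

Section square_root.
Context {R : realType} {p : nat}.
Implicit Types (A B C D M : 'M[R]_p) (v : 'cV[R]_p).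

Lemma tr_mulmx_sum m n (M : 'M[R]_(m, n)) : \tr (M^T *m M) = \sum_i \sum_j M j i ^+ 2.
Proof.
apply: eq_bigr => i _; rewrite mxE; apply: eq_bigr => j _.
by rewrite mxE expr2.
Qed.

Lemma sqr_entry_le_tr m n (M : 'M[R]_(m, n)) i j : M i j ^+ 2 <= \tr (M^T *m M).
Proof.
rewrite tr_mulmx_sum (bigD1 j)//= (bigD1 i)//= -addrA lerDl addr_ge0//.
  by apply: sumr_ge0 => k _; exact: sqr_ge0.
by apply: sumr_ge0 => k _; apply: sumr_ge0 => l _; exact: sqr_ge0.
Qed.

Lemma mulmx_tr_eq0 m n (M : 'M[R]_(m, n)) : M^T *m M = 0 -> M = 0.
Proof.
move=> M0; apply/matrixP => i j; rewrite mxE; apply/eqP; rewrite -sqrf_eq0.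
by rewrite eq_le sqr_ge0 andbT -(@mxtrace0 R n) -M0 sqr_entry_le_tr.
Qed.

Lemma tr_psd M : psd M -> 0 <= \tr M.
Proof.
move=> [_ M0]; apply: sumr_ge0 => i _; have := M0 (delta_mx i 0).
by rewrite trmx_delta -rowE -colE !mxE.
Qed.

Lemma psd_conj M (N : 'M[R]_p) : psd M -> psd (N^T *m M *m N).
Proof.
move=> [sM M0]; split; first by rewrite !trmx_mul trmxK sM mulmxA.
by move=> v; have := M0 (N *m v); rewrite trmx_mul !mulmxA.
Qed.

(** The diagonal vanishes, and then the values of the quadratic form at
    [e_i + e_j] and [e_i - e_j] have opposite signs. *)
Lemma psd_tr0 M : psd M -> \tr M = 0 -> M = 0.
Proof.
move=> [sM M0] tM.
have d0 i : 0 <= M i i.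
  by have := M0 (delta_mx i 0); rewrite trmx_delta -rowE -colE !mxE.
have di i : M i i = 0.
  by apply: (psumr_eq0P (P := xpredT) (F := fun i => M i i)) => //.
have q (a b : R) i j : 0 <= a * b * M i j *+ 2.
  have := M0 (a *: delta_mx i 0 + b *: delta_mx j 0).
  rewrite [(_ + _)^T]linearD/= ![(_ *: _)^T]linearZ/= !trmx_delta !mulmxDl !mulmxDr.
  rewrite -!scalemxAl -!scalemxAr -!rowE -!colE !mxE !di.
  have -> : M j i = M i j by rewrite -[in LHS]sM mxE.
  by congr (_ <= _); ring.
apply/matrixP => i j; rewrite mxE; apply/eqP; rewrite eq_le.
have := q 1 1 i j; have := q 1 (- 1) i j.
by rewrite mulrN1 !mul1r mulN1r mulNrn oppr_ge0 !pmulrn_lge0 ?pmulrn_lle0// => -> ->.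
Qed.

(** If [B^2 = C^2] and [D = B - C] then [DB + CD = 0], so the traces of the
    positive semidefinite matrices [DBD] and [DCD] add up to zero. *)
Lemma psd_sqr_inj B C : psd B -> psd C -> B *m B = C *m C -> B = C.
Proof.
move=> pB pC BC; apply/eqP; rewrite -subr_eq0; apply/eqP.
set D := B - C; have sD : D^T = D.
  by rewrite /D linearB/=; case: pB => -> _; case: pC => -> _.
have DBC : D *m B + C *m D = 0.
  by rewrite mulmxBl mulmxBr BC addrC subrKA subrr.
have t0 : \tr (D *m B *m D) + \tr (D *m C *m D) = 0.
  by rewrite mxtrace_mulC -mulmxA -linearD/= -mulmxDr DBC mulmx0 linear0.
have pDBD : psd (D *m B *m D) by rewrite -[X in X *m B]sD; exact: psd_conj.
have pDCD : psd (D *m C *m D) by rewrite -[X in X *m C]sD; exact: psd_conj.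
move/eqP: t0; rewrite paddr_eq0 ?tr_psd// => /andP[/eqP tB /eqP tC].
have D3 : D *m D *m D = 0.
  have -> : D *m D *m D = D *m B *m D - D *m C *m D.
    by rewrite -mulmxBl -mulmxBr.
  by rewrite (psd_tr0 pDBD tB) (psd_tr0 pDCD tC) subrr.
apply: mulmx_tr_eq0; rewrite sD; apply: mulmx_tr_eq0.
by rewrite trmx_mul sD mulmxA D3 mul0mx.
Qed.

Lemma sqrtmxP A : (exists B, psd B /\ B *m B = A) ->
  psd (sqrtmx A) /\ sqrtmx A *m sqrtmx A = A.
Proof.
by move=> ex; rewrite /sqrtmx; case: xgetP => [B _ //|no]; case: ex => B /no.
Qed.

Lemma sqrtmx_eq A B : psd B -> B *m B = A -> sqrtmx A = B.
Proof.
move=> pB BA; have [|pS SA] := @sqrtmxP A; first by exists B.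
by apply: psd_sqr_inj => //; rewrite SA.
Qed.

End square_root.

Lemma trmx_horner_mx (R : comNzRingType) n (A : 'M[R]_n.+1) (q : {poly R}) :
  (horner_mx A q)^T = horner_mx A^T q.
Proof.
elim/poly_ind: q => [|q c ih]; first by rewrite !rmorph0 trmx0.
rewrite !(rmorphD, rmorphM)/= !(horner_mx_X, horner_mx_C).
rewrite linearD/= trmx_mul ih tr_scalar_mx; congr (_ + _).
exact: comm_mx_horner.
Qed.

Lemma psd_mulmx_sym (R : realType) p (B : 'M[R]_p) : B^T = B -> psd (B *m B).
Proof.
move=> sB; split; first by rewrite trmx_mul sB.
move=> v; rewrite -{1}sB mulmxA -trmx_mul -mulmxA mxE.
by apply: sumr_ge0 => i _; rewrite mxE -expr2 sqr_ge0.
Qed.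

Lemma eigenvalue_psd_ge0 (R : realType) p (A : 'M[R]_p) a :
  psd A -> eigenvalue A a -> 0 <= a.
Proof.
move=> [_ pA] /eigenvalueP[v vA v0]; have := pA v^T.
rewrite trmxK vA -scalemxAl mxE pmulr_lge0// mxE.
have [i vi] : exists i, v 0 i != 0 by apply/rV0Pn.
rewrite (bigD1 i)//= ltr_pwDl//; first by rewrite mxE -expr2 exprn_even_gt0.
by apply: sumr_ge0 => j _; rewrite mxE -expr2 sqr_ge0.
Qed.

(** The root is a polynomial in [A]: interpolate the fourth root on the
    spectrum and square, which makes positivity evident. *)
Lemma psd_sqrt_exists (R : realType) p (A : 'M[R]_p) : psd A ->
  exists B : 'M[R]_p, [/\ B^T = B, psd (B *m B) & B *m B *m (B *m B) = A].
Proof.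
case: p A => [|p] A pA.
  exists 0; split; [exact: flatmx0| |by rewrite [LHS]flatmx0 [RHS]flatmx0].
  by split; [rewrite [LHS]flatmx0 [RHS]flatmx0|move=> v; rewrite (flatmx0 v) mulmx0 mxE].
have sA : A^T = A by case: pA.
have [s [sA_eig s0]] := symmetric_horner_mx_eq0 sA.
have [q qs] := interpolation (fun a => Num.sqrt (Num.sqrt a)) s.
exists (horner_mx A q); split.
- by rewrite trmx_horner_mx sA.
- by apply: psd_mulmx_sym; rewrite trmx_horner_mx sA.
have : horner_mx A (q * q * (q * q) - 'X) = 0.
  apply: s0 => a sa; rewrite hornerD hornerN hornerX !hornerM qs//.
  have a0 : 0 <= a by apply: (eigenvalue_psd_ge0 pA); exact: sA_eig.
  have E (x : R) : x * x * (x * x) = (x ^+ 2) ^+ 2 by ring.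
  by rewrite E sqr_sqrtr ?sqrtr_ge0// sqr_sqrtr// subrr.
by rewrite rmorphB/= horner_mx_X !rmorphM/= => /subr0_eq.
Qed.

Lemma sqrtmx_psdP (R : realType) p (A : 'M[R]_p) : psd A ->
  exists2 B : 'M[R]_p, B^T = B &
    sqrtmx A = B *m B /\ psd (B *m B) /\ B *m B *m (B *m B) = A.
Proof.
move=> pA; have [B [sB pB BA]] := psd_sqrt_exists pA.
by exists B => //; split => //; exact: sqrtmx_eq.
Qed.

(** * Continuity of the inverse square root *)

Section cvg_matrix.
Context {R : realType} {T : Type} {F : set_system T} {FF : Filter F}.

Lemma cvg_prodr (I : Type) (s : seq I) (f : I -> T -> R) (a : I -> R) :
  (forall i, f i x @[x --> F] --> a i) ->
  \prod_(i <- s) f i x @[x --> F] --> \prod_(i <- s) a i.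
Proof.
move=> fa; elim: s => [|i s ih].
  by under eq_cvg do rewrite big_nil; rewrite big_nil; exact: cvg_cst.
by under eq_cvg do rewrite big_cons; rewrite big_cons; exact: cvgM.
Qed.

Lemma cvg_mulmx m n k (f : T -> 'M[R]_(m, n)) (g : T -> 'M[R]_(n, k))
    (A : 'M[R]_(m, n)) (B : 'M[R]_(n, k)) :
  f x @[x --> F] --> A -> g x @[x --> F] --> B ->
  f x *m g x @[x --> F] --> A *m B.
Proof.
move=> /cvg_mxP fA /cvg_mxP gB; apply/cvg_mxP => i j.
under eq_cvg do rewrite mxE; rewrite mxE.
by apply: cvg_sumr => l; apply: cvgM; [exact: fA|exact: gB].
Qed.

Lemma cvg_trmx m n (f : T -> 'M[R]_(m, n)) (A : 'M[R]_(m, n)) :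
  f x @[x --> F] --> A -> (f x)^T @[x --> F] --> A^T.
Proof.
move=> /cvg_mxP fA; apply/cvg_mxP => i j.
by under eq_cvg do rewrite mxE; rewrite mxE; exact: fA.
Qed.

Lemma cvg_det n (f : T -> 'M[R]_n) (A : 'M[R]_n) :
  f x @[x --> F] --> A -> \det (f x) @[x --> F] --> \det A.
Proof.
move=> /cvg_mxP fA; apply: cvg_sumr => s; apply: cvgM; first exact: cvg_cst.
by apply: cvg_prodr => i; exact: fA.
Qed.

Lemma cvg_adj n (f : T -> 'M[R]_n) (A : 'M[R]_n) :
  f x @[x --> F] --> A -> \adj (f x) @[x --> F] --> \adj A.
Proof.
move=> /cvg_mxP fA; apply/cvg_mxP => i j.
under eq_cvg do rewrite mxE; rewrite mxE.
apply: cvgM; first exact: cvg_cst.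
apply: cvg_det; apply/cvg_mxP => k l.
by under eq_cvg do rewrite !mxE; rewrite !mxE; exact: fA.
Qed.

Lemma cvg_unitmx n (f : T -> 'M[R]_n) (A : 'M[R]_n) : A \in unitmx ->
  f x @[x --> F] --> A -> \forall x \near F, f x \in unitmx.
Proof.
rewrite unitmxE unitfE => A0 /cvg_det /cvgrPdist_lt/(_ `|\det A|).
rewrite normr_gt0 => /(_ A0); apply: filterS => x.
rewrite unitmxE unitfE; apply: contraTneq => ->.
by rewrite subr0 ltxx.
Qed.

Lemma cvg_invmx n (f : T -> 'M[R]_n) (A : 'M[R]_n) : A \in unitmx ->
  f x @[x --> F] --> A -> invmx (f x) @[x --> F] --> invmx A.
Proof.
move=> uA fA; have uf := cvg_unitmx uA fA.
have : (\det (f x))^-1 *: \adj (f x) @[x --> F] --> (\det A)^-1 *: \adj A.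
  apply: cvgZ; last exact: cvg_adj.
  by apply: cvgV; [move: uA; rewrite unitmxE unitfE|exact: cvg_det].
have -> : invmx A = (\det A)^-1 *: \adj A by rewrite /invmx uA.
apply: cvg_trans; apply: near_eq_cvg; apply: filterS uf => x ux.
by rewrite /invmx ux.
Qed.

End cvg_matrix.

Lemma psd_invmx (R : realType) p (A : 'M[R]_p) : A \in unitmx -> psd A ->
  psd (invmx A).
Proof.
move=> uA [sA pA]; split; first by rewrite trmx_inv sA.
move=> v; have := pA (invmx A *m v).
by rewrite trmx_mul trmx_inv sA !mulmxA -(mulmxA v^T (invmx A) A) mulVmx// mulmx1.
Qed.

Lemma mxtrace_le (R : realType) p (A : 'M[R]_p) : `|\tr A| <= p%:R * `|A|.
Proof.
apply: (le_trans (ler_norm_sum _ _ _)).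
apply: (@le_trans _ _ (\sum_(i < p) `|A|)).
  by apply: ler_sum => i _; exact: mx_norm_entry.
by rewrite sumr_const card_ord mulr_natl.
Qed.

(** At a positive definite matrix [S] the square root is Lipschitz: with
    [Q = sqrt S'], [C = sqrt S] and [D = Q - C] one has [S' - S = QD + DC],
    hence [tr (D (S' - S))] is at least [tr (DCD)], and the latter controls
    the square of [D] because [C] is invertible. *)
Lemma sqrtmx_lipschitz (R : realType) p (S : 'M[R]_p) : S \in unitmx -> psd S ->
  exists K, forall S', psd S' -> `|sqrtmx S' - sqrtmx S| <= K * `|S' - S|.
Proof.
move=> uS pS; have [B sB [CB [pC BS]]] := sqrtmx_psdP pS.
have uB : B \in unitmx.
  by move: uS; rewrite -BS !unitmx_mul andbA => /andP[/andP[]].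
pose M := (p%:R * `|invmx B|) ^+ 2; exists (M * (p%:R * (p%:R))) => S' pS'.
have [Q0 sQ0 [QE [pQ QS]]] := sqrtmx_psdP pS'.
rewrite QE CB; set Q := Q0 *m Q0; set C := B *m B; set D := Q - C.
have sD : D^T = D by rewrite /D linearB/=; case: pC => -> _; case: pQ => -> _.
have E : S' - S = Q *m D + D *m C.
  by rewrite -QS -BS mulmxBr mulmxBl addrA subrK.
have trE : \tr (D *m (S' - S)) = \tr (D *m Q *m D) + \tr (D *m C *m D).
  rewrite E mulmxDr mxtraceD mulmxA; congr (_ + _).
  by rewrite [in LHS]mulmxA -[RHS]mxtrace_mulC -!mulmxA.
have trC : \tr (D *m C *m D) <= p%:R * (p%:R * `|D| * `|S' - S|).
  apply: (@le_trans _ _ (\tr (D *m (S' - S)))).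
    rewrite trE lerDr; apply: tr_psd; rewrite -{1}sD; exact: psd_conj.
  apply: (le_trans (ler_norm _)); apply: (le_trans (mxtrace_le _)).
  by rewrite ler_wpM2l// norm_mulmx_le.
have DC : `|D| ^+ 2 <= M * \tr (D *m C *m D).
  pose W := B *m D; have DW : D = invmx B *m W by rewrite mulKmx.
  have -> : D *m C *m D = W^T *m W by rewrite /W trmx_mul sB sD !mulmxA.
  have trW0 : 0 <= \tr (W^T *m W).
    by rewrite tr_mulmx_sum; do 2 (apply: sumr_ge0 => ? _); exact: sqr_ge0.
  have W2 : `|W| ^+ 2 <= \tr (W^T *m W).
    rewrite -[leRHS]sqr_sqrtr// ler_sqr ?nnegrE ?sqrtr_ge0//.
    apply/mx_norm_leP; first exact: sqrtr_ge0.
    by move=> i j; rewrite -sqrtr_sqr ler_sqrt// sqr_entry_le_tr.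
  apply: (@le_trans _ _ ((p%:R * `|invmx B| * `|W|) ^+ 2)).
    rewrite ler_sqr ?nnegrE ?mulr_ge0//.
    by rewrite {1}DW norm_mulmx_le.
  by rewrite exprMn ler_wpM2l// sqr_ge0.
have [->|D0] := eqVneq D 0; first by rewrite normr0 !mulr_ge0// sqr_ge0.
have D0' : 0 < `|D| by rewrite normr_gt0.
rewrite -(ler_pM2r D0') -expr2 (le_trans DC)//.
apply: (@le_trans _ _ (M * (p%:R * (p%:R * `|D| * `|S' - S|)))).
  by rewrite ler_wpM2l// sqr_ge0.
by rewrite le_eqVlt; apply/orP; left; apply/eqP; ring.
Qed.

Lemma cvg_invsqrtmx (R : realType) (T : Type) (F : set_system T) {FF : Filter F}
    p (f : T -> 'M[R]_p) (A : 'M[R]_p) : A \in unitmx -> psd A ->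
  (\forall x \near F, psd (f x)) -> f x @[x --> F] --> A ->
  invsqrtmx (f x) @[x --> F] --> invsqrtmx A.
Proof.
move=> uA pA pf fA.
have uV : invmx A \in unitmx by rewrite unitmx_inv.
have [K KP] := sqrtmx_lipschitz uV (psd_invmx uA pA).
have uf : \forall x \near F, f x \in unitmx by exact: cvg_unitmx fA.
have cV : invmx (f x) @[x --> F] --> invmx A by exact: cvg_invmx.
apply/cvgrPdist_le => e e0.
have K1 : 0 < `|K| + 1 by rewrite ltr_wpDl.
have eK : 0 < e / (`|K| + 1) by rewrite divr_gt0.
have cVe : \forall x \near F, `|invmx A - invmx (f x)| < e / (`|K| + 1).
  exact: (cvgr_dist_lt _ _ cV _ eK).
near=> x.
have h : `|invmx A - invmx (f x)| < e / (`|K| + 1).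
  by near: x; exact: cVe.
have px : psd (invmx (f x)).
  by apply: psd_invmx; near: x.
rewrite distrC (le_trans (KP _ px))//.
apply: (@le_trans _ _ ((`|K| + 1) * `|invmx (f x) - invmx A|)).
  rewrite ler_wpM2r//.
  by rewrite (le_trans (ler_norm K))// lerDl.
by rewrite -ler_pdivlMl// mulrC distrC ltW.
Unshelve. all: by end_near. Qed.

(** * Measurability of the inverse square root *)

Lemma measurable_invr (R : realType) : measurable_fun setT (fun x : R => x^-1).
Proof.
have -> : [set: R] = [set x | x != 0] `|` [set 0].
  apply/seteqP; split => // x _; have [->|x0] := eqVneq x 0; first by right.
  by left.
have oD : open [set x : R | x != 0].
  rewrite (_ : [set x | _] = ~` [set 0]); first exact/closed_openC/closed_eq.
  by apply/seteqP; split => x /= /eqP.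
apply/measurable_funU => //; first exact: open_measurable.
split; last exact: measurable_fun_set1.
apply: open_continuous_measurable_fun => // x; rewrite inE/= => x0.
exact: inv_continuous.
Qed.

Section measurable_matrix_fun.
Context d (T : measurableType d) (R : realType).

Lemma measurable_fun_mxP m n (D : set T) (f : T -> 'M[R]_(m, n)) :
  measurable_fun D f <-> forall i j, measurable_fun D (fun t => f t i j).
Proof.
split => [mf i j|mf].
  exact: (measurableT_comp (measurable_entry i j) mf).
move=> mD; apply: (measurability (mx_entries_preimages)) => //.
move=> _ [_ [[i j] _ [A mA <-]] <-].
by have := mf i j mD A mA; rewrite setTI.
Qed.

Lemma measurable_mulmx m n k (D : set T) (f : T -> 'M[R]_(m, n)) (g : T -> 'M[R]_(n, k)) :
  measurable_fun D f -> measurable_fun D g ->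
  measurable_fun D (fun t => f t *m g t).
Proof.
move=> /measurable_fun_mxP mf /measurable_fun_mxP mg; apply/measurable_fun_mxP => i j.
under eq_fun do rewrite mxE.
by apply: measurable_sum => l; exact: measurable_funM.
Qed.

Lemma measurable_trmx m n (D : set T) (f : T -> 'M[R]_(m, n)) :
  measurable_fun D f -> measurable_fun D (fun t => (f t)^T).
Proof.
move=> /measurable_fun_mxP mf; apply/measurable_fun_mxP => i j.
by under eq_fun do rewrite mxE; exact: mf.
Qed.

Lemma measurable_scalemx m n (D : set T) (c : T -> R) (f : T -> 'M[R]_(m, n)) :
  measurable_fun D c -> measurable_fun D f ->
  measurable_fun D (fun t => c t *: f t).
Proof.
move=> mc /measurable_fun_mxP mf; apply/measurable_fun_mxP => i j.
by under eq_fun do rewrite mxE; exact: measurable_funM.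
Qed.

Lemma measurable_summx m n (D : set T) I (s : seq I) (f : I -> T -> 'M[R]_(m, n)) :
  (forall i, measurable_fun D (f i)) ->
  measurable_fun D (fun t => \sum_(i <- s) f i t).
Proof.
move=> mf; apply/measurable_fun_mxP => i j.
under eq_fun do rewrite summxE.
by apply: measurable_sum => l; have /measurable_fun_mxP := mf l; exact.
Qed.

End measurable_matrix_fun.

Lemma measurable_invmx (R : realType) p :
  measurable_fun setT (@invmx R p : 'M[R]_p -> 'M[R]_p).
Proof.
have mdet : measurable_fun setT (fun A : 'M[R]_p => \det A).
  apply: continuous_measurable_mx => A.
  by apply: (@cvg_det _ _ (nbhs A)); exact: cvg_id.
have madj : measurable_fun setT (fun A : 'M[R]_p => \adj A).
  apply/measurable_fun_mxP => i j; apply: continuous_measurable_mx => A.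
  have /cvg_mxP : \adj M @[M --> A] --> \adj A.
    by apply: (@cvg_adj _ _ (nbhs A)); exact: cvg_id.
  exact.
rewrite (_ : @invmx R p = fun A => if A \in unitmx then (\det A)^-1 *: \adj A else A)//.
apply: measurable_fun_ifT.
- rewrite (_ : (fun A => _) = (fun x : R => x != 0) \o (fun A => \det A)); last first.
    by apply/funext => A /=; rewrite unitmxE unitfE.
  apply: measurableT_comp => //; apply: (@measurable_fun_bool _ _ _ _ true).
  rewrite setTI; apply: open_measurable.
  rewrite (_ : _ @^-1` _ = ~` [set 0]); first exact/closed_openC/closed_eq.
  by apply/seteqP; split => x /=; [move=> /eqP|move=> /eqP ->].
- apply: measurable_scalemx => //.
  exact: (measurableT_comp (@measurable_invr R) mdet).
- exact: measurable_id.
Qed.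

(** The Heine-Borel theorem for row vectors, transported by [vec_mx]. *)
Lemma bounded_closed_compact_mx (R : realType) m n (K : set 'M[R]_(m, n)) (C : R) :
  closed K -> (forall M, K M -> `|M| <= C) -> compact K.
Proof.
move=> cK KC.
have cv : continuous (@vec_mx R m n).
  move=> v; apply/(@cvg_mxP _ _ (nbhs v)) => i j; under eq_cvg do rewrite mxE.
  by rewrite mxE; exact: coord_continuous.
have -> : K = @vec_mx R m n @` (vec_mx @^-1` K).
  apply/seteqP; split => [M KM|_ [v Kv <-]//].
  by exists (mxvec M); rewrite /= mxvecK.
apply: continuous_compact; first exact: continuous_subspaceT.
apply: bounded_closed_compact; last by apply: preimage_closed => // v _; exact: cv.
exists C; split; first exact: num_real.
move=> y Cy v /= /KC vC; apply/mx_norm_leP; first by rewrite (le_trans _ (ltW Cy))// (le_trans _ vC).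
move=> i j; rewrite (ord1 i); case/mxvec_indexP: j => k l.
have -> : v 0 (mxvec_index k l) = vec_mx v k l by rewrite mxE.
by rewrite (le_trans (mx_norm_entry _ _ _))// (le_trans vC)// ltW.
Qed.

Lemma psd_closed (R : realType) p : closed [set B : 'M[R]_p | psd B].
Proof.
have cq (u v : 'cV[R]_p) : continuous (fun B : 'M[R]_p => (u^T *m B *m v) 0 0).
  move=> B; have /cvg_mxP : u^T *m M *m v @[M --> B] --> u^T *m B *m v.
    apply: (@cvg_mulmx _ _ (nbhs B)); last exact: cvg_cst.
    by apply: (@cvg_mulmx _ _ (nbhs B)); [exact: cvg_cst|exact: cvg_id].
  exact.
have -> : [set B : 'M[R]_p | psd B] =
    \bigcap_(ij in [set: 'I_p * 'I_p])
      (fun B : 'M[R]_p => B ij.1 ij.2 - B ij.2 ij.1) @^-1` [set 0] `&`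
    \bigcap_(v in [set: 'cV[R]_p])
      (fun B : 'M[R]_p => (v^T *m B *m v) 0 0) @^-1` [set x | 0 <= x].
  apply/seteqP; split => [B [sB pB]|B [sB pB]].
    by split => [[i j] _ /=|v _]; [rewrite -{1}sB mxE subrr|exact: pB].
  split; last by move=> v; exact: pB.
  by apply/matrixP => i j; rewrite mxE; apply/eqP; rewrite -subr_eq0; apply/eqP/(sB (j, i)).
apply: closedI; apply: closed_bigI => i _; apply: preimage_closed.
- move=> B _; apply: (@cvgB _ _ _ (nbhs B)); exact: coord_continuous.
- exact: closed_eq.
- by move=> B _; exact: cq.
- exact: closed_ge.
Qed.

(** Where a positive semidefinite root exists it is unique, so the matrices whose
    root has a given entry at least [x] form the image under squaring of a closed
    set of positive semidefinite matrices, which is a countable union of images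
    of compact sets. Elsewhere [sqrtmx] is 0. *)
Lemma measurable_sqrtmx (R : realType) p :
  measurable_fun setT (@sqrtmx R p : 'M[R]_p -> 'M[R]_p).
Proof.
pose sq (B : 'M[R]_p) := B *m B.
have csq : continuous sq.
  by move=> B; apply: (@cvg_mulmx _ _ (nbhs B)); exact: cvg_id.
have msq (L : set R) (i j : 'I_p) (C : R) : closed L ->
    measurable (sq @` [set B | psd B /\ L (B i j) /\ `|B| <= C]).
  move=> cL; apply: compact_measurable_mx; apply: continuous_compact.
    exact: continuous_subspaceT.
  apply: (@bounded_closed_compact_mx _ _ _ _ C); last by move=> M [_ []].
  rewrite (_ : [set _ | _] = [set B | psd B] `&`
      ((fun B : 'M[R]_p => B i j) @^-1` L `&`
       (fun B : 'M[R]_p => `|B|) @^-1` [set x | x <= C])); last first.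
    by apply/seteqP; split.
  apply: closedI; first exact: psd_closed.
  apply: closedI; apply: preimage_closed => //.
  - by move=> B _; exact: coord_continuous.
  - by move=> B _; exact: norm_continuous.
pose roots L i j := \bigcup_n (sq @` [set B | psd B /\ L (B i j) /\ `|B| <= n%:R]).
have rootsP L i j A : roots L i j A <-> exists B, [/\ psd B, L (B i j) & sq B = A].
  split => [[n _ [B [pB [LB _]] BA]]|[B [pB LB BA]]]; first by exists B.
  have [n Bn] : exists n : nat, `|B| <= n%:R.
    exists (Num.truncn `|B|).+1; apply: ltW; exact: truncnS_gt.
  by exists n => //; exists B.
apply/measurable_fun_mxP => i j.
apply: (measurability _ (RGenCInfty.measurableE R)) => //.
move=> _ [_ [x ->] <-]; rewrite setTI.
have mroots L : closed L -> measurable (roots L i j).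
  by move=> cL; apply: bigcupT_measurable => n; exact: msq.
have -> : (fun A => sqrtmx A i j) @^-1` `[x, +oo[ =
    roots [set y | x <= y] i j `|` (~` roots setT i j `&` [set A | x <= 0]).
  apply/seteqP; split => [A /=|A /=]; rewrite in_itv/= andbT.
    move=> xA; have [ex|no] := pselect (exists B, psd B /\ B *m B = A).
      by left; have [pS SA] := sqrtmxP ex; apply/rootsP; exists (sqrtmx A).
    right; split.
      by move=> /rootsP[B [pB _ BA]]; apply: no; exists B.
    move: xA; rewrite /sqrtmx; case: xgetP => [B _ BA|_]; last by rewrite mxE.
    by case: no; exists B.
  move=> [/rootsP[B [pB xB BA]]|[no x0]]; first by rewrite (sqrtmx_eq pB BA).
  rewrite /sqrtmx; case: xgetP => [B _ [pB BA]|_]; last by rewrite mxE.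
  by case: no; apply/rootsP; exists B.
apply: measurableU; first by apply: mroots; exact: closed_ge.
apply: measurableI; first by apply: measurableC; apply: mroots; exact: closedT.
have [x0|x0] := boolP (x <= 0); first by rewrite (_ : [set _ | _] = setT)//; apply/seteqP; split.
by rewrite (_ : [set _ | _] = set0)//; apply/seteqP; split.
Qed.

Lemma measurable_invsqrtmx (R : realType) p :
  measurable_fun setT (@invsqrtmx R p : 'M[R]_p -> 'M[R]_p).
Proof. exact: (measurableT_comp (@measurable_sqrtmx R p) (@measurable_invmx R p)). Qed.

(** * Quantiles *)

Section quantile_theory.
Context {dO : measure_display} {Omega : measurableType dO} {R : realType}.
Variable P : probability Omega R.
Implicit Types (X Y W : Omega -> R) (a t : R).

Lemma measurable_le X t : measurable_fun setT X -> measurable [set w | X w <= t].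
Proof.
move=> mX; rewrite (_ : [set w | _] = X @^-1` `]-oo, t]).
  by rewrite -[X in measurable X]setTI; exact: mX.
by apply/seteqP; split => w /=; rewrite in_itv.
Qed.

Lemma measurable_lt X t : measurable_fun setT X -> measurable [set w | X w < t].
Proof.
move=> mX; rewrite (_ : [set w | _] = X @^-1` `]-oo, t[).
  by rewrite -[X in measurable X]setTI; exact: mX.
by apply/seteqP; split => w /=; rewrite in_itv.
Qed.

Lemma measurable_gt X t : measurable_fun setT X -> measurable [set w | t < X w].
Proof.
move=> mX; rewrite (_ : [set w | _] = ~` [set w | X w <= t]).
  exact/measurableC/measurable_le.
by apply/seteqP; split => w /=; rewrite ltNge => /negP.
Qed.

Lemma measurable_norm_ge X t :
  measurable_fun setT X -> measurable [set w | t <= `|X w|].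
Proof.
move=> mX; rewrite (_ : [set w | _] = ~` [set w | `|X w| < t]).
  by apply/measurableC/measurable_lt; exact: measurableT_comp.
by apply/seteqP; split => w /=; rewrite leNgt => /negP.
Qed.

Lemma prob_le (A B : set Omega) : measurable A -> measurable B -> A `<=` B ->
  fine (P A) <= fine (P B).
Proof.
move=> mA mB AB; apply: fine_le; rewrite ?fin_num_measure//.
by apply: le_measure; rewrite ?inE.
Qed.

Lemma prob_leU (A B C : set Omega) : measurable A -> measurable B -> measurable C ->
  A `<=` B `|` C -> fine (P A) <= fine (P B) + fine (P C).
Proof.
move=> mA mB mC AB; rewrite -lee_fin EFinD !fineK ?fin_num_measure//.
apply: (@le_trans _ _ (P (B `|` C))).
  by apply: le_measure; rewrite ?inE//; exact: measurableU.
exact: measureU2.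
Qed.

Lemma prob_setC (A : set Omega) : measurable A -> fine (P (~` A)) = 1 - fine (P A).
Proof. by move=> mA; rewrite probability_setC// fineB ?fin_num_measure. Qed.

Lemma prob_tight W (r : R) : measurable_fun setT W -> 0 < r ->
  exists2 K, 0 < K & (P [set w | (K < W w)%R] < r%:E)%E.
Proof.
move=> mW r0; pose V : {RV P >-> R} := HB.pack W (isMeasurableFun.Build _ _ _ _ W mW).
have /fine_cvgP[_ /cvgrPdist_lt/(_ _ r0)] := cvg_ccdfy0 V.
move=> [M [_ MP]]; exists (`|M| + 1); first by rewrite ltr_wpDl.
have := MP (`|M| + 1); rewrite (le_lt_trans (ler_norm M)) ?ltrDl//.
move=> /(_ isT); rewrite sub0r normrN ger0_norm ?fine_ge0// => VM.
rewrite -lte_fin fineK in VM; last exact: fin_num_measure.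
rewrite (_ : [set w | _] = V @^-1` `]`|M| + 1, +oo[)//.
by apply/seteqP; split => w /=; rewrite in_itv/= andbT.
Qed.

(** The infimum that defines the quantile is attained, because distribution
    functions are right continuous. *)
Lemma le_quantileP X a t : measurable_fun setT X -> 0 < a < 1 ->
  (a%:E <= P [set w | (X w <= t)%R])%E <-> quantile P X a <= t.
Proof.
move=> mX /andP[a0 a1].
pose V : {RV P >-> R} := HB.pack X (isMeasurableFun.Build _ _ _ _ X mX).
have VE r : P [set w | X w <= r] = cdf V r.
  rewrite (_ : [set w | _] = X @^-1` `]-oo, r]); first exact: erefl.
  by apply/seteqP; split => w /=; rewrite in_itv.
pose S := [set t | (a%:E <= P [set w | (X w <= t)%R])%E].
have lbS : has_lbound S.
  have /fine_cvgP[_ /cvgrPdist_lt/(_ _ a0)] := cvg_cdfNy0 V.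
  move=> [M [_ MP]]; exists (M - 1) => r Sr; rewrite leNgt; apply/negP => rM.
  have := MP r (lt_trans rM _); rewrite gtrBl => /(_ ltr01).
  rewrite sub0r normrN ger0_norm ?fine_ge0// -lte_fin fineK; last exact: fin_num_measure.
  by rewrite ltNge -VE Sr.
have S0 : S !=set0.
  have a1' : 0 < 1 - a by rewrite subr_gt0.
  have /fine_cvgP[_ /cvgrPdist_lt/(_ _ a1')] := cvg_cdfy1 V.
  move=> [M [_ MP]]; exists (M + 1); rewrite /S/= VE.
  have := MP (M + 1); rewrite ltrDl => /(_ ltr01).
  rewrite ltr_distlC => /andP[+ _].
  rewrite opprB addrCA subrr addr0 => h; rewrite -[cdf _ _]fineK ?lee_fin ?ltW//.
  exact: fin_num_measure.
have infS : lbound S (inf S) by exact: inf_lbound.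
have cdf_mono : {homo cdf V : x y / x <= y >-> (x <= y)%E} by exact: cdf_nondecreasing.
have Sinf : (a%:E <= cdf V (inf S))%E.
  have rc := @cdf_right_continuous _ _ _ P V (inf S).
  apply: (closed_cvg (fun x => (a%:E <= x)%E) _ _ _ rc).
    exact: closed_ereal_le_ereal.
  near=> r.
  have rS : inf S < r by near: r; exact: nbhs_right_gt.
  have [y Sy yr] := inf_lt S0 rS.
  by rewrite (le_trans Sy)// VE; apply: cdf_mono; exact: ltW.
rewrite VE; split => [at_|qt]; last exact: le_trans Sinf (cdf_mono _ _ qt).
by apply: ge_inf => //=; rewrite VE.
Unshelve. all: by end_near. Qed.

(** The quantile is continuous at [X] for convergence in probability as soon as
    the distribution function of [X] exceeds [a] immediately to the right of its
    quantile; to the left it is below [a] by definition. The factor [W] is the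
    same for all [Y], so that a single [s] serves for all of them. *)
Lemma quantile_stable X W a dl : measurable_fun setT X -> measurable_fun setT W ->
  0 < a < 1 -> 0 < dl ->
  (a%:E < P [set w | (X w <= quantile P X a + dl / 2)%R])%E ->
  exists2 s, 0 < s & forall Y, measurable_fun setT Y ->
    (forall w, `|Y w - X w| <= s * W w) ->
    `|quantile P Y a - quantile P X a| <= dl.
Proof.
move=> mX mW a01 dl0; set q := quantile P X a => aq.
have pfin A : measurable A -> P A \is a fin_num by move=> mA; exact: fin_num_measure.
have mXl t := measurable_le t mX.
have qa : (P [set w | (X w <= q - dl / 2)%R] < a%:E)%E.
  rewrite ltNge; apply/negP => /(le_quantileP _ mX a01); rewrite -/q; lra.
rewrite -(fineK (pfin _ (mXl _))) lte_fin in aq.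
rewrite -(fineK (pfin _ (mXl _))) lte_fin in qa.
pose r := Num.min (fine (P [set w | (X w <= q + dl / 2)%R]) - a)
  (a - fine (P [set w | (X w <= q - dl / 2)%R])).
have r0 : 0 < r by rewrite lt_min !subr_gt0 aq qa.
have [K K0 KP] := prob_tight mW r0.
have mK : measurable [set w | K < W w] by exact: measurable_gt.
rewrite -(fineK (pfin _ mK)) lte_fin lt_min in KP; have /andP[KP1 KP2] := KP.
exists (dl / (2 * K)); first by rewrite divr_gt0// mulr_gt0.
move=> Y mY YX; have mYl t := measurable_le t mY.
have near w : W w <= K -> `|Y w - X w| <= dl / 2.
  move=> WK; apply: (le_trans (YX w)).
  have -> : dl / 2 = dl / (2 * K) * K by field; rewrite gt_eqF.
  by rewrite ler_wpM2l// ltW// divr_gt0// mulr_gt0.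
have h1 : quantile P Y a <= q + dl.
  apply/(le_quantileP _ mY a01); rewrite -(fineK (pfin _ (mYl _))) lee_fin.
  have := prob_leU (mXl (q + dl / 2)) (mYl (q + dl)) mK.
  suff h : [set w | X w <= q + dl / 2] `<=` [set w | Y w <= q + dl] `|` [set w | K < W w].
    by move=> /(_ h); lra.
  move=> w /= Xw; have [WK|] := leP (W w) K; last by right.
  by left; have := near w WK; rewrite ler_norml => /andP[]; lra.
have h2 : q - dl < quantile P Y a.
  rewrite ltNge; apply/negP => /(le_quantileP _ mY a01).
  rewrite -(fineK (pfin _ (mYl _))) lee_fin.
  have := prob_leU (mYl (q - dl)) (mXl (q - dl / 2)) mK.
  suff h : [set w | Y w <= q - dl] `<=` [set w | X w <= q - dl / 2] `|` [set w | K < W w].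
    by move=> /(_ h); lra.
  move=> w /= Xw; have [WK|] := leP (W w) K; last by right.
  by left; have := near w WK; rewrite ler_norml => /andP[]; lra.
by rewrite ler_norml; apply/andP; split; lra.
Qed.

(** The distribution function is below [a] to the left of the quantile, and
    hence at the quantile if there is no jump. *)
Lemma quantile_no_atom X a : measurable_fun setT X -> 0 < a < 1 ->
  P [set w | X w = quantile P X a] = 0%E ->
  P [set w | X w <= quantile P X a] = a%:E /\
  P [set w | X w < quantile P X a] = a%:E.
Proof.
move=> mX a01; set q := quantile P X a => q0.
have mle t := measurable_le t mX; have mlt t := measurable_lt t mX.
have meq : measurable [set w | X w = q].
  rewrite (_ : [set w | _] = X @^-1` [set q])//.
  by rewrite -[Y in measurable Y]setTI; exact: mX.
have E : P [set w | X w <= q] = P [set w | X w < q].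
  rewrite (_ : [set w | X w <= q] = [set w | X w < q] `|` [set w | X w = q]); last first.
    apply/seteqP; split => w /=; rewrite le_eqVlt; first by move=> /orP[/eqP|]; [right|left].
    by move=> [->|->]; rewrite ?orbT ?eqxx.
  transitivity (P [set w | (X w < q)%R] + P [set w | X w = q])%E.
    by apply: measureU => //; apply/seteqP; split => w //= [+ wq]; rewrite wq ltxx.
  by rewrite q0 adde0.
suff h : P [set w | X w <= q] = a%:E by split; rewrite -?E.
apply/eqP; rewrite eq_le; apply/andP; split; last exact/(le_quantileP _ mX a01).
rewrite E; have /cvg_lim <-// : P [set w | X w <= q - n.+1%:R^-1] @[n --> \oo] -->
    P [set w | X w < q].
  rewrite (_ : [set w | X w < q] = \bigcup_n [set w | X w <= q - n.+1%:R^-1]).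
    apply: nondecreasing_cvg_mu => //; first exact: bigcupT_measurable.
    move=> m n mn; apply/subsetPset => w /= /le_trans; apply.
    by rewrite lerD2l lerN2 lef_pV2 ?posrE// ler_nat.
  apply/seteqP; split => [w /= Xq|w [n _ /= Xq]]; last first.
    by rewrite (le_lt_trans Xq)// ltrBlDr ltrDl invr_gt0.
  have /ltr_add_invr[n] : X w < q by [].
  by move=> h; exists n => //=; rewrite lerBrDr ltW.
apply: lime_le.
  apply: ereal_nondecreasing_is_cvgn => m n mn; apply: le_measure; rewrite ?inE//.
  move=> w /= /le_trans; apply.
  by rewrite lerD2l lerN2 lef_pV2 ?posrE// ler_nat.
apply: nearW => n; rewrite leNgt; apply/negP => /ltW /(le_quantileP _ mX a01).
by rewrite -/q lerBrDr leNgt ltrDl invr_gt0 ltr0n.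
Qed.

End quantile_theory.

(** * Quantiles of Lipschitz functions of normal vectors *)

Lemma normal_prob_itv_gt0 (R : realType) (a b : R) : a < b ->
  (0 < normal_prob 0 1 `]a, b[)%E.
Proof.
move=> ab; pose M := Num.max `|a| `|b|.
pose c : R := normal_peak 1 * expR (- M ^+ 2 / 2).
have c0 : 0 < c by rewrite mulr_gt0 ?expR_gt0// normal_peak_gt0.
apply: (@lt_le_trans _ _ (\int[lebesgue_measure]_(x in `]a, b[) c%:E)%E).
  rewrite integral_cst//= lebesgue_measure_itv/= lte_fin ab -EFinD.
  by rewrite -EFinM lte_fin mulr_gt0// subr_gt0.
have mpdf : measurable_fun (`]a, b[ : set R) (fun x => (normal_pdf 0 1 x)%:E).
  by apply/measurable_EFinP; apply: measurable_funTS; exact: measurable_normal_pdf.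
have pdf0 (x : R) : `]a, b[%classic x -> (0 <= (normal_pdf 0 1 x)%:E)%E.
  by move=> _; rewrite lee_fin normal_pdf_ge0.
have c0' (x : R) : `]a, b[%classic x -> (0 <= c%:E)%E by rewrite lee_fin ltW.
apply: ge0_le_integral => //=.
move=> x; rewrite in_itv/= => /andP[ax xb].
rewrite lee_fin normal_pdfE ?oner_eq0// ler_wpM2l//.
  by rewrite normal_peak_ge0.
rewrite /normal_fun ler_expR expr1n subr0.
have xM : x ^+ 2 <= M ^+ 2.
  rewrite -[x ^+ 2]real_normK ?num_real// ler_sqr ?nnegrE ?le_max ?normr_ge0//.
  apply/orP; have [x0|x0] := lerP 0 x.
    by right; rewrite (ger0_norm x0) (le_trans (ltW xb))// ler_norm.
  by left; rewrite (ltr0_norm x0) -(normrN a) (le_trans _ (ler_norm _))// lerN2 ltW.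
by rewrite !mulNr lerN2 ler_pM2r ?invr_gt0.
Qed.

Section gaussian_support.
Context {dO : measure_display} {Omega : measurableType dO} {R : realType}
  {P : probability Omega R} {d : nat}.
Variables (g1 g2 : group P d).
Variables (Z1 : {RV P >-> 'cV[R]_(npar g1)}) (Z2 : {RV P >-> 'cV[R]_(npar g2)}).
Hypotheses (indep : mutual_indep P (noise Z1 Z2))
  (normal1 : std_normal_coords Z1) (normal2 : std_normal_coords Z2).

Let p1 := npar g1.
Let p2 := npar g2.

(** A product of probabilities of intervals under the normal law. *)
Lemma gaussian_full_support (z1 : 'cV[R]_p1) (z2 : 'cV[R]_p2) (r : R) : 0 < r ->
  (0 < P [set w | (`|z1 - Z1 w| < r)%R /\ (`|z2 - Z2 w| < r)%R])%E.
Proof.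
move=> r0.
pose I : eqType := (('I_(ncov g1) * nat + 'I_(ncov g2) * nat) + ('I_p1 + 'I_p2))%type.
pose s : seq I := [seq inr a | a : 'I_p1 + 'I_p2].
pose A (i : I) : set R := match i with
  | inr (inl a) => `](z1 a 0 - r), (z1 a 0 + r)[%classic
  | inr (inr a) => `](z2 a 0 - r), (z2 a 0 + r)[%classic
  | _ => setT end.
have us : uniq s by rewrite map_inj_uniq ?enum_uniq// => a b [].
have mA i : measurable (A i).
  by case: i => [i|[a|a]] /=; [exact: measurableT|exact: measurable_itv|exact: measurable_itv].
have itvr (x : R) : x - r < x + r by rewrite ltrD2l gtrN.
have Pi : (0 < \prod_(i <- s) P (noise Z1 Z2 i @^-1` A i))%E.
  elim/big_rec: _ => // i x _ x0; apply: mule_gt0 => //.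
  case: i => [i|[a|a]] /=.
  - by rewrite preimage_setT probability_setT.
  - rewrite (_ : _ @^-1` _ = [set w | A (inr (inl a)) (Z1 w a 0)])//.
    by rewrite normal1; [exact: normal_prob_itv_gt0|exact: (mA (inr (inl a)))].
  - rewrite (_ : _ @^-1` _ = [set w | A (inr (inr a)) (Z2 w a 0)])//.
    by rewrite normal2; [exact: normal_prob_itv_gt0|exact: (mA (inr (inr a)))].
rewrite (_ : [set w | _] = \bigcap_(i in [set` s]) (noise Z1 Z2 i @^-1` A i)).
  by rewrite indep.
have inA (x y : R) : `](x - r), (x + r)[%classic y <-> `|x - y| < r.
  by rewrite /= in_itv/= distrC ltr_distl.
apply/seteqP; split => w /=.
  move=> [h1 h2] i /= /mapP[[a|a] _ ->] /=.
    apply/inA; apply: (le_lt_trans _ h1).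
    by rewrite (_ : _ - _ = (z1 - Z1 w) a 0) ?mx_norm_entry// !mxE.
  apply/inA; apply: (le_lt_trans _ h2).
  by rewrite (_ : _ - _ = (z2 - Z2 w) a 0) ?mx_norm_entry// !mxE.
move=> h; split; apply/mx_norm_ltP => // i j; rewrite (ord1 j) !mxE; apply/inA.
  by apply: (h (inr (inl i))) => /=; apply: map_f; rewrite mem_enum.
by apply: (h (inr (inr i))) => /=; apply: map_f; rewrite mem_enum.
Qed.

(** If [X <= q + e] has probability at most [a], then the values between [q] and
    [q + e] are not charged, because [X <= q] has probability at least [a]; and
    since [0 < a < 1], [X] takes values on both sides of them. By connectedness the
    continuous function [t] takes a value in between, and by the full support of
    the normal law it does so with positive probability. *)
Lemma gaussian_quantile_lt (t : 'cV[R]_p1 -> 'cV[R]_p2 -> R) (L a e : R) :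
  0 <= L ->
  (forall x y x' y', `|t x y - t x' y'| <= L * `|x - x'| + L * `|y - y'|) ->
  measurable_fun setT (fun w => t (Z1 w) (Z2 w)) ->
  0 < a < 1 -> 0 < e ->
  (a%:E < P [set w | (t (Z1 w) (Z2 w) <=
                      quantile P (fun w => t (Z1 w) (Z2 w)) a + e)%R])%E.
Proof.
move=> L0 tL mT a01 e0; set X := fun w => t (Z1 w) (Z2 w).
set q := quantile P X a; have mX : measurable_fun setT X := mT.
have mle c : measurable [set w | X w <= c] by exact: measurable_le.
have aq : (a%:E <= P [set w | (X w <= q)%R])%E.
  exact/(le_quantileP _ _ mX a01).
rewrite ltNge; apply/negP => qa.
have mI : measurable [set w | q < X w <= q + e].
  rewrite (_ : [set w | _] = [set w | q < X w] `&` [set w | X w <= q + e]).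
    by apply: measurableI => //; exact: measurable_gt.
  by apply/seteqP; split => w /= /andP.
have I0 : P [set w | q < X w <= q + e] = 0%E.
  have : (P [set w | (X w <= q)%R] + P [set w | (q < X w <= q + e)%R] <= a%:E)%E.
    apply: le_trans qa; rewrite -measureU//; last first.
      by apply/seteqP; split => w //= [+ /andP[]]; rewrite leNgt => /negP.
    apply: le_measure; rewrite ?inE//; first exact: measurableU.
    by move=> w /= [|/andP[]//] /le_trans; apply; rewrite lerDl ltW.
  move=> h; apply/eqP; rewrite eq_le measure_ge0 andbT.
  have : (a%:E + P [set w | (q < X w <= q + e)%R] <= a%:E + 0)%E.
    by rewrite adde0; apply: le_trans h; exact: leeD2r.
  by rewrite leeD2lE.
have /andP[a0 a1] := a01.
have [w0 Xw0] : exists w, X w <= q.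
  apply/not_existsP => no; move: aq.
  rewrite (_ : [set w | _] = set0); first by rewrite measure0 lee_fin leNgt a0.
  by apply/seteqP; split => w //= /no.
have [w1 Xw1] : exists w, q + e < X w.
  apply/not_existsP => no; move: qa.
  rewrite (_ : [set w | _] = setT); first by rewrite probability_setT lee_fin leNgt a1.
  by apply/seteqP; split => w //= _; rewrite leNgt; apply/negP/no.
(* The values of t on the segment from w0 to w1 run from at most q to above
   q + e, hence pass through q + e / 2. *)
pose f (s : R) := t (Z1 w0 + s *: (Z1 w1 - Z1 w0)) (Z2 w0 + s *: (Z2 w1 - Z2 w0)).
have f0 : f 0 = X w0 by rewrite /f !scale0r !addr0.
have f1 : f 1 = X w1 by rewrite /f !scale1r addrC subrK addrC subrK.
pose K := L * `|Z1 w1 - Z1 w0| + L * `|Z2 w1 - Z2 w0|.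
have K0 : 0 <= K by rewrite addr_ge0// mulr_ge0.
have cf : continuous f.
  apply: (lipschitz_continuous K0) => s s'; rewrite (le_trans (tL _ _ _ _))//.
  have E n (x y : 'cV[R]_n) : x + s *: y - (x + s' *: y) = (s - s') *: y.
    by rewrite opprD addrACA subrr add0r scalerBl.
  by rewrite !E !normrZ !(mulrCA L) -mulrDr -/K mulrC.
have [s _ fs] : exists2 s, s \in `[0, 1] & f s = q + e / 2.
  apply: IVT => //; first exact: continuous_subspaceT.
  by rewrite f0 f1 ge_min le_max; apply/andP; split; apply/orP; [left|right]; lra.
have L1 : 0 < 2 * L + 1 by lra.
have r0 : 0 < e / 3 / (2 * L + 1) by rewrite !divr_gt0.
have := gaussian_full_support (Z1 w0 + s *: (Z1 w1 - Z1 w0))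
  (Z2 w0 + s *: (Z2 w1 - Z2 w0)) r0.
rewrite ltNge => /negP; apply; rewrite -I0; apply: le_measure; rewrite ?inE//.
  rewrite (_ : [set w | _] =
    Z1 @^-1` ball (Z1 w0 + s *: (Z1 w1 - Z1 w0)) (e / 3 / (2 * L + 1)) `&`
    Z2 @^-1` ball (Z2 w0 + s *: (Z2 w1 - Z2 w0)) (e / 3 / (2 * L + 1))).
    by apply: measurableI; rewrite -[Y in measurable Y]setTI;
      apply: measurable_funPT => //; exact: measurable_mx_ball.
  by rewrite -!ball_normE.
move=> w /= [/ltW h1 /ltW h2].
have : `|f s - X w| <= e / 3.
  apply: (le_trans (tL _ _ _ _)).
  apply: (@le_trans _ _ (2 * L * (e / 3 / (2 * L + 1)))).
    have := lerD h1 h2; move: (e / 3 / _) => r h12.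
    by rewrite -mulrDr (_ : 2 * L * r = L * (r + r)); [rewrite ler_wpM2l|ring].
  rewrite mulrCA ler_piMr ?divr_ge0 ?ltW// ltr_pdivrMr// mul1r; lra.
by rewrite fs ler_norml => /andP[h3 h4]; apply/andP; split; lra.
Qed.

End gaussian_support.

(** * The directional derivative of the L1 norm *)

Lemma measurable_sgr (R : realType) : measurable_fun setT (Num.sg : R -> R).
Proof.
apply: nondecreasing_measurable => // x y xy.
case: (sgrP x) => x0; case: (sgrP y) => y0 //; rewrite ?lerN10 ?ler01 //.
- by move: xy; rewrite x0 leNgt y0.
- by move: (lt_le_trans x0 xy); rewrite y0 ltxx.
- by move: (lt_trans (lt_le_trans x0 xy) y0); rewrite ltxx.
Qed.

Section directional_derivative.
Context d (T : measurableType d) (R : realType).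
Variables (mu : {measure set T -> \bar R}) (X : set T).
Hypotheses (mX : measurable X) (muX : (mu X < +oo)%E).
Implicit Types (D E G H : T -> R) (M : set T).

(** The integrand of the directional derivative of [D |-> \int |D|] at [D] in
    direction [G], when [M] is the zero set of [D] and [s] its sign. *)
Definition dir_integrand M s G (x : T) : R :=
  \1_M x * `|G x| + (1 - \1_M x) * (s x * G x).

Lemma dir_integrand_in M s G x : M x -> dir_integrand M s G x = `|G x|.
Proof. by move=> Mx; rewrite /dir_integrand indicE mem_set// subrr !mul1r mul0r addr0. Qed.

Lemma dir_integrand_notin M s G x : ~ M x -> dir_integrand M s G x = s x * G x.
Proof. by move=> Mx; rewrite /dir_integrand indicE memNset// subr0 mul0r mul1r add0r. Qed.

Lemma bounded_measurable_dir M s G : measurable M -> bounded_measurable X s ->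
  bounded_measurable X G -> bounded_measurable X (dir_integrand M s G).
Proof.
move=> mM bs bG; apply: bounded_measurableD; apply: bounded_measurableM.
- exact: bounded_measurable_indic.
- exact: bounded_measurable_norm.
- apply: bounded_measurableB; first exact: bounded_measurable_cst.
  exact: bounded_measurable_indic.
- exact: bounded_measurableM.
Qed.

Lemma Rintegral_dir M s G : measurable M -> M `<=` X ->
  bounded_measurable X s -> bounded_measurable X G ->
  \int[mu]_(x in X `\` M) (s x * G x) + \int[mu]_(x in M) `|G x| =
  \int[mu]_(x in X) dir_integrand M s G x.
Proof.
move=> mM MX bs bG; have XE : (X `\` M) `|` M = X.
  apply/seteqP; split => [x [[]//|/MX//]|x Xx].
  by have [Mx|nMx] := pselect (M x); [right|left].
have mXM : measurable (X `\` M) by exact: measurableD.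
rewrite -[in RHS]XE Rintegral_setU//; last 2 first.
- rewrite XE; apply: bounded_measurable_integrable => //.
  exact: bounded_measurable_dir.
- by rewrite disj_set2E; apply/eqP; rewrite setDE -setIA setICl setI0.
congr (_ + _); apply: eq_Rintegral => x; rewrite inE.
  by move=> [_ nMx]; rewrite dir_integrand_notin.
by move=> Mx; rewrite dir_integrand_in.
Qed.

Lemma bounded_measurable_sg D : bounded_measurable X D ->
  bounded_measurable X (fun x => Num.sg (D x)).
Proof.
move=> [mD _]; split; last by exists 1 => x _; rewrite normr_sg; case: (D x != 0).
exact: measurableT_comp (@measurable_sgr R) mD.
Qed.

Definition zero_set D := [set x | X x /\ D x = 0].

(** The set on which a small perturbation of [D] may change its sign. *)
Definition margin D (t : R) := [set x | X x /\ 0 < `|D x| <= t].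

Lemma measurable_sublevel D t : measurable_fun X D ->
  measurable [set x | X x /\ `|D x| < t].
Proof.
move=> mD; rewrite (_ : [set x | _] = X `&` D @^-1` [set y | `|y| < t])//.
apply: mD => //; rewrite (_ : [set y | _] = ball 0 t); last first.
  by rewrite -ball_normE; apply/seteqP; split => y /=; rewrite sub0r normrN.
by apply: open_measurable; exact: ball_open.
Qed.

Lemma measurable_zero_set D : measurable_fun X D -> measurable (zero_set D).
Proof. by move=> mD; exact: (mD mX [set 0]). Qed.

Lemma measurable_margin D t : measurable_fun X D -> measurable (margin D t).
Proof.
move=> mD; rewrite (_ : margin D t = (X `&` (fun x => `|D x|) @^-1` `]0, t])).
  have mn : measurable_fun X (fun x => `|D x|) by exact: measurableT_comp.
  exact: mn.
by apply/seteqP; split => x [Xx]; rewrite /= in_itv.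
Qed.

(** The margins decrease to the empty set, since they omit the zeros of [D]. *)
Lemma margin_cvg0 D (e : R) : measurable_fun X D -> 0 < e ->
  exists2 t, 0 < t & fine (mu (margin D t)) <= e.
Proof.
move=> mD e0; pose F n := margin D n.+1%:R^-1.
have : mu (F n) @[n --> \oo] --> mu (\bigcap_n F n).
  apply: nonincreasing_cvg_mu => //.
  - apply: le_lt_trans muX; apply: le_measure; rewrite ?inE//.
      exact: measurable_margin.
    by move=> x [].
  - by move=> n; exact: measurable_margin.
  - by apply: bigcapT_measurable => n; exact: measurable_margin.
  - move=> m n mn; apply/subsetPset => x [Xx /andP[D0 Dn]]; split => //.
    by rewrite D0 (le_trans Dn)// lef_pV2 ?posrE// ler_nat.
have -> : \bigcap_n F n = set0.
  apply/seteqP; split => // x Fx; have [_ /andP[D0 _]] := Fx 0%N Logic.I.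
  have /ltr_add_invr[n] := D0; rewrite add0r => nD.
  by have [_ /andP[_]] := Fx n Logic.I; rewrite leNgt nD.
rewrite measure0 => /fine_cvgP[_ /cvgrPdist_le/(_ _ e0)] [n _ /(_ n (leqnn n))] /=.
rewrite sub0r normrN => h; exists n.+1%:R^-1; first by rewrite invr_gt0.
exact: le_trans (ler_norm _) h.
Qed.

Lemma fine_margin_le D t t' : measurable_fun X D -> t <= t' ->
  fine (mu (margin D t)) <= fine (mu (margin D t')).
Proof.
move=> mD tt'.
have mf u : mu (margin D u) \is a fin_num.
  rewrite ge0_fin_numE//; apply: le_lt_trans muX.
  apply: le_measure; rewrite ?inE//; first exact: measurable_margin.
  by move=> x [].
rewrite fine_le// le_measure ?inE//; try exact: measurable_margin.
by move=> x [Xx /andP[D0 Dt]]; split => //; rewrite D0 (le_trans Dt).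
Qed.

(** Where [|E| >= tau > rho >= |E - D|] the signs of [D] and [E] agree, and
    where [D = 0] one has [|E| < tau]; so, apart from the distance between [G] and
    [H], the two integrands can only differ where [0 < |D| < tau + rho]. *)
Lemma dir_integrand_perturb D E G H (tau rho e C : R) :
  bounded_measurable X D -> bounded_measurable X E ->
  bounded_measurable X G -> bounded_measurable X H ->
  (forall x, X x -> `|E x - D x| <= rho) -> rho < tau ->
  (forall x, X x -> `|H x - G x| <= e) -> (forall x, X x -> `|G x| <= C) ->
  `|\int[mu]_(x in X) dir_integrand [set x | X x /\ `|E x| < tau] (fun x => Num.sg (E x)) H x -
    \int[mu]_(x in X) dir_integrand (zero_set D) (fun x => Num.sg (D x)) G x| <=
  e * fine (mu X) + 2 * C * fine (mu (margin D (tau + rho))).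
Proof.
move=> bD bE bG bH ED rt HG GC.
have mE : measurable [set x | X x /\ `|E x| < tau].
  by apply: measurable_sublevel; case: bE.
have mD : measurable (zero_set D) by apply: measurable_zero_set; case: bD.
have mM : measurable (margin D (tau + rho)) by apply: measurable_margin; case: bD.
have -> : mu (margin D (tau + rho)) = mu (margin D (tau + rho) `&` X).
  by congr (mu _); apply/esym/setIidl => x [].
apply: Rintegral_dist_indic => //.
- by apply: bounded_measurable_dir => //; exact: bounded_measurable_sg.
- by apply: bounded_measurable_dir => //; exact: bounded_measurable_sg.
move=> x Xx; have {}ED := ED x Xx; have {}HG := HG x Xx; have {}GC := GC x Xx.
have C0 : 0 <= C by apply: le_trans GC.
have i0 : 0 <= 2 * C * \1_(margin D (tau + rho)) x by rewrite !mulr_ge0.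
have sg1 (y : R) : `|Num.sg y| <= 1 by rewrite normr_sg; case: (y != 0).
have HG' : `| `|H x| - `|G x| | <= e by apply: le_trans HG; exact: ler_dist_dist.
have [D0|D0] := eqVneq (D x) 0.
  have E0 : `|E x| < tau by rewrite (le_lt_trans _ rt)// -[E x]subr0 -D0.
  rewrite !dir_integrand_in//; first by lra.
have [Et|tE] := ltP `|E x| tau; last first.
  rewrite !dir_integrand_notin//; last 2 first.
  - by move=> [_]; exact/eqP.
  - by move=> [_]; rewrite ltNge tE.
  have -> : Num.sg (E x) = Num.sg (D x).
    move: ED tE; rewrite ler_norml => /andP[h1 h2].
    case: (sgrP (D x)) => [/eqP|d0|d0]; first by rewrite (negbTE D0).
      case: (ger0P (E x)) => [y0 tE|y0 tE].
        by apply: gtr0_sg; lra.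
      lra.
    case: (ger0P (E x)) => [y0 tE|y0 tE]; first lra.
    exact: ltr0_sg.
  rewrite -mulrBr normrM (@le_trans _ _ e) ?lerDl//.
  by rewrite (le_trans _ HG)// ler_piMl.
rewrite dir_integrand_in// dir_integrand_notin; last by move=> [_]; exact/eqP.
rewrite indicE mem_set ?mulr1; last first.
  split => //; rewrite normr_gt0 D0/=.
  rewrite (_ : D x = E x - (E x - D x)); last by rewrite opprB addrC subrK.
  by rewrite (le_trans (ler_normB _ _))// lerD// ltW.
rewrite (_ : _ - _ = (`|H x| - `|G x|) + (`|G x| - Num.sg (D x) * G x)); last by ring.
rewrite (le_trans (ler_normD _ _))// lerD//.
rewrite (le_trans (ler_normB _ _))// normr_id mulrDl mul1r lerD//.
by rewrite normrM (le_trans _ GC)// ler_piMl.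
Qed.

(** The increment [|D + v| - |D|] equals [sg D * v] as soon as [|v| <= |D|], and
    [|v|] where [D = 0]; the remaining points lie in a margin of [D]. *)
Lemma dir_integrand_expand D E H (r rho e : R) :
  bounded_measurable X D -> bounded_measurable X E -> bounded_measurable X H ->
  0 < r -> (forall x, X x -> `|r * (E x - D x) - H x| <= e) ->
  (forall x, X x -> `|r * (E x - D x)| <= rho) ->
  `|r * (\int[mu]_(x in X) `|E x| - \int[mu]_(x in X) `|D x|) -
    \int[mu]_(x in X) dir_integrand (zero_set D) (fun x => Num.sg (D x)) H x| <=
  e * fine (mu X) + 2 * rho * fine (mu (margin D (rho / r))).
Proof.
move=> bD bE bH r0 EDH EDr.
have mD : measurable (zero_set D) by apply: measurable_zero_set; case: bD.
have mM : measurable (margin D (rho / r)) by apply: measurable_margin; case: bD.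
have bE' := bounded_measurable_norm bE; have bD' := bounded_measurable_norm bD.
have ii f : bounded_measurable X f -> mu.-integrable X (EFin \o f).
  exact: bounded_measurable_integrable.
have -> : mu (margin D (rho / r)) = mu (margin D (rho / r) `&` X).
  by congr (mu _); apply/esym/setIidl => x [].
rewrite -RintegralB//; [|exact: ii|exact: ii].
rewrite -RintegralZl//; last by apply: ii; exact: bounded_measurableB.
apply: Rintegral_dist_indic => //.
- by apply: bounded_measurableM; [exact: bounded_measurable_cst|exact: bounded_measurableB].
- by apply: bounded_measurable_dir => //; exact: bounded_measurable_sg.
move=> x Xx; have {}EDH := EDH x Xx; have {}EDr := EDr x Xx.
have rho0 : 0 <= rho by apply: le_trans EDr.
have i0 : 0 <= 2 * rho * \1_(margin D (rho / r)) x by rewrite !mulr_ge0.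
have sg1 (y : R) : `|Num.sg y| <= 1 by rewrite normr_sg; case: (y != 0).
pose v := r * (E x - D x); pose y := r * D x.
have -> : r * (`|E x| - `|D x|) = `|y + v| - `|y|.
  have -> : y + v = r * E x by rewrite /y /v; ring.
  by rewrite !normrM (gtr0_norm r0) mulrBr.
have [D0|D0] := eqVneq (D x) 0.
  rewrite dir_integrand_in// /y D0 mulr0 add0r normr0 subr0.
  rewrite (@le_trans _ _ e) ?lerDl// (le_trans _ EDH)//.
  by rewrite /v D0; exact: ler_dist_dist.
rewrite dir_integrand_notin; last by move=> [_]; exact/eqP.
have sgy : Num.sg y = Num.sg (D x) by rewrite /y sgrM (gtr0_sg r0) mul1r.
have y0 : y != 0 by rewrite mulf_neq0// gt_eqF.
rewrite (_ : _ - _ = (`|y + v| - `|y| - Num.sg y * v) + Num.sg y * (v - H x)); last first.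
  by rewrite sgy; ring.
rewrite (le_trans (ler_normD _ _))// addrC lerD//.
  by rewrite normrM (le_trans _ EDH)// ler_piMl.
have [vy|yv] := leP `|v| `|y|.
  suff -> : `|y + v| - `|y| - Num.sg y * v = 0 by rewrite normr0.
  move: vy; case: (sgrP y) => [/eqP|{}y0|{}y0]; first by rewrite (negbTE y0).
    rewrite ler_norml => /andP[h1 h2].
    have h3 : 0 <= y + v by lra.
    by rewrite ger0_norm//; ring.
  rewrite ler_norml => /andP[h1 h2].
  have h3 : y + v <= 0 by lra.
  by rewrite ler0_norm//; ring.
rewrite indicE mem_set ?mulr1; last first.
  split => //; rewrite normr_gt0 D0/= ler_pdivlMr//.
  by rewrite mulrC -[r in leLHS]gtr0_norm// -normrM ltW// (lt_le_trans yv).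
apply: (@le_trans _ _ (2 * `|v|)); last by rewrite ler_wpM2l.
rewrite (le_trans (ler_normB _ _))// mulrDl mul1r lerD//.
  by rewrite (le_trans (ler_dist_dist _ _))// addrC addKr.
by rewrite normrM ler_piMl.
Qed.

Lemma dir_integrand_lipschitz D G H (e : R) :
  bounded_measurable X D -> bounded_measurable X G -> bounded_measurable X H ->
  (forall x, X x -> `|G x - H x| <= e) ->
  `|\int[mu]_(x in X) dir_integrand (zero_set D) (fun x => Num.sg (D x)) G x -
    \int[mu]_(x in X) dir_integrand (zero_set D) (fun x => Num.sg (D x)) H x| <=
  e * fine (mu X).
Proof.
move=> bD bG bH GH.
have mD : measurable (zero_set D) by apply: measurable_zero_set; case: bD.
have := @Rintegral_dist_indic _ _ _ mu X mX muX
  (dir_integrand (zero_set D) (fun x => Num.sg (D x)) G)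
  (dir_integrand (zero_set D) (fun x => Num.sg (D x)) H) e 0 set0 measurable0.
rewrite mul0r addr0; apply.
- by apply: bounded_measurable_dir => //; exact: bounded_measurable_sg.
- by apply: bounded_measurable_dir => //; exact: bounded_measurable_sg.
move=> x Xx; rewrite mul0r addr0; have {}GH := GH x Xx.
have [zx|nzx] := pselect (zero_set D x).
  by rewrite !dir_integrand_in// (le_trans _ GH)// ler_dist_dist.
rewrite !dir_integrand_notin// -mulrBr normrM (le_trans _ GH)// ler_piMl//.
by rewrite normr_sg; case: (D x != 0).
Qed.

End directional_derivative.

(** * Mean values, and uniformity over a compact set *)

Lemma mx_dot_le (R : realType) p (u v : 'cV[R]_p) :
  `|(u^T *m v) 0 0| <= p%:R * `|u| * `|v|.
Proof.
apply: (le_trans (mx_norm_entry _ _ _)); apply: (le_trans (norm_mulmx_le _ _)).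
rewrite ler_wpM2r// ler_wpM2l//; apply/mx_norm_leP => // i j.
by rewrite mxE mx_norm_entry.
Qed.

Lemma derive_grad (R : realType) p (f : 'cV[R]_p -> R) (b v : 'cV[R]_p) :
  differentiable f b -> 'D_v f b = ((grad f b)^T *m v) 0 0.
Proof.
move=> df; rewrite deriveE// mxE.
have {1}-> : v = \sum_(i < p) v i 0 *: delta_mx i 0.
  by rewrite [LHS]matrix_sum_delta; apply: eq_bigr => i _; rewrite big_ord1.
rewrite linear_sum; apply: eq_bigr => i _ /=.
by rewrite linearZ/= !mxE -deriveE// mulrC.
Qed.

Lemma mean_value_grad (R : realType) p (f : 'cV[R]_p -> R) (a b : 'cV[R]_p) (r : R) :
  (forall c, ball a r c -> differentiable f c) -> ball a r b ->
  exists2 c, `|c - a| <= `|b - a| & f b - f a = ((grad f c)^T *m (b - a)) 0 0.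
Proof.
move=> df ab; pose v := b - a; pose h (s : R) := f (a + s *: v).
have seg (s : R) : 0 <= s <= 1 -> `|a + s *: v - a| <= `|v|.
  move=> /andP[s0 s1]; rewrite addrC addKr normrZ ger0_norm//.
  by rewrite ler_piMl.
have dfs (s : R) : 0 <= s <= 1 -> differentiable f (a + s *: v).
  move=> /seg s01; apply: df; move: ab; rewrite -ball_normE/= => ab.
  by rewrite distrC (le_lt_trans s01)// distrC.
have hE (s : R) : (fun k : R => k^-1 *: ((h \o shift s) (k *: 1) - h s)) =
    (fun k => k^-1 *: ((f \o shift (a + s *: v)) (k *: v) - f (a + s *: v))).
  apply/funext => k; rewrite /h /= [k *: 1]mulr1 scalerDl; congr (_ *: (f _ - _)).
  by rewrite addrCA.
have dh (s : R) : 0 <= s <= 1 -> is_derive s 1 h (((grad f (a + s *: v))^T *m v) 0 0).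
  move=> /dfs ds; apply: DeriveDef.
    by rewrite /derivable hE; exact: diff_derivable.
  by rewrite -derive_grad// /derive hE.
have [s|s|s s01 hs] := @MVT R h (fun s => ((grad f (a + s *: v))^T *m v) 0 0) 0 1 ltr01.
- by rewrite in_itv/= => /andP[s0 s1]; apply: dh; rewrite !ltW.
- apply: derivable_within_continuous => u; rewrite in_itv/= => u01.
  by have [] := dh u u01.
exists (a + s *: v).
  by apply: seg; move: s01; rewrite in_itv/= => /andP[s0 s1]; rewrite !ltW.
move: hs; rewrite /h scale1r scale0r addr0 subr0 mulr1 => <-.
by rewrite /v (addrC a) subrK.
Qed.

Section uniform_in_covariate.
Context {R : realType} {d p : nat}.
Variables (X : set 'rV[R]_d) (D : set 'cV[R]_p) (f : 'rV[R]_d -> 'cV[R]_p -> R).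
Hypotheses (cX : compact X)
  (cf : {within X `*` D, continuous (fun z : 'rV[R]_d * 'cV[R]_p => f z.1 z.2)}).

(** Every [x] has a neighborhood on which the bound holds for all [b] close to
    [b0]; finitely many of them cover [X]. *)
Lemma continuous_near_uniform b0 : nbhs b0 D ->
  forall e, 0 < e -> \forall b \near b0, forall x, X x -> `|f x b - f x b0| <= e.
Proof.
move=> Db0 e e0.
have /compact_near_coveringP/near_covering_withinP := cX.
move=> /(_ _ (nbhs b0) (fun b x => `|f x b - f x b0| <= e)); apply.
move=> x Xx; have Db : D b0 by exact: nbhs_singleton.
move/subspace_continuousP : cf => /(_ (x, b0)) /(_ (conj Xx Db)).
have e2 : 0 < e / 2 by rewrite divr_gt0.
move=> /cvgrPdist_lt /(_ _ e2) /=; rewrite near_withinE => -[[U V] [/= Ux Vb] UV].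
exists (U, V `&` D); first by split => //=; exact: filterI.
move=> [x' b] /= [Ux' [Vb' Db']] Xx'.
have h1 : `|f x b0 - f x' b0| < e / 2.
  by apply: (UV (x', b0)) => //; split => //=; exact: nbhs_singleton.
have h2 : `|f x b0 - f x' b| < e / 2 by exact: (UV (x', b)).
rewrite (_ : _ - _ = (f x b0 - f x' b0) - (f x b0 - f x' b)); last by ring.
by rewrite (le_trans (ler_normB _ _))// (splitr e) lerD// ltW.
Qed.

Lemma continuous_section b : D b -> {within X, continuous (fun x => f x b)}.
Proof.
move=> Db; apply/subspace_continuousP => x Xx.
move/subspace_continuousP : cf => /(_ (x, b)) /(_ (conj Xx Db)).
move=> /cvgrPdist_lt h; apply/cvgrPdist_lt => e /h.
rewrite !near_withinE => -[[U V] [/= Ux Vb] UV]; near=> x' => Xx'.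
apply: (UV (x', b)) => //; split => /=; last exact: nbhs_singleton.
by near: x'.
Unshelve. all: by end_near. Qed.

Lemma bounded_measurable_section b : D b ->
  bounded_measurable X (fun x => f x b).
Proof.
move=> Db; split.
  apply: within_continuous_measurable_mx; first exact: compact_measurable_mx.
  exact: continuous_section.
have /compact_bounded[M [_ MP]] := continuous_compact (continuous_section Db) cX.
exists (`|M| + 1) => x Xx; apply: (MP (`|M| + 1)); last by exists x.
by rewrite (le_lt_trans (ler_norm M))// ltrDl.
Qed.

Lemma measurable_section_comp d' (T : measurableType d') (h : T -> 'cV[R]_p) :
  measurable D -> measurable_fun setT h -> (forall w, D (h w)) ->
  measurable_fun (X `*` setT) (fun z : 'rV[R]_d * T => f z.1 (h z.2)).
Proof.
move=> mD mh Dh.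
have mX : measurable X by exact: compact_measurable_mx.
have mXD : measurable (X `*` D) by exact: measurableX.
apply: (@measurable_comp _ _ _ _ _ _ (X `*` D) (fun z : 'rV[R]_d * 'cV[R]_p => f z.1 z.2)
  _ (fun z : 'rV[R]_d * T => (z.1, h z.2)) mXD).
- by move=> _ [[x w] [/= Xx _] <-]; split => //=; exact: Dh.
- exact: within_continuous_measurable_mx_pair.
- apply: measurable_funTS; apply: measurable_fun_pair => //.
  exact: measurableT_comp.
Qed.

End uniform_in_covariate.

(** * Expansion of a regression function at the true parameter *)

Lemma mxBE (V : zmodType) m n (A B : 'M[V]_(m, n)) i j :
  (A - B) i j = A i j - B i j.
Proof. by rewrite !mxE. Qed.

Section one_group_expansion.
Context {dO : measure_display} {Omega : measurableType dO} {R : realType}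
  {P : probability Omega R} {d : nat}.
Variables (g : group P d) (X : set 'rV[R]_d).
Hypotheses (cX : compact X) (A4 : assumption4 g X).

Definition dot_grad (b v : 'cV[R]_(npar g)) (x : 'rV[R]_d) : R :=
  ((grad (reg g x) b)^T *m v) 0 0.

Lemma bounded_measurable_reg D b : C2_on X D (reg g) -> D b ->
  bounded_measurable X (fun x => reg g x b).
Proof. by move=> [_ cf _ _] Db; exact: (bounded_measurable_section cX cf Db). Qed.

Lemma bounded_measurable_dot_grad D b v : C2_on X D (reg g) -> D b ->
  bounded_measurable X (dot_grad b v).
Proof.
move=> [_ _ cg _] Db; rewrite /dot_grad.
under [X in bounded_measurable _ X]eq_fun do rewrite mxE.
apply: bounded_measurable_sum => i; apply: bounded_measurableM.
  under [X in bounded_measurable _ X]eq_fun do rewrite mxE.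
  exact: (bounded_measurable_section (f := fun x b => grad (reg g x) b i 0) cX (cg i) Db).
exact: bounded_measurable_cst.
Qed.

Lemma grad_near_uniform e : 0 < e -> \forall b \near par g,
  forall x, X x -> `|grad (reg g x) b - grad (reg g x) (par g)| <= e.
Proof.
move=> e0; have [[U [oU Up [_ _ cg _]]] _] := A4.
have nU : nbhs (par g) U by exact: open_nbhs_nbhs.
have : \forall b \near par g, forall i : 'I_(npar g), forall x, X x ->
    `|grad (reg g x) b i 0 - grad (reg g x) (par g) i 0| <= e.
  apply: (@filter_forall _ _ _ (nbhs (par g))) => i.
  exact: (continuous_near_uniform (f := fun x b => grad (reg g x) b i 0) cX (cg i) nU e0).
apply: filterS => b h x Xx; apply/mx_norm_leP; first exact: ltW.
move=> i j; rewrite (ord1 j).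
by rewrite mxBE; exact: h.
Qed.

Lemma grad_bounded : exists2 C, 0 <= C &
  forall x, X x -> `|grad (reg g x) (par g)| <= C.
Proof.
have [[U [oU Up [_ _ cg _]]] _] := A4.
have /choice[C CP] : forall i : 'I_(npar g), exists C, forall x, X x ->
    `|grad (reg g x) (par g) i 0| <= C.
  move=> i; have [_ [C CP]] := bounded_measurable_section
      (f := fun x b => grad (reg g x) b i 0) cX (cg i) Up.
  by exists C.
exists (\sum_i `|C i|); first exact: sumr_ge0.
move=> x Xx; apply/mx_norm_leP; first exact: sumr_ge0.
move=> i j; rewrite (ord1 j) (le_trans (CP i x Xx))// (le_trans (ler_norm _))//.
by rewrite (bigD1 i)//= lerDl; exact: sumr_ge0.
Qed.

(** By the mean value theorem the remainder is an increment of the gradient, which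
    is small uniformly in the covariate. *)
Lemma taylor_uniform e : 0 < e -> \forall b \near par g, forall x, X x ->
  `|reg g x b - reg g x (par g) - dot_grad (par g) (b - par g) x| <=
    e * `|b - par g|.
Proof.
move=> e0; have [[U [oU Up [dU _ _ _]]] _] := A4.
pose e' := e / ((npar g)%:R + 1).
have p1 : 0 < (npar g)%:R + 1 :> R by rewrite ltr_wpDl.
have e'0 : 0 < e' by rewrite divr_gt0.
have /nbhs_ballP[r/= r0 rP] : \forall b \near par g, U b /\
    forall x, X x -> `|grad (reg g x) b - grad (reg g x) (par g)| <= e'.
  by apply: filterI; [exact: open_nbhs_nbhs|exact: grad_near_uniform].
near=> b => x Xx.
have rb : ball (par g) r b by near: b; exact: nbhsx_ballx.
have [c cb ->] : exists2 c, `|c - par g| <= `|b - par g| &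
    reg g x b - reg g x (par g) = dot_grad c (b - par g) x.
  apply: (mean_value_grad _ rb) => c /rP[Uc _].
  by have [] := dU x c Xx Uc.
have /rP[_ /(_ x Xx) gc] : ball (par g) r c.
  by move: rb; rewrite -!ball_normE/= distrC => rb; rewrite distrC (le_lt_trans cb).
have -> : dot_grad c (b - par g) x - dot_grad (par g) (b - par g) x =
    ((grad (reg g x) c - grad (reg g x) (par g))^T *m (b - par g)) 0 0.
  by rewrite [(_ - _)^T]linearB/= mulmxBl mxBE.
rewrite (le_trans (mx_dot_le _ _))// ler_wpM2r//.
apply: (@le_trans _ _ ((npar g)%:R * e')); first by rewrite ler_wpM2l.
by rewrite /e' mulrCA ler_piMr ?ltW// ltr_pdivrMr// mul1r ltrDl.
Unshelve. all: by end_near. Qed.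

Lemma dot_gradB b v v' x : dot_grad b v x - dot_grad b v' x = dot_grad b (v - v') x.
Proof. by rewrite /dot_grad mulmxBr mxBE. Qed.

Lemma dot_gradZ b (c : R) v x : dot_grad b (c *: v) x = c * dot_grad b v x.
Proof. by rewrite /dot_grad -scalemxAr mxE. Qed.

Lemma dot_grad_le b v x :
  `|dot_grad b v x| <= (npar g)%:R * `|grad (reg g x) b| * `|v|.
Proof. exact: mx_dot_le. Qed.

End one_group_expansion.

(** * Estimated quantities of one group *)

Lemma psd_information (dO : measure_display) (Omega : measurableType dO)
    (R : realType) (P : probability Omega R) (d : nat) (g : group P d)
    (s : R) (u : 'I_(ncov g) -> R) b :
  0 <= s -> (forall i, 0 <= u i) -> psd (information g s u b).
Proof.
move=> s0 u0; split.
  rewrite linearZ/= linear_sum; congr (_ *: _); apply: eq_bigr => i _ /=.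
  by rewrite linearZ/= trmx_mul trmxK.
move=> v; rewrite /information -scalemxAr -scalemxAl mxE mulr_ge0 ?invr_ge0//.
rewrite mulmx_sumr mulmx_suml summxE; apply: sumr_ge0 => i _.
rewrite -scalemxAr -scalemxAl mxE mulr_ge0//.
set a := grad _ _; have -> : v^T *m (a *m a^T) *m v = (a^T *m v)^T *m (a^T *m v).
  by rewrite trmx_mul trmxK !mulmxA.
by rewrite mxE; apply: sumr_ge0 => j _; rewrite mxE -expr2 sqr_ge0.
Qed.

Lemma cvg_summx (R : realType) (T : Type) (F : set_system T) {FF : Filter F}
    m n (I : Type) (s : seq I) (f : I -> T -> 'M[R]_(m, n)) (A : I -> 'M[R]_(m, n)) :
  (forall i, f i x @[x --> F] --> A i) ->
  \sum_(i <- s) f i x @[x --> F] --> \sum_(i <- s) A i.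
Proof.
move=> fA; apply/cvg_mxP => i j.
under eq_cvg do rewrite summxE; rewrite summxE.
by apply: cvg_sumr => l; have /cvg_mxP := fA l; exact.
Qed.

Lemma cvg_sqrt_nat_inv (R : realType) (T : Type) (F : set_system T)
    {FF : Filter F} (n : T -> nat) : n x @[x --> F] --> \oo ->
  (Num.sqrt (n x)%:R)^-1 @[x --> F] --> (0 : R).
Proof.
move=> nF; apply/cvgrPdist_lt => e e0.
have [m me] : exists m : nat, e ^- 2 < m%:R.
  by exists (Num.truncn (e ^- 2)).+1; exact: truncnS_gt.
have : \forall x \near F, (m <= n x)%N by move/cvgnyPge : nF; exact.
apply: filterS => x mx.
have n0 : e ^- 2 < (n x)%:R by rewrite (lt_le_trans me)// ler_nat.
have e2 : 0 < e ^- 2 by rewrite invr_gt0 exprn_gt0.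
have s0 : 0 < Num.sqrt (n x)%:R :> R by rewrite sqrtr_gt0 (lt_trans e2).
rewrite sub0r normrN gtr0_norm ?invr_gt0// -[e]invrK ltf_pV2 ?posrE ?invr_gt0//.
rewrite -[e^-1]gtr0_norm ?invr_gt0// -sqrtr_sqr ltr_sqrt ?(lt_trans e2)//.
by rewrite exprVn.
Qed.

Section one_group_limits.
Context {dO : measure_display} {Omega : measurableType dO} {R : realType}
  {P : probability Omega R} {d : nat}.
Variables (g : group P d) (X : set 'rV[R]_d).
Hypotheses (cX : compact X) (dX : design g X) (A1 : assumption1 g)
  (A4 : assumption4 g X) (A6 : assumption6 g).

Definition scaled_error (N : nat) (w : Omega) : 'cV[R]_(npar g) :=
  Num.sqrt (size_of g N)%:R *: (est g N w - par g).

(* The limits are taken along a filter F on pairs (stage, outcome) on which the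
   stage tends to infinity while the scaled error stays bounded: convergence
   along F is convergence uniform in such outcomes. *)
Variables (F : set_system (nat * Omega)) (K : R).
Context {FF : Filter F}.
Hypotheses (F_oo : z.1 @[z --> F] --> \oo)
  (F_err : \forall z \near F, `|scaled_error z.1 z.2| <= K)
  (F_var : varest g z.1 z.2 @[z --> F] --> var g).

Lemma cvg_size : size_of g z.1 @[z --> F] --> \oo.
Proof. by have [_ + _ _] := A6; exact: cvg_comp F_oo. Qed.

Lemma size_gt0_near : \forall z \near F, (0 < size_of g z.1)%N.
Proof. by move/cvgnyPge : cvg_size; apply. Qed.

Lemma cvg_est : est g z.1 z.2 @[z --> F] --> par g.
Proof.
apply/cvgrPdist_le => e e0.
have K1 : 0 < `|K| + 1 by rewrite ltr_wpDl.
have eK : 0 < e / (`|K| + 1) by rewrite divr_gt0.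
near=> z.
have n0 : 0 < Num.sqrt (size_of g z.1)%:R :> R.
  by rewrite sqrtr_gt0 ltr0n; near: z; exact: size_gt0_near.
have -> : par g - est g z.1 z.2 =
    - ((Num.sqrt (size_of g z.1)%:R)^-1 *: scaled_error z.1 z.2).
  by rewrite /scaled_error scalerA mulVf ?gt_eqF// scale1r opprB.
rewrite normrN normrZ gtr0_norm ?invr_gt0//.
have h1 : (Num.sqrt (size_of g z.1)%:R)^-1 <= e / (`|K| + 1).
  apply: (le_trans (ler_norm _)); rewrite -normrN -sub0r.
  by near: z; move/cvgrPdist_le : (@cvg_sqrt_nat_inv R _ F FF _ cvg_size); exact.
have h2 : `|scaled_error z.1 z.2| <= `|K| + 1.
  rewrite (@le_trans _ _ K)//; first by near: z; exact: F_err.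
  by rewrite (le_trans (ler_norm K))// lerDl.
apply: (@le_trans _ _ (e / (`|K| + 1) * (`|K| + 1))).
  by apply: ler_pM => //; rewrite invr_ge0 ltW.
by rewrite divfK// gt_eqF.
Unshelve. all: by end_near. Qed.

Lemma grad_est_uniform e : 0 < e -> \forall z \near F,
  forall x, X x -> `|grad (reg g x) (est g z.1 z.2) - grad (reg g x) (par g)| <= e.
Proof. by move=> e0; exact: cvg_est (grad_near_uniform cX A4 e0). Qed.

Lemma taylor_est_uniform e : 0 < e -> \forall z \near F, forall x, X x ->
  `|reg g x (est g z.1 z.2) - reg g x (par g) -
    dot_grad (par g) (est g z.1 z.2 - par g) x| <= e * `|est g z.1 z.2 - par g|.
Proof. by move=> e0; exact: cvg_est (taylor_uniform cX A4 e0). Qed.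

Lemma var_gt0 : 0 < var g. Proof. by case: A1. Qed.

Lemma frac_ge0 N i : 0 <= Defs.frac g N i.
Proof. by rewrite divr_ge0. Qed.

Lemma zeta_ge0 i : 0 <= zeta g i.
Proof. by have [_ _ _ /(_ i)/andP[/ltW]] := A6. Qed.

Lemma psd_Sigma : psd (Sigma g).
Proof. by apply: psd_information; [exact/ltW/var_gt0|exact: zeta_ge0]. Qed.

Lemma psd_Sigma_hat_near : \forall z \near F, psd (Sigma_hat g z.1 z.2).
Proof.
move/cvgrPdist_lt : F_var => /(_ _ var_gt0); apply: filterS => z.
rewrite ltr_norml => /andP[_ h]; apply: psd_information; last exact: frac_ge0.
by move: h; rewrite ltrBlDl ltrDr => /ltW.
Qed.

Lemma cvg_Sigma_hat : Sigma_hat g z.1 z.2 @[z --> F] --> Sigma g.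
Proof.
apply: cvgZ; first by apply: cvgV => //; rewrite gt_eqF// var_gt0.
apply: cvg_summx => i; apply: cvgZ.
  by have [_ _ + _] := A6 => /(_ i); exact: cvg_comp F_oo.
have cg : grad (reg g (cov g i)) (est g z.1 z.2) @[z --> F] -->
    grad (reg g (cov g i)) (par g).
  apply/cvgrPdist_le => e e0; have := grad_est_uniform e0.
  apply: filterS => z h; rewrite distrC; apply: h.
  by case: dX.
by apply: cvg_mulmx => //; exact: cvg_trmx.
Qed.

Lemma cvg_invsqrt_Sigma_hat :
  invsqrtmx (Sigma_hat g z.1 z.2) @[z --> F] --> invsqrtmx (Sigma g).
Proof.
apply: cvg_invsqrtmx; [by case: A6|exact: psd_Sigma|exact: psd_Sigma_hat_near|].
exact: cvg_Sigma_hat.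
Qed.

(** The vector [v] stands for a normal vector, which varies while the data are
    held fixed; hence the bound for all [v] at once. *)
Lemma dot_grad_est_uniform m (W_ : nat * Omega -> 'M[R]_(npar g, m))
    (W : 'M[R]_(npar g, m)) e :
  W_ z @[z --> F] --> W -> 0 < e -> \forall z \near F, forall x, X x ->
  forall v : 'cV[R]_m,
  `|dot_grad (est g z.1 z.2) (W_ z *m v) x - dot_grad (par g) (W *m v) x| <=
    e * `|v|.
Proof.
move=> cW e0; have [C C0 CP] := grad_bounded cX A4.
pose p : R := (npar g)%:R.
pose A := p * m%:R * (`|W| + 1) + 1; pose B := p * C * m%:R + 1.
have A0 : 0 < A by rewrite ltr_wpDl// !mulr_ge0// addr_ge0.
have B0 : 0 < B by rewrite ltr_wpDl// !mulr_ge0.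
have eA : 0 < e / 2 / A by rewrite !divr_gt0.
have eB : 0 < e / 2 / B by rewrite !divr_gt0.
near=> z => x Xx v.
have g1 : `|grad (reg g x) (est g z.1 z.2) - grad (reg g x) (par g)| <= e / 2 / A.
  by move: x Xx; near: z; exact: grad_est_uniform.
have W1 : `|W - W_ z| <= e / 2 / B by near: z; move/cvgrPdist_le : cW; exact.
have W2 : `|W_ z| <= `|W| + 1.
  have : `|W - W_ z| <= 1 by near: z; move/cvgrPdist_le : cW; exact.
  rewrite distrC => h; rewrite -[W_ z](subrK W) addrC.
  by rewrite (le_trans (ler_normD _ _))// lerD2l.
rewrite (_ : _ - _ =
  ((grad (reg g x) (est g z.1 z.2) - grad (reg g x) (par g))^T *m (W_ z *m v)) 0 0
  + dot_grad (par g) (W_ z *m v - W *m v) x); last first.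
  rewrite -dot_gradB [(_ - _)^T]linearB/= mulmxBl mxBE /dot_grad; ring.
apply: (le_trans (ler_normD _ _)); rewrite [in leRHS](splitr e) mulrDl lerD//.
  apply: (le_trans (mx_dot_le _ _)).
  apply: (@le_trans _ _ (p * (e / 2 / A) * (m%:R * (`|W| + 1) * `|v|))).
    rewrite ler_pM// ?mulr_ge0//; first by rewrite ler_wpM2l.
    apply: (le_trans (norm_mulmx_le _ _)).
    by rewrite ler_wpM2r// ler_wpM2l.
  have -> : p * (e / 2 / A) * (m%:R * (`|W| + 1) * `|v|) =
    e / 2 * (p * m%:R * (`|W| + 1) / A) * `|v| by ring.
  rewrite ler_wpM2r// ler_piMr ?divr_ge0 ?ltW// ltr_pdivrMr// mul1r.
  by rewrite /A ltrDl.
apply: (le_trans (dot_grad_le _ _ _)); rewrite -mulmxBl.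
apply: (@le_trans _ _ (p * C * (m%:R * (e / 2 / B) * `|v|))).
  rewrite ler_pM// ?mulr_ge0//; first by rewrite ler_wpM2l// CP.
  apply: (le_trans (norm_mulmx_le _ _)).
  by rewrite ler_wpM2r// ler_wpM2l// distrC.
have -> : p * C * (m%:R * (e / 2 / B) * `|v|) =
  e / 2 * (p * C * m%:R / B) * `|v| by ring.
rewrite ler_wpM2r// ler_piMr ?divr_ge0 ?ltW// ltr_pdivrMr// mul1r.
by rewrite /B ltrDl.
Unshelve. all: by end_near. Qed.

End one_group_limits.

(** * Expansions of the distance and of the conditional statistic *)

Lemma compact_lebesgue_lty (R : realType) d (X : set 'rV[R]_d) :
  compact X -> (lebesgue_rV d X < +oo)%E.
Proof.
move=> cX; have [M [_ MP]] := compact_bounded cX.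
pose I : set R := `[- (`|M| + 1), `|M| + 1]%classic.
pose B := [set v : 'rV[R]_d | forall i, I (v 0 i)].
have XB : X `<=` B.
  move=> v Xv i; rewrite /I/= in_itv/= -ler_norml.
  rewrite (le_trans (mx_norm_entry _ _ _))// (MP (`|M| + 1))//.
  by rewrite (le_lt_trans (ler_norm M))// ltrDl.
have mB : measurable B.
  rewrite (_ : B = \bigcap_(i in [set: 'I_d])
    ((fun v : 'rV[R]_d => v 0 i) @^-1` `[- (`|M| + 1), `|M| + 1])).
    apply: fin_bigcap_measurable => // i _.
    rewrite -[Y in measurable Y]setTI; apply: (measurable_entry 0 i measurableT).
    exact: measurable_itv.
  by apply/seteqP; split => v vB i; [move=> _|]; exact: vB.
apply: (@le_lt_trans _ _ (lebesgue_rV d B)).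
  by apply: le_measure; rewrite ?inE//; exact: compact_measurable_mx.
have -> : lebesgue_rV d B =
    (\prod_(i < d) @lebesgue_measure R I)%E.
  by apply: lebesgue_rV_box => i; exact: measurable_itv.
rewrite -ge0_fin_numE; last by apply: prode_ge0 => i _; exact: measure_ge0.
elim/big_ind: _ => // [x y xf yf|i _]; first exact: fin_numM.
by rewrite /= lebesgue_measure_itv/=; case: ifP.
Qed.

Lemma le_thirds (R : realType) (a u v : R) : u <= a / 3 -> v <= a / 6 ->
  u + a / 3 + (v + v) <= a.
Proof. lra. Qed.

Section two_group_limits.
Context {dO : measure_display} {Omega : measurableType dO} {R : realType}
  {P : probability Omega R} {d : nat}.
Variables (g1 g2 : group P d) (X : set 'rV[R]_d) (kappa c : R).
Hypotheses (cX : compact X)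
  (design1 : design g1 X) (design2 : design g2 X)
  (A1_1 : assumption1 g1) (A1_2 : assumption1 g2)
  (A3_1 : assumption3 g1) (A3_2 : assumption3 g2)
  (A4_1 : assumption4 g1 X) (A4_2 : assumption4 g2 X)
  (A6_1 : assumption6 g1) (A6_2 : assumption6 g2)
  (A6_kappa : kappa_hat g1 g2 N @[N --> \oo] --> kappa)
  (kappa_gt1 : 1 < kappa) (c_gt0 : 0 < c).

Notation leb := (lebesgue_rV d).
Notation p1 := (npar g1).
Notation p2 := (npar g2).

Let muX : (leb X < +oo)%E. Proof. exact: compact_lebesgue_lty. Qed.
Let mX : measurable X. Proof. exact: compact_measurable_mx. Qed.

Definition diff_fun (b1 : 'cV[R]_p1) (b2 : 'cV[R]_p2) (x : 'rV[R]_d) : R :=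
  reg g1 x b1 - reg g2 x b2.

Definition lin_fun (b1 : 'cV[R]_p1) (b2 : 'cV[R]_p2) (h1 : 'cV[R]_p1)
    (h2 : 'cV[R]_p2) (x : 'rV[R]_d) : R :=
  dot_grad b1 h1 x - dot_grad b2 h2 x.

Notation D0 := (diff_fun (par g1) (par g2)).

(** The directional derivative of [dist1 g1 g2 X] at the true parameters. *)
Definition dist_deriv (h1 : 'cV[R]_p1) (h2 : 'cV[R]_p2) : R :=
  \int[leb]_(x in X) dir_integrand (zero_set X D0) (fun x => Num.sg (D0 x))
    (lin_fun (par g1) (par g2) h1 h2) x.

Lemma bounded_measurable_diff D1 D2 b1 b2 :
  C2_on X D1 (reg g1) -> C2_on X D2 (reg g2) -> D1 b1 -> D2 b2 ->
  bounded_measurable X (diff_fun b1 b2).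
Proof.
move=> c1 c2 Db1 Db2.
by apply: bounded_measurableB;
  [exact: (bounded_measurable_reg cX c1)|exact: (bounded_measurable_reg cX c2)].
Qed.

Lemma bounded_measurable_lin D1 D2 b1 b2 h1 h2 :
  C2_on X D1 (reg g1) -> C2_on X D2 (reg g2) -> D1 b1 -> D2 b2 ->
  bounded_measurable X (lin_fun b1 b2 h1 h2).
Proof.
move=> c1 c2 Db1 Db2.
by apply: bounded_measurableB; [exact: (bounded_measurable_dot_grad cX _ c1)|
  exact: (bounded_measurable_dot_grad cX _ c2)].
Qed.

Lemma bounded_measurable_diff_par : bounded_measurable X D0.
Proof.
have [[U1 [_ u1 c1]] _] := A4_1; have [[U2 [_ u2 c2]] _] := A4_2.
exact: (bounded_measurable_diff c1 c2).
Qed.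

Lemma bounded_measurable_diff_est N w : bounded_measurable X (diff_fun (est g1 N w) (est g2 N w)).
Proof.
have [_ c1] := A4_1; have [_ c2] := A4_2.
have [_ e1] := A3_1; have [_ e2] := A3_2.
exact: (bounded_measurable_diff c1 c2).
Qed.

Lemma bounded_measurable_lin_par h1 h2 : bounded_measurable X (lin_fun (par g1) (par g2) h1 h2).
Proof.
have [[U1 [_ u1 c1]] _] := A4_1; have [[U2 [_ u2 c2]] _] := A4_2.
exact: (bounded_measurable_lin _ _ c1 c2).
Qed.

Lemma bounded_measurable_lin_est N w h1 h2 :
  bounded_measurable X (lin_fun (est g1 N w) (est g2 N w) h1 h2).
Proof.
have [_ c1] := A4_1; have [_ c2] := A4_2.
have [_ e1] := A3_1; have [_ e2] := A3_2.
exact: (bounded_measurable_lin _ _ c1 c2).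
Qed.

Lemma lin_fun_bound : exists2 C, 0 <= C & forall x h1 h2, X x ->
  `|lin_fun (par g1) (par g2) h1 h2 x| <= C * (`|h1| + `|h2|).
Proof.
have [C1 C1_0 C1P] := grad_bounded cX A4_1.
have [C2 C2_0 C2P] := grad_bounded cX A4_2.
pose C := p1%:R * C1 + p2%:R * C2.
have q1 : 0 <= p1%:R * C1 by rewrite mulr_ge0.
have q2 : 0 <= p2%:R * C2 by rewrite mulr_ge0.
exists C => [|x h1 h2 Xx]; first exact: addr_ge0.
rewrite (le_trans (ler_normB _ _))// mulrDr lerD//.
  rewrite (le_trans (dot_grad_le _ _ _))// ler_wpM2r//.
  by rewrite (@le_trans _ _ (p1%:R * C1)) ?lerDl// ler_wpM2l// C1P.
rewrite (le_trans (dot_grad_le _ _ _))// ler_wpM2r//.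
by rewrite (@le_trans _ _ (p2%:R * C2)) ?lerDr// ler_wpM2l// C2P.
Qed.

Lemma lin_funB b1 b2 h1 h2 k1 k2 x :
  lin_fun b1 b2 h1 h2 x - lin_fun b1 b2 k1 k2 x =
  lin_fun b1 b2 (h1 - k1) (h2 - k2) x.
Proof. by rewrite /lin_fun -!dot_gradB; ring. Qed.

Lemma dist_deriv_lipschitz : exists2 L, 0 <= L & forall h1 h2 k1 k2,
  `|dist_deriv h1 h2 - dist_deriv k1 k2| <= L * `|h1 - k1| + L * `|h2 - k2|.
Proof.
have [C C0 CP] := lin_fun_bound; exists (C * fine (leb X)).
  by rewrite mulr_ge0// fine_ge0.
move=> h1 h2 k1 k2.
apply: (@le_trans _ _ (C * (`|h1 - k1| + `|h2 - k2|) * fine (leb X))).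
  apply: dir_integrand_lipschitz => //; [exact: bounded_measurable_diff_par|exact: bounded_measurable_lin_par|exact: bounded_measurable_lin_par|].
  by move=> x Xx; rewrite lin_funB; exact: CP.
by rewrite -mulrDr mulrAC.
Qed.

Lemma T_limitE (Z1 : {RV P >-> 'cV[R]_p1}) (Z2 : {RV P >-> 'cV[R]_p2}) w :
  T_limit X Z1 Z2 kappa w = dist_deriv
    (Num.sqrt kappa *: (invsqrtmx (Sigma g1) *m Z1 w))
    (Num.sqrt (kappa / (kappa - 1)) *: (invsqrtmx (Sigma g2) *m Z2 w)).
Proof.
have mZ : measurable (zero_set X D0) by apply: measurable_zero_set => //; case: bounded_measurable_diff_par.
have b1 : bounded_measurable X (fun x => Num.sg (D0 x)).
  by apply: bounded_measurable_sg => //; exact: bounded_measurable_diff_par.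
have ZX : zero_set X D0 `<=` X by move=> x [].
rewrite /dist_deriv -(Rintegral_dir mX muX mZ ZX b1 (bounded_measurable_lin_par _ _)).
have ZE : zero_set X D0 = [set x | X x /\ reg g1 x (par g1) = reg g2 x (par g2)].
  by apply/seteqP; split => x [Xx] /eqP; rewrite ?subr_eq0 => /eqP h; split => //;
    apply/eqP; rewrite ?subr_eq0; apply/eqP.
by rewrite ZE.
Qed.

Variables (F : set_system (nat * Omega)) (K : R).
Context {FF : Filter F}.
Hypotheses (F_oo : z.1 @[z --> F] --> \oo) (K_ge0 : 0 <= K)
  (F_err1 : \forall z \near F, `|scaled_error g1 z.1 z.2| <= K)
  (F_err2 : \forall z \near F, `|scaled_error g2 z.1 z.2| <= K)
  (F_var1 : varest g1 z.1 z.2 @[z --> F] --> var g1)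
  (F_var2 : varest g2 z.1 z.2 @[z --> F] --> var g2).

Notation n z := (total_size g1 g2 z.1).
Notation rootn z := (Num.sqrt (n z)%:R : R).
Notation r1 z := (Num.sqrt (kappa_hat g1 g2 z.1)).
Notation r2 z := (Num.sqrt (kappa_hat g1 g2 z.1 / (kappa_hat g1 g2 z.1 - 1))).
Notation s1 := (Num.sqrt kappa).
Notation s2 := (Num.sqrt (kappa / (kappa - 1))).

Lemma sqrt_cvg (f : nat * Omega -> R) a : f z @[z --> F] --> a ->
  Num.sqrt (f z) @[z --> F] --> Num.sqrt a.
Proof. by move=> fa; apply: (cvg_comp f Num.sqrt fa); exact: sqrt_continuous. Qed.

Lemma cvg_kappa : kappa_hat g1 g2 z.1 @[z --> F] --> kappa.
Proof. exact: (cvg_comp fst _ F_oo A6_kappa). Qed.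

Lemma cvg_r1 : r1 z @[z --> F] --> s1.
Proof. exact: sqrt_cvg cvg_kappa. Qed.

Lemma cvg_r2 : r2 z @[z --> F] --> s2.
Proof.
apply: sqrt_cvg; apply: cvgM; first exact: cvg_kappa.
apply: cvgV; first by rewrite subr_eq0 gt_eqF.
by apply: cvgB; [exact: cvg_kappa|exact: cvg_cst].
Qed.

Lemma cvg_total : n z @[z --> F] --> \oo.
Proof.
apply/cvgnyPge => m.
have := cvg_size A6_1 F_oo; move/cvgnyPge => /(_ m); apply: filterS => z h.
by rewrite (leq_trans h)// leq_addr.
Qed.

(** Because [n / n_1 = kappa_hat] and [n / n_2 = kappa_hat / (kappa_hat - 1)]. *)
Lemma rescaled_errors : \forall z \near F,
  rootn z *: (est g1 z.1 z.2 - par g1) = r1 z *: scaled_error g1 z.1 z.2 /\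
  rootn z *: (est g2 z.1 z.2 - par g2) = r2 z *: scaled_error g2 z.1 z.2.
Proof.
near=> z.
have n1 : (0 < size_of g1 z.1)%N by near: z; exact: (size_gt0_near A6_1).
have n2 : (0 < size_of g2 z.1)%N by near: z; exact: (size_gt0_near A6_2).
have n10 : 0 < (size_of g1 z.1)%:R :> R by rewrite ltr0n.
have n20 : 0 < (size_of g2 z.1)%:R :> R by rewrite ltr0n.
have kE : kappa_hat g1 g2 z.1 =
    ((size_of g1 z.1)%:R + (size_of g2 z.1)%:R) / (size_of g1 z.1)%:R.
  by rewrite /kappa_hat /total_size natrD.
have k0 : 0 <= kappa_hat g1 g2 z.1 by rewrite divr_ge0.
have kE1 : kappa_hat g1 g2 z.1 - 1 = (size_of g2 z.1)%:R / (size_of g1 z.1)%:R.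
  by rewrite kE mulrDl divff ?gt_eqF// addrC addKr.
have k1 : 0 < kappa_hat g1 g2 z.1 - 1 by rewrite kE1 divr_gt0.
split; rewrite /scaled_error scalerA -sqrtrM ?divr_ge0 ?(ltW k1)//;
  congr (Num.sqrt _ *: _); rewrite /total_size natrD.
  by rewrite kE divfK// gt_eqF.
by rewrite kE1 kE; field; rewrite !gt_eqF.
Unshelve. all: by end_near. Qed.

Let B := K * (s1 + 1) + K * (s2 + 1).

Lemma rescaled_bound : \forall z \near F,
  `|rootn z *: (est g1 z.1 z.2 - par g1)| +
  `|rootn z *: (est g2 z.1 z.2 - par g2)| <= B.
Proof.
near=> z.
have [-> ->] : rootn z *: (est g1 z.1 z.2 - par g1) = r1 z *: scaled_error g1 z.1 z.2 /\
  rootn z *: (est g2 z.1 z.2 - par g2) = r2 z *: scaled_error g2 z.1 z.2.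
  by near: z; exact: rescaled_errors.
have h1 : r1 z <= s1 + 1.
  have : `|s1 - r1 z| <= 1 by near: z; move/cvgrPdist_le : cvg_r1; exact.
  by rewrite ler_norml => /andP[]; lra.
have h2 : r2 z <= s2 + 1.
  have : `|s2 - r2 z| <= 1 by near: z; move/cvgrPdist_le : cvg_r2; exact.
  by rewrite ler_norml => /andP[]; lra.
have e1 : `|scaled_error g1 z.1 z.2| <= K by near: z.
have e2 : `|scaled_error g2 z.1 z.2| <= K by near: z.
rewrite normrZ [X in _ + X <= _]normrZ !(ger0_norm (sqrtr_ge0 _)).
by apply: lerD; rewrite mulrC; apply: ler_pM.
Unshelve. all: by end_near. Qed.

Lemma B_ge0 : 0 <= B.
Proof. by rewrite addr_ge0// mulr_ge0// addr_ge0// sqrtr_ge0. Qed.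

Lemma diff_expansion e : 0 < e -> \forall z \near F, forall x, X x ->
  `|rootn z * (diff_fun (est g1 z.1 z.2) (est g2 z.1 z.2) x - D0 x) -
    lin_fun (par g1) (par g2) (rootn z *: (est g1 z.1 z.2 - par g1))
      (rootn z *: (est g2 z.1 z.2 - par g2)) x| <= e.
Proof.
move=> e0; have B1 : 0 < B + 1 by rewrite ltr_wpDl// B_ge0.
have eB : 0 < e / (B + 1) by rewrite divr_gt0.
have u1 := taylor_est_uniform cX A4_1 A6_1 F_oo F_err1 eB.
have u2 := taylor_est_uniform cX A4_2 A6_2 F_oo F_err2 eB.
near=> z => x Xx.
have /(_ x Xx) t1 : forall x, X x -> `|reg g1 x (est g1 z.1 z.2) - reg g1 x (par g1) -
    dot_grad (par g1) (est g1 z.1 z.2 - par g1) x| <= e / (B + 1) * `|est g1 z.1 z.2 - par g1|.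
  by near: z; exact: u1.
have /(_ x Xx) t2 : forall x, X x -> `|reg g2 x (est g2 z.1 z.2) - reg g2 x (par g2) -
    dot_grad (par g2) (est g2 z.1 z.2 - par g2) x| <= e / (B + 1) * `|est g2 z.1 z.2 - par g2|.
  by near: z; exact: u2.
have bd : `|rootn z *: (est g1 z.1 z.2 - par g1)| +
    `|rootn z *: (est g2 z.1 z.2 - par g2)| <= B by near: z; exact: rescaled_bound.
rewrite /lin_fun !dot_gradZ -mulrBr -mulrBr normrM (ger0_norm (sqrtr_ge0 _)).
move: bd; rewrite !normrZ !(ger0_norm (sqrtr_ge0 _)) -mulrDr => bd.
set A1 := dot_grad _ _ _; set A2 := dot_grad _ _ _.
apply: (@le_trans _ _ (rootn z * (e / (B + 1) * (`|est g1 z.1 z.2 - par g1| +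
    `|est g2 z.1 z.2 - par g2|)))).
  rewrite ler_wpM2l ?sqrtr_ge0// mulrDr.
  rewrite (_ : _ - _ = (reg g1 x (est g1 z.1 z.2) - reg g1 x (par g1) - A1) -
    (reg g2 x (est g2 z.1 z.2) - reg g2 x (par g2) - A2)).
    by rewrite (le_trans (ler_normB _ _))// lerD.
  by rewrite /diff_fun; ring.
move: bd; move: (rootn z) (`|_| + `|_|) => u v uv.
have -> : u * (e / (B + 1) * v) = e * (u * v / (B + 1)) by ring.
by rewrite ler_piMr ?ltW// ltr_pdivrMr// mul1r ltr_pwDr.
Unshelve. all: by end_near. Qed.

Lemma diff_bound : exists2 C, 0 < C & \forall z \near F, forall x, X x ->
  `|rootn z * (diff_fun (est g1 z.1 z.2) (est g2 z.1 z.2) x - D0 x)| <= C.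
Proof.
have [C C0 CP] := lin_fun_bound; exists (C * B + 1).
  by rewrite ltr_wpDl// mulr_ge0// B_ge0.
near=> z => x Xx.
have h : `|rootn z * (diff_fun (est g1 z.1 z.2) (est g2 z.1 z.2) x - D0 x) -
    lin_fun (par g1) (par g2) (rootn z *: (est g1 z.1 z.2 - par g1))
      (rootn z *: (est g2 z.1 z.2 - par g2)) x| <= 1.
  by move: x Xx; near: z; exact: diff_expansion.
rewrite -[X in `|X|](subrK (lin_fun (par g1) (par g2) (rootn z *: (est g1 z.1 z.2 - par g1))
      (rootn z *: (est g2 z.1 z.2 - par g2)) x)).
rewrite (le_trans (ler_normD _ _))// addrC lerD//.
rewrite (le_trans (CP _ _ _ Xx))// ler_wpM2l//.
by near: z; exact: rescaled_bound.
Unshelve. all: by end_near. Qed.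

Lemma rootn_gt0_near : \forall z \near F, 0 < rootn z.
Proof.
move/cvgnyPge : cvg_total => /(_ 1%N); apply: filterS => z h.
by rewrite sqrtr_gt0 ltr0n.
Qed.

(** The delta method for a functional that is only directionally differentiable:
    the scaled difference of the regression functions is linear in the estimation
    errors up to [o(1)], uniformly in the covariate, and the margin on which the
    sign of the difference may change has width of order [1 / sqrt n]. *)
Lemma dist_expansion dl : 0 < dl -> \forall z \near F,
  `|rootn z * (d_hat g1 g2 X z.1 z.2 - dist1 g1 g2 X (par g1) (par g2)) -
    dist_deriv (s1 *: scaled_error g1 z.1 z.2) (s2 *: scaled_error g2 z.1 z.2)|
    <= dl.
Proof.
move=> dl0; have [C C0 CP] := diff_bound.
have [L L0 LP] := dist_deriv_lipschitz.
have mu0 : 0 <= fine (leb X) by exact: fine_ge0.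
have mD0 : measurable_fun X D0 by case: bounded_measurable_diff_par.
have mu1 : 0 < fine (leb X) + 1 by rewrite ltr_wpDl.
have LK1 : 0 < L * K + 1 by rewrite ltr_wpDl// mulr_ge0.
pose e1 := dl / 3 / (fine (leb X) + 1).
have e10 : 0 < e1 by rewrite !divr_gt0.
pose e2 := dl / 3 / (2 * C).
have e20 : 0 < e2 by rewrite !divr_gt0// mulr_gt0.
have [t t0 tP] := margin_cvg0 mX muX mD0 e20.
pose e3 := dl / 6 / (L * K + 1).
have e30 : 0 < e3 by rewrite !divr_gt0.
have tC : 0 < t / C by rewrite divr_gt0.
have ex := diff_expansion e10.
near=> z.
have rn0 : 0 < rootn z by near: z; exact: rootn_gt0_near.
have rt : C / rootn z <= t.
  rewrite mulrC -ler_pdivlMr//.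
  have : `|0 - (rootn z)^-1| <= t / C.
    by near: z; move/cvgrPdist_le : (@cvg_sqrt_nat_inv R _ F FF _ cvg_total); exact.
  by rewrite sub0r normrN gtr0_norm// invr_gt0.
have h1 : `|s1 - r1 z| <= e3 by near: z; move/cvgrPdist_le : cvg_r1; exact.
have h2 : `|s2 - r2 z| <= e3 by near: z; move/cvgrPdist_le : cvg_r2; exact.
have k1 : `|scaled_error g1 z.1 z.2| <= K by near: z.
have k2 : `|scaled_error g2 z.1 z.2| <= K by near: z.
have [E1 E2] : rootn z *: (est g1 z.1 z.2 - par g1) = r1 z *: scaled_error g1 z.1 z.2 /\
  rootn z *: (est g2 z.1 z.2 - par g2) = r2 z *: scaled_error g2 z.1 z.2.
  by near: z; exact: rescaled_errors.
have a1 : `|rootn z * (d_hat g1 g2 X z.1 z.2 - dist1 g1 g2 X (par g1) (par g2)) -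
    dist_deriv (rootn z *: (est g1 z.1 z.2 - par g1))
      (rootn z *: (est g2 z.1 z.2 - par g2))| <= e1 * fine (leb X) + 2 * C * e2.
  apply: (@le_trans _ _ (e1 * fine (leb X) + 2 * C * fine (leb (margin X D0 (C / rootn z))))).
    apply: (@dir_integrand_expand _ _ _ leb X mX muX D0
      (diff_fun (est g1 z.1 z.2) (est g2 z.1 z.2))) => //.
    - exact: bounded_measurable_diff_par.
    - exact: bounded_measurable_diff_est.
    - exact: bounded_measurable_lin_par.
    - by near: z; exact: ex.
    - by near: z; exact: CP.
  rewrite lerD2l ler_wpM2l//; first by rewrite mulr_ge0// ltW.
  by apply: (le_trans _ tP); exact: fine_margin_le.
have a2 : `|dist_deriv (r1 z *: scaled_error g1 z.1 z.2) (r2 z *: scaled_error g2 z.1 z.2) -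
    dist_deriv (s1 *: scaled_error g1 z.1 z.2) (s2 *: scaled_error g2 z.1 z.2)| <=
    L * (e3 * K) + L * (e3 * K).
  rewrite (le_trans (LP _ _ _ _))// -!scalerBl normrZ [X in _ + L * X <= _]normrZ.
  by apply: lerD; rewrite ler_wpM2l// ler_pM// distrC.
have b1 : e1 * fine (leb X) <= dl / 3.
  rewrite /e1 -mulrA ler_piMr ?divr_ge0 ?ltW//.
  by rewrite mulrC ltr_pdivrMr// mul1r ltrDl.
have b2 : 2 * C * e2 = dl / 3 by rewrite /e2; field; rewrite gt_eqF.
have b3 : L * (e3 * K) <= dl / 6.
  rewrite (_ : _ * _ = dl / 6 * (L * K / (L * K + 1))); last by rewrite /e3; ring.
  by rewrite ler_piMr ?divr_ge0 ?ltW// ltr_pdivrMr// mul1r ltrDl.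
rewrite E1 E2 in a1.
apply: (le_trans (ler_distD (dist_deriv (r1 z *: scaled_error g1 z.1 z.2)
  (r2 z *: scaled_error g2 z.1 z.2)) _ _)).
apply: (le_trans (lerD a1 a2)); rewrite b2; exact: le_thirds.
Unshelve. all: by end_near. Qed.

Notation tau z := (c * Num.sqrt (ln (n z)%:R / (n z)%:R) : R).

Lemma T_hatE (Z1 : {RV P >-> 'cV[R]_p1}) (Z2 : {RV P >-> 'cV[R]_p2}) N w w' :
  T_hat X Z1 Z2 c N w w' = \int[leb]_(x in X)
    dir_integrand (N_hat g1 g2 X c N w)
      (fun x => Num.sg (diff_fun (est g1 N w) (est g2 N w) x))
      (lin_fun (est g1 N w) (est g2 N w)
        (Num.sqrt (kappa_hat g1 g2 N) *: (invsqrtmx (Sigma_hat g1 N w) *m Z1 w'))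
        (Num.sqrt (kappa_hat g1 g2 N / (kappa_hat g1 g2 N - 1)) *:
          (invsqrtmx (Sigma_hat g2 N w) *m Z2 w'))) x.
Proof.
have mN : measurable (N_hat g1 g2 X c N w).
  by apply: (measurable_sublevel mX (D := diff_fun (est g1 N w) (est g2 N w))); case: (bounded_measurable_diff_est N w).
have b1 : bounded_measurable X
    (fun x => Num.sg (diff_fun (est g1 N w) (est g2 N w) x)).
  by apply: bounded_measurable_sg => //; exact: bounded_measurable_diff_est.
have NX : N_hat g1 g2 X c N w `<=` X by move=> x [].
by rewrite -(Rintegral_dir mX muX mN NX b1 (bounded_measurable_lin_est _ _ _ _)).
Qed.

(** The quotient of the threshold and of [1 / sqrt n] is [c * sqrt (log n)]. *)
Lemma tau_dominates C : 0 < C -> \forall z \near F, C / rootn z < tau z.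
Proof.
move=> C0; pose a : R := (C / c) ^+ 2.
move/cvgnyPge : cvg_total => /(_ (Num.truncn (expR a)).+1); apply: filterS => z h.
have na : expR a < (n z)%:R by rewrite (lt_le_trans (truncnS_gt _))// ler_nat.
have n0 : 0 < (n z)%:R :> R by rewrite (lt_trans (expR_gt0 a)).
have an : a < ln (n z)%:R by rewrite -ltr_expR lnK.
have a0 : 0 <= a by rewrite sqr_ge0.
rewrite sqrtrM; last by rewrite ltW// (le_lt_trans a0).
rewrite sqrtrV ?ltW// mulrA ltr_pM2r ?invr_gt0 ?sqrtr_gt0//.
rewrite mulrC -ltr_pdivrMr//; rewrite -[X in X < _]gtr0_norm ?divr_gt0//.
by rewrite -sqrtr_sqr ltr_sqrt// (le_lt_trans a0).
Qed.

Lemma tau_cvg0 : tau z @[z --> F] --> 0.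
Proof.
rewrite -(mulr0 c); apply: cvgM; first exact: cvg_cst.
have c0 : Num.sqrt (2 * (rootn z)^-1) @[z --> F] --> (0 : R).
  rewrite -[X in _ --> X](sqrtr0 R) -(mulr0 2).
  apply: sqrt_cvg; apply: cvgM; first exact: cvg_cst.
  exact: (@cvg_sqrt_nat_inv R _ F FF _ cvg_total).
apply/cvgrPdist_le => e e0; move/cvgrPdist_le : c0 => /(_ _ e0) c0.
near=> z.
have rn0 : 0 < rootn z by near: z; exact: rootn_gt0_near.
have n0 : 0 < (n z)%:R :> R by rewrite -sqrtr_gt0.
rewrite sub0r normrN ger0_norm ?sqrtr_ge0//.
have : `|0 - Num.sqrt (2 * (rootn z)^-1)| <= e by near: z; exact: c0.
(* ln n = 2 * ln (sqrt n) <= 2 * sqrt n *)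
rewrite sub0r normrN ger0_norm ?sqrtr_ge0//; apply: le_trans.
rewrite ler_wsqrtr//.
move: rn0 n0; move: (rootn z) (@sqr_sqrtr R (n z)%:R) => q + q0 n0.
move=> /(_ (ltW n0)) <-.
rewrite ler_pdivrMr ?exprn_gt0// expr2 mulrA divfK ?gt_eqF//.
have -> : ln (q * q) = 2 * ln q by rewrite lnM// mulr_natl mulr2n.
by rewrite ler_wpM2l// ltW// ln_sublinear.
Unshelve. all: by end_near. Qed.

(** The threshold [tau] exceeds the estimation error of the difference [D0] of the
    regression functions, so that [N_hat] contains the zeros of [D0] and outside
    [N_hat] the sign of [D0] is estimated correctly; and [tau] tends to 0, so that
    the other points of [N_hat] form a set of small measure. *)
Lemma T_hat_expansion (Z1 : {RV P >-> 'cV[R]_p1}) (Z2 : {RV P >-> 'cV[R]_p2}) s :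
  0 < s -> \forall z \near F, forall w',
  `|T_hat X Z1 Z2 c z.1 z.2 w' - T_limit X Z1 Z2 kappa w'| <=
    s * (`|Z1 w'| + `|Z2 w'|).
Proof.
move=> s0; have [C C0 CP] := diff_bound; have [CL CL0 CLP] := lin_fun_bound.
have mu0 : 0 <= fine (leb X) by exact: fine_ge0.
have mD0 : measurable_fun X D0 by case: bounded_measurable_diff_par.
have mu1 : 0 < fine (leb X) + 1 by rewrite ltr_wpDl.
pose V1 := invsqrtmx (Sigma g1); pose V2 := invsqrtmx (Sigma g2).
pose V1' z := invsqrtmx (Sigma_hat g1 z.1 z.2).
pose V2' z := invsqrtmx (Sigma_hat g2 z.1 z.2).
pose B1 := CL * (p1%:R * (s1 * `|V1|)); pose B2 := CL * (p2%:R * (s2 * `|V2|)).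
have B10 : 0 <= B1 by rewrite !mulr_ge0// sqrtr_ge0.
have B20 : 0 <= B2 by rewrite !mulr_ge0// sqrtr_ge0.
have BB : 0 < B1 + B2 + 1 by rewrite ltr_wpDl// addr_ge0.
pose e1 := s / 2 / (fine (leb X) + 1).
have e10 : 0 < e1 by rewrite !divr_gt0.
pose e2 := s / 4 / (B1 + B2 + 1).
have e20 : 0 < e2 by rewrite !divr_gt0.
have [t t0 tP] := margin_cvg0 mX muX mD0 e20.
have t2 : 0 < t / 2 by rewrite divr_gt0.
have c1 : r1 z *: V1' z @[z --> F] --> s1 *: V1.
  apply: cvgZ; first exact: cvg_r1.
  exact: (cvg_invsqrt_Sigma_hat cX design1 A1_1 A4_1 A6_1 F_oo F_err1 F_var1).
have c2 : r2 z *: V2' z @[z --> F] --> s2 *: V2.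
  apply: cvgZ; first exact: cvg_r2.
  exact: (cvg_invsqrt_Sigma_hat cX design2 A1_2 A4_2 A6_2 F_oo F_err2 F_var2).
have u1 := dot_grad_est_uniform cX A4_1 A6_1 F_oo F_err1 c1 e10.
have u2 := dot_grad_est_uniform cX A4_2 A6_2 F_oo F_err2 c2 e10.
near=> z => w'.
have v1 : forall x, X x -> forall v, `|dot_grad (est g1 z.1 z.2) ((r1 z *: V1' z) *m v) x -
    dot_grad (par g1) ((s1 *: V1) *m v) x| <= e1 * `|v| by near: z; exact: u1.
have v2 : forall x, X x -> forall v, `|dot_grad (est g2 z.1 z.2) ((r2 z *: V2' z) *m v) x -
    dot_grad (par g2) ((s2 *: V2) *m v) x| <= e1 * `|v| by near: z; exact: u2.
have CPz : forall x, X x ->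
    `|rootn z * (diff_fun (est g1 z.1 z.2) (est g2 z.1 z.2) x - D0 x)| <= C.
  by near: z; exact: CP.
have rn0 : 0 < rootn z by near: z; exact: rootn_gt0_near.
have rt : C / rootn z < tau z by near: z; exact: tau_dominates.
have tt : tau z <= t / 2.
  have : `|0 - tau z| <= t / 2 by near: z; move/cvgrPdist_le : tau_cvg0; exact.
  by rewrite sub0r normrN; apply: le_trans; exact: ler_norm.
pose S := `|Z1 w'| + `|Z2 w'|; have S0 : 0 <= S by rewrite addr_ge0.
have Ez x : X x -> `|diff_fun (est g1 z.1 z.2) (est g2 z.1 z.2) x - D0 x| <= C / rootn z.
  move=> Xx; rewrite ler_pdivlMr// mulrC -[X in X * _]gtr0_norm// -normrM.
  exact: CPz.
pose H := lin_fun (est g1 z.1 z.2) (est g2 z.1 z.2) (r1 z *: (V1' z *m Z1 w'))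
  (r2 z *: (V2' z *m Z2 w')).
pose G := lin_fun (par g1) (par g2) (s1 *: (V1 *m Z1 w')) (s2 *: (V2 *m Z2 w')).
have HG x : X x -> `|H x - G x| <= e1 * S.
  move=> Xx; rewrite /H /G /lin_fun !scalemxAl.
  set a := dot_grad _ _ _; set b := dot_grad _ _ _.
  set a' := dot_grad _ _ _; set b' := dot_grad _ _ _.
  rewrite (_ : _ - _ = (a - a') - (b - b')); last by ring.
  rewrite (le_trans (ler_normB _ _))// mulrDr lerD//.
    exact: v1.
  exact: v2.
have GC x : X x -> `|G x| <= (B1 + B2) * S.
  move=> Xx; rewrite (le_trans (CLP _ _ _ Xx))//.
  apply: (@le_trans _ _ (CL * (p1%:R * (s1 * `|V1|) * `|Z1 w'| + p2%:R * (s2 * `|V2|) * `|Z2 w'|))).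
    rewrite ler_wpM2l// lerD// normrZ (ger0_norm (sqrtr_ge0 _)).
      rewrite (_ : _ * _ * `|Z1 w'| = s1 * (p1%:R * `|V1| * `|Z1 w'|)); last by ring.
      by rewrite ler_wpM2l ?sqrtr_ge0// norm_mulmx_le.
    rewrite (_ : _ * _ * `|Z2 w'| = s2 * (p2%:R * `|V2| * `|Z2 w'|)); last by ring.
    by rewrite ler_wpM2l ?sqrtr_ge0// norm_mulmx_le.
  rewrite mulrDr !mulrA -/B1 -/B2 /S mulrDl !mulrDr.
  rewrite -!mulrA -/B1 -/B2.
  have := mulr_ge0 B10 (normr_ge0 (Z2 w')); have := mulr_ge0 B20 (normr_ge0 (Z1 w')).
  rewrite /B1 /B2 !mulrA; lra.
rewrite T_hatE T_limitE.
apply: (@le_trans _ _ (e1 * S * fine (leb X) +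
    2 * ((B1 + B2) * S) * fine (leb (margin X D0 (tau z + C / rootn z))))).
  apply: (@dir_integrand_perturb _ _ _ leb X mX muX D0
    (diff_fun (est g1 z.1 z.2) (est g2 z.1 z.2)) G H) => //.
  - exact: bounded_measurable_diff_par.
  - exact: bounded_measurable_diff_est.
  - exact: bounded_measurable_lin_par.
  - exact: bounded_measurable_lin_est.
have mt : fine (leb (margin X D0 (tau z + C / rootn z))) <= e2.
  apply: (le_trans _ tP); apply: fine_margin_le => //.
  by rewrite (splitr t) lerD// ltW// (lt_le_trans rt).
have b1 : e1 * fine (leb X) <= s / 2.
  rewrite /e1 -mulrA ler_piMr ?divr_ge0 ?ltW//.
  by rewrite mulrC ltr_pdivrMr// mul1r ltrDl.
have b2 : 2 * (B1 + B2) * e2 <= s / 2.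
  rewrite (_ : _ * _ = s / 2 * ((B1 + B2) / (B1 + B2 + 1))); last by rewrite /e2; field; rewrite gt_eqF.
  by rewrite ler_piMr ?divr_ge0 ?ltW// ltr_pdivrMr// mul1r ltrDl.
rewrite -/S [in leRHS](splitr s) [leRHS]mulrDl lerD//.
  by rewrite mulrAC ler_wpM2r.
rewrite (_ : 2 * _ * _ = 2 * (B1 + B2) * fine (leb (margin X D0 (tau z + C / rootn z))) * S); last by ring.
rewrite ler_wpM2r// (le_trans _ b2)// ler_wpM2l// mulr_ge0// addr_ge0.
Unshelve. all: by end_near. Qed.

End two_group_limits.

(** * Measurability of the estimated distance and quantile *)

(** Tonelli's theorem for the positive and the negative part. *)
Lemma measurable_Rintegral_param (R : realType) d' (T : measurableType d')
    d (S : measurableType d) (mu : {sigma_finite_measure set S -> \bar R})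
    (X : set S) (f : S * T -> R) :
  measurable X -> measurable_fun (X `*` setT) f ->
  measurable_fun setT (fun w => \int[mu]_(x in X) f (x, w)).
Proof.
move=> mX mf; have mXT : measurable (X `*` [set: T]) by exact: measurableX.
pose h (z : S * T) : \bar R := ((f \_ (X `*` setT)) z)%:E.
have mh : measurable_fun setT h.
  by apply/measurable_EFinP; apply/(measurable_restrictT f mXT).
have hE w : \int[mu]_(x in X) f (x, w) =
    (fine (\int[mu]_x (h^\+ (x, w)) - \int[mu]_x (h^\- (x, w))))%E.
  rewrite /Rintegral integral_mkcond; congr fine.
  have -> : (fun x => (f (x, w))%:E) \_ X = (fun x => h (x, w)).
    apply/funext => x; rewrite /h /patch.
    have -> : ((x, w) \in X `*` setT) = (x \in X).
      by apply/idP/idP; rewrite !inE; [case|].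
    by case: ifP.
  by rewrite integralE; congr (_ - _)%E; apply: eq_integral => x _; rewrite !(funeposE, funenegE).
under eq_fun do rewrite hE.
apply: measurableT_comp; first exact: fine_measurable.
apply: emeasurable_funB.
  have := @measurable_fun_fubini_tonelli_G _ _ S T R mu (h^\+)%E.
  by apply; [exact: measurable_funepos|move=> z; exact: funepos_ge0].
have := @measurable_fun_fubini_tonelli_G _ _ S T R mu (h^\-)%E.
by apply; [exact: measurable_funeneg|move=> z; exact: funeneg_ge0].
Qed.

Section one_group_measurability.
Context {dO : measure_display} {Omega : measurableType dO} {R : realType}
  {P : probability Omega R} {d : nat}.
Variables (g : group P d) (X : set 'rV[R]_d).
Hypotheses (cX : compact X) (dX : design g X) (A3 : assumption3 g)
  (A4 : assumption4 g X).

Lemma measurable_obs ij : measurable_fun setT (obs g ij).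
Proof. by apply: measurable_funD => //; exact: measurable_funPT. Qed.

Lemma sample_measurable N : sample g N `<=` measurable.
Proof.
move=> _ [ij _ [B mB <-]].
by apply: measurable_obs.
Qed.

Lemma statistic_measurable d' (T : measurableType d') (G : set (set Omega))
    (f : Omega -> T) : G `<=` measurable -> statistic_of G f ->
  measurable_fun setT f.
Proof.
move=> Gm sf _ A mA; rewrite setTI.
have : <<s G >> `<=` measurable.
  by apply: smallest_sub => //; exact: sigma_algebra_measurable.
by apply; exact: sf.
Qed.

Hypothesis mest : forall N, measurable_fun setT (est g N).
Hypothesis mvar : forall N, measurable_fun setT (varest g N).

Let mX : measurable X. Proof. exact: compact_measurable_mx. Qed.
Let mB : measurable (parset g).
Proof. by case: A3 => cB _; exact: compact_measurable_mx. Qed.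

Lemma measurable_scaled_error N : measurable_fun setT (scaled_error g N).
Proof.
apply: measurable_scalemx => //; apply/measurable_fun_mxP => i j.
under eq_fun do rewrite mxBE.
by apply: measurable_funB => //; have /measurable_fun_mxP := mest N; exact.
Qed.

Section at_random_outcome.
Context d' (T : measurableType d') (h : T -> Omega).
Hypothesis mh : measurable_fun setT h.

Lemma measurable_reg_est N : measurable_fun (X `*` setT)
  (fun z : 'rV[R]_d * T => reg g z.1 (est g N (h z.2))).
Proof.
have [_ [_ cf _ _]] := A4; have [_ eB] := A3.
exact: (measurable_section_comp cX cf mB (measurableT_comp (mest N) mh)
  (fun t => eB N (h t))).
Qed.

Lemma measurable_grad_est N : measurable_fun (X `*` setT)
  (fun z : 'rV[R]_d * T => grad (reg g z.1) (est g N (h z.2))).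
Proof.
have [_ [_ _ cg _]] := A4; have [_ eB] := A3.
apply/measurable_fun_mxP => i j; rewrite (ord1 j).
exact: (measurable_section_comp (f := fun x b => grad (reg g x) b i 0)
  cX (cg i) mB (measurableT_comp (mest N) mh) (fun t => eB N (h t))).
Qed.

Lemma measurable_dot_grad_est N (v : T -> 'cV[R]_(npar g)) :
  measurable_fun setT v -> measurable_fun (X `*` setT)
    (fun z : 'rV[R]_d * T => dot_grad (est g N (h z.2)) (v z.2) z.1).
Proof.
move=> mv; have mv2 : measurable_fun (X `*` setT) (fun z : 'rV[R]_d * T => v z.2).
  by apply: measurable_funTS; exact: measurableT_comp.
have /measurable_fun_mxP := measurable_mulmx (measurable_trmx (measurable_grad_est N)) mv2.
exact.
Qed.

End at_random_outcome.

Lemma measurable_Sigma_hat N : measurable_fun setT (Sigma_hat g N).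
Proof.
apply: measurable_scalemx; first exact: measurableT_comp (@measurable_invr R) (mvar N).
apply: measurable_summx => i; apply: measurable_scalemx => //.
have mg : measurable_fun setT (fun w => grad (reg g (cov g i)) (est g N w)).
  apply: (@measurable_comp _ _ _ _ _ _ (X `*` setT)
    (fun z : 'rV[R]_d * Omega => grad (reg g z.1) (est g N z.2)) _
    (fun w => (cov g i, w))).
  - exact: measurableX.
  - by move=> _ [w _ <-]; split => //=; case: dX.
  - exact: (@measurable_grad_est _ Omega id (@measurable_id _ _ setT) N).
  - exact: measurable_fun_pair.
by apply: measurable_mulmx => //; exact: measurable_trmx.
Qed.

End one_group_measurability.

Section two_group_measurability.
Context {dO : measure_display} {Omega : measurableType dO} {R : realType}
  {P : probability Omega R} {d : nat}.
Variables (g1 g2 : group P d) (X : set 'rV[R]_d) (c : R).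
Variables (Z1 : {RV P >-> 'cV[R]_(npar g1)}) (Z2 : {RV P >-> 'cV[R]_(npar g2)}).
Hypotheses (cX : compact X)
  (design1 : design g1 X) (design2 : design g2 X)
  (ests : estimators g1 g2)
  (A3_1 : assumption3 g1) (A3_2 : assumption3 g2)
  (A4_1 : assumption4 g1 X) (A4_2 : assumption4 g2 X).

Let mX : measurable X. Proof. exact: compact_measurable_mx. Qed.

Lemma measurable_est1 N : measurable_fun setT (est g1 N).
Proof. by case: ests => h _ _ _; exact: statistic_measurable (@sample_measurable _ _ _ _ _ g1 N) (h N). Qed.

Lemma measurable_est2 N : measurable_fun setT (est g2 N).
Proof. by case: ests => _ h _ _; exact: statistic_measurable (@sample_measurable _ _ _ _ _ g2 N) (h N). Qed.

Lemma samples_measurable N : sample g1 N `|` sample g2 N `<=` measurable.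
Proof. by move=> A [/sample_measurable|/sample_measurable]. Qed.

Lemma measurable_varest1 N : measurable_fun setT (varest g1 N).
Proof. by case: ests => _ _ h _; exact: statistic_measurable (@samples_measurable N) (h N). Qed.

Lemma measurable_varest2 N : measurable_fun setT (varest g2 N).
Proof. by case: ests => _ _ _ h; exact: statistic_measurable (@samples_measurable N) (h N). Qed.

Lemma measurable_diff_est d' (T : measurableType d') (h : T -> Omega) N :
  measurable_fun setT h -> measurable_fun (X `*` setT)
  (fun z : 'rV[R]_d * T => diff_fun (est g1 N (h z.2)) (est g2 N (h z.2)) z.1).
Proof.
by move=> mh; apply: measurable_funB;
  [exact: (measurable_reg_est cX A3_1 A4_1 measurable_est1)|
   exact: (measurable_reg_est cX A3_2 A4_2 measurable_est2)].
Qed.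

Lemma measurable_d_hat N : measurable_fun setT (d_hat g1 g2 X N).
Proof.
apply: (measurable_Rintegral_param (lebesgue_rV d)
  (f := fun z => `|diff_fun (est g1 N z.2) (est g2 N z.2) z.1|) mX).
by apply: measurableT_comp => //; exact: (@measurable_diff_est _ Omega id N (@measurable_id _ _ setT)).
Qed.

(** Measurability jointly in the data and in the normal vectors, as required for
    the measurability of the conditional distribution function. *)
Lemma measurable_T_hat N : measurable_fun setT
  (fun z : Omega * Omega => T_hat X Z1 Z2 c N z.1 z.2).
Proof.
under eq_fun do rewrite (T_hatE c cX A3_1 A3_2 A4_1 A4_2 Z1 Z2).
have mS1 := measurable_Sigma_hat cX design1 A3_1 A4_1 measurable_est1 measurable_varest1 N.
have mS2 := measurable_Sigma_hat cX design2 A3_2 A4_2 measurable_est2 measurable_varest2 N.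
set k1 := Num.sqrt _; set k2 := Num.sqrt _.
have mv1 : measurable_fun setT (fun z : Omega * Omega =>
    k1 *: (invsqrtmx (Sigma_hat g1 N z.1) *m Z1 z.2)).
  apply: measurable_scalemx => //; apply: measurable_mulmx.
    apply: (measurableT_comp (@measurable_invsqrtmx R _)).
    exact: measurableT_comp mS1 measurable_fst.
  exact: measurableT_comp.
have mv2 : measurable_fun setT (fun z : Omega * Omega =>
    k2 *: (invsqrtmx (Sigma_hat g2 N z.1) *m Z2 z.2)).
  apply: measurable_scalemx => //; apply: measurable_mulmx.
    apply: (measurableT_comp (@measurable_invsqrtmx R _)).
    exact: measurableT_comp mS2 measurable_fst.
  exact: measurableT_comp.
have mD : measurable_fun (X `*` setT) (fun z : 'rV[R]_d * (Omega * Omega) =>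
    diff_fun (est g1 N z.2.1) (est g2 N z.2.1) z.1).
  exact: (measurable_diff_est N (@measurable_fst _ _ Omega Omega)).
have mG : measurable_fun (X `*` setT) (fun z : 'rV[R]_d * (Omega * Omega) =>
    lin_fun (est g1 N z.2.1) (est g2 N z.2.1)
      (k1 *: (invsqrtmx (Sigma_hat g1 N z.2.1) *m Z1 z.2.2))
      (k2 *: (invsqrtmx (Sigma_hat g2 N z.2.1) *m Z2 z.2.2)) z.1).
  apply: measurable_funB.
    exact: (measurable_dot_grad_est cX A3_1 A4_1 measurable_est1
      (@measurable_fst _ _ Omega Omega) N mv1).
  exact: (measurable_dot_grad_est cX A3_2 A4_2 measurable_est2
      (@measurable_fst _ _ Omega Omega) N mv2).
have mXT : measurable (X `*` [set: Omega * Omega]) by exact: measurableX.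
set tau := (c * Num.sqrt (ln (total_size g1 g2 N)%:R / (total_size g1 g2 N)%:R))%R.
pose S := [set z : 'rV[R]_d * (Omega * Omega) | (X `*` setT) z /\
  `|diff_fun (est g1 N z.2.1) (est g2 N z.2.1) z.1| < tau].
have mS : measurable S.
  rewrite (_ : S = (X `*` setT) `&`
    (fun z => diff_fun (est g1 N z.2.1) (est g2 N z.2.1) z.1) @^-1` ball 0 tau).
    by apply: mD => //; apply: open_measurable; exact: ball_open.
  by rewrite -ball_normE; apply/seteqP; split => z /=; rewrite sub0r normrN.
have SE x w : \1_(N_hat g1 g2 X c N w.1) x = \1_S (x, w) :> R.
  rewrite !indicE; congr (nat_of_bool _)%:R; apply/idP/idP; rewrite !inE.
    by move=> [Xx h]; split.
  by move=> [[Xx _] h]; split.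
apply: (measurable_Rintegral_param (lebesgue_rV d) (f := fun z =>
  dir_integrand (N_hat g1 g2 X c N z.2.1)
    (fun x => Num.sg (diff_fun (est g1 N z.2.1) (est g2 N z.2.1) x))
    (lin_fun (est g1 N z.2.1) (est g2 N z.2.1)
      (k1 *: (invsqrtmx (Sigma_hat g1 N z.2.1) *m Z1 z.2.2))
      (k2 *: (invsqrtmx (Sigma_hat g2 N z.2.1) *m Z2 z.2.2))) z.1) mX).
under eq_fun => z do rewrite /dir_integrand SE.
have m1S : measurable_fun (X `*` setT) (\1_S \o (fun z : 'rV[R]_d * (Omega * Omega) => (z.1, z.2)) : _ -> R).
  apply: measurable_funTS; apply: measurableT_comp => //.
  exact: measurable_fun_pair.
apply: measurable_funD; apply: measurable_funM => //.
- exact: measurableT_comp.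
- exact: measurable_funB.
apply: measurable_funM => //.
apply: (@measurableT_comp _ _ _ _ _ _ (Num.sg : R -> R)) => //.
exact: measurable_sgr.
Qed.

Lemma measurable_T_hat_section N w : measurable_fun setT (T_hat X Z1 Z2 c N w).
Proof. exact: (measurableT_comp (measurable_T_hat N) (pair1_measurable w)). Qed.

(** The quantile exceeds [t] exactly where the conditional probability of
    [T_hat <= t], a measurable function of the data, is less than [alpha]. *)
Lemma measurable_q_hat alpha N : 0 < alpha < 1 ->
  measurable_fun setT (q_hat X Z1 Z2 c alpha N).
Proof.
move=> a01; apply: (measurability _ (RGenOInfty.measurableE R)) => //.
move=> _ [_ [t ->] <-]; rewrite setTI.
pose A := [set z : Omega * Omega | T_hat X Z1 Z2 c N z.1 z.2 <= t].
have mA : measurable A by apply: measurable_le; exact: measurable_T_hat.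
have -> : q_hat X Z1 Z2 c alpha N @^-1` `]t, +oo[ =
    [set w | (P (xsection A w) < alpha%:E)%E].
  have E w : xsection A w = [set w' | T_hat X Z1 Z2 c N w w' <= t].
    by apply/seteqP; split => w'; rewrite /xsection/= inE.
  apply/seteqP; split => w /=; rewrite in_itv/= andbT E => h.
    rewrite ltNge; apply/negP => /(le_quantileP _ _ (measurable_T_hat_section N w) a01).
    by rewrite leNgt h.
  rewrite ltNge; apply/negP => /(le_quantileP _ _ (measurable_T_hat_section N w) a01).
  by rewrite leNgt h.
have mP : measurable_fun setT (fun w => P (xsection A w)).
  exact: measurable_fun_xsection.
rewrite -[X in measurable X]setTI.
exact: (emeasurable_fun_infty_o measurableT mP).
Qed.

End two_group_measurability.

(** * Convergence in law and comparison of distribution functions *)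

Section ramp.
Context {R : realType}.
Implicit Types r h s t : R.

(** A Lipschitz function between the indicators of [t <= r] and of [t <= r + h]. *)
Definition ramp r h t : R := Num.max 0 (Num.min 1 ((r + h - t) / h)).

Lemma ramp01 r h t : 0 <= ramp r h t <= 1.
Proof.
rewrite le_max lexx/= ge_max ler01/= ge_min lexx//.
Qed.

Lemma ramp_eq1 r h t : 0 < h -> t <= r -> ramp r h t = 1.
Proof.
move=> h0 tr; rewrite /ramp min_l ?max_r//.
by rewrite ler_pdivlMr// mul1r; lra.
Qed.

Lemma ramp_eq0 r h t : 0 < h -> r + h <= t -> ramp r h t = 0.
Proof.
move=> h0 tr; have u0 : (r + h - t) / h <= 0 by rewrite ler_pdivrMr// mul0r; lra.
by rewrite /ramp min_r ?max_l// (le_trans u0).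
Qed.

Lemma ramp_lipschitz r h s t : 0 < h ->
  `|ramp r h s - ramp r h t| <= h^-1 * `|s - t|.
Proof.
move=> h0; have -> : h^-1 * `|s - t| = `|(r + h - s) / h - (r + h - t) / h|.
  rewrite -mulrBl normrM normfV (gtr0_norm h0) mulrC distrC.
  by congr (`|_| / _); ring.
rewrite /ramp; move: ((r + h - s) / h) ((r + h - t) / h) => u v.
have /andP[a1 a2] : - `|u - v| <= u - v <= `|u - v| by rewrite -ler_norml.
rewrite !maxEle !minEle ler_norml; move: `|u - v| a1 a2 => a a1 a2.
case: (leP 1 u) => ?; case: (leP 1 v) => ?;
  rewrite ?ler01//; try case: (leP 0 u) => ?; try case: (leP 0 v) => ?;
  apply/andP; split; lra.
Qed.

End ramp.

Section lipschitz_convergence.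
Context {dO : measure_display} {Omega : measurableType dO} {R : realType}.
Variable P : probability Omega R.
Implicit Types (A D qh : nat -> Omega -> R) (T : Omega -> R).

(** Convergence in law, tested on the class of functions that the convergence of a
    pair of independent vectors provides. *)
Definition cvg_lipschitz A T : Prop := forall (f : R -> R) (L : R), 0 <= L ->
  (forall t, 0 <= f t <= 1) ->
  (forall s t, `|f s - f t| <= L * `|s - t|) ->
  \int[P]_w f (A N w) @[N --> \oo] --> \int[P]_w f (T w).

Lemma cvg_lipschitzN A T :
  cvg_lipschitz A T -> cvg_lipschitz (fun N w => - A N w) (fun w => - T w).
Proof.
move=> AT f L L0 f01 fL; apply: (AT (f \o -%R) L) => //= s t.
by rewrite (le_trans (fL _ _))// -opprD normrN.
Qed.

Lemma cvg_in_probabilityN A (c : R) : cvg_in_probability P A c ->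
  cvg_in_probability P (fun N w => - A N w) (- c).
Proof.
move=> Ac e e0; under eq_fun do under eq_set do rewrite -opprD normrN.
exact: Ac.
Qed.

Lemma cvg_in_probability_shift A (c M : R) : cvg_in_probability P A c ->
  cvg_in_probability P (fun N w => A N w + M) (c + M).
Proof.
move=> Ac e e0; have E w N : A N w + M - (c + M) = A N w - c by ring.
rewrite (_ : (fun N => P _) = (fun N => P [set w | e <= `|A N w - c|])).
  exact: Ac.
by apply/funext => N; congr (P _); apply/seteqP; split => w /=; rewrite E.
Qed.

Lemma near_cvg_in_probability A (c e r : R) : cvg_in_probability P A c ->
  0 < e -> 0 < r -> \forall N \near \oo, fine (P [set w | e <= `|A N w - c|]) < r.
Proof.
move=> Ac e0 r0; have /fine_cvgP[_ /cvgrPdist_lt/(_ _ r0)] := Ac e e0.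
apply: filterS => N; rewrite sub0r normrN; exact: le_lt_trans (ler_norm _).
Qed.

Lemma cvg_in_probability_cst (c : R) : cvg_in_probability P (fun _ _ => c) c.
Proof.
move=> e e0; rewrite (_ : (fun N => _) = fun=> 0%E); first exact: cvg_cst.
apply/funext => N; rewrite (_ : [set w | _] = set0) ?measure0//.
by apply/seteqP; split => w //=; rewrite subrr normr0 leNgt e0.
Qed.

Lemma prob_right_continuous T (q e : R) : measurable_fun setT T -> 0 < e ->
  exists2 dl, 0 < dl & fine (P [set w | T w <= q + dl]) <= fine (P [set w | T w <= q]) + e.
Proof.
move=> mT e0; pose V : {RV P >-> R} := HB.pack T (isMeasurableFun.Build _ _ _ _ T mT).
have VE r : P [set w | T w <= r] = cdf V r.
  rewrite (_ : [set w | _] = T @^-1` `]-oo, r]); first exact: erefl.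
  by apply/seteqP; split => w /=; rewrite in_itv.
have fV : cdf V q \is a fin_num by rewrite fin_num_measure.
have := @cdf_right_continuous _ _ _ _ V q.
rewrite -(fineK fV) => /fine_cvgP[_ /cvgrPdist_lt/(_ _ e0)].
move=> [dl /= dl0 hdl]; exists (dl / 2); first by rewrite divr_gt0.
have := hdl (q + dl / 2); rewrite /ball_/= opprD addrA subrr sub0r normrN.
rewrite gtr0_norm ?divr_gt0// !VE => h.
have : `|fine (cdf V q) - fine (cdf V (q + dl / 2))| < e.
  by apply: h; rewrite ?ltrDl ?divr_gt0// ltr_pdivrMr// ltr_pMr// ltr1n.
rewrite ltr_norml => /andP[+ _].
by move: (fine _) (fine _) => *; lra.
Qed.

Lemma ramp_bounds T (r h : R) : measurable_fun setT T -> 0 < h ->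
  fine (P [set w | T w <= r]) <= \int[P]_w ramp r h (T w) <=
  fine (P [set w | T w <= r + h]).
Proof.
move=> mT h0; have hV : 0 <= h^-1 by rewrite invr_ge0 ltW.
have mr : measurable_fun setT (ramp r h).
  apply: continuous_measurable_fun.
  exact: lipschitz_continuous hV (fun s t => ramp_lipschitz r s t h0).
have iR : P.-integrable setT (EFin \o (fun w => ramp r h (T w))).
  apply: bounded_measurable_integrable => //; first exact: P_setT_lty.
  split; first exact: measurableT_comp mr mT.
  by exists 1 => w _; have /andP[? ?] := ramp01 r h (T w); rewrite ger0_norm.
have iI (B : set Omega) : measurable B -> P.-integrable setT (EFin \o (\1_B : Omega -> R)).
  move=> mA; apply: bounded_measurable_integrable => //; first exact: P_setT_lty.
  exact: bounded_measurable_indic.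
have mle t := measurable_le t mT.
have IE (B : set Omega) : measurable B -> fine (P B) = \int[P]_w \1_B w.
  by move=> mA; rewrite Rintegral_indic// setIT.
rewrite !IE//; apply/andP; split; apply: le_Rintegral => //; try exact: iI.
- move=> w _; have /andP[r0 r1] := ramp01 r h (T w).
  rewrite indicE; case: (boolP (w \in _)) => //; rewrite inE/= => Tr.
  by rewrite ramp_eq1.
- move=> w _; have /andP[r0 r1] := ramp01 r h (T w).
  rewrite indicE; case: (boolP (w \in _)) => //; rewrite notin_setE/= => /negP.
  by rewrite -ltNge => /ltW Tr; rewrite ramp_eq0.
Qed.

Section portmanteau.
Variables (A D qh : nat -> Omega -> R) (T : Omega -> R) (q : R).
Hypotheses (mA : forall N, measurable_fun setT (A N))
  (mD : forall N, measurable_fun setT (D N))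
  (mqh : forall N, measurable_fun setT (qh N)) (mT : measurable_fun setT T).
Hypotheses (AT : cvg_lipschitz A T)
  (DA : cvg_in_probability P (fun N w => D N w - A N w) 0)
  (qhq : cvg_in_probability P qh q).

(** Half of Slutsky's theorem combined with half of the portmanteau theorem: with
    [h = dl / 3], outside two events of small probability [D <= qh] implies
    [A <= q + 2 * h], and the probability of the latter is bounded by the
    expectation of a ramp that vanishes beyond [q + 3 * h]. *)
Lemma near_limsup_le e : 0 < e -> \forall N \near \oo,
  fine (P [set w | D N w <= qh N w]) <= fine (P [set w | T w <= q]) + e.
Proof.
move=> e0; have e4 : 0 < e / 4 by rewrite divr_gt0.
have [dl dl0 Tdl] := prob_right_continuous q mT e4.
have h0 : 0 < dl / 3 by rewrite divr_gt0.
have hV : 0 <= (dl / 3)^-1 by rewrite invr_ge0 ltW.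
pose r := q + 2 * (dl / 3).
have /cvgrPdist_lt/(_ _ e4) near1 := AT hV (ramp01 r (dl / 3))
  (fun s t => ramp_lipschitz r s t h0).
have near2 := near_cvg_in_probability DA h0 e4.
have near3 := near_cvg_in_probability qhq h0 e4.
have /andP[_ up] := ramp_bounds r mT h0.
have rE : r + dl / 3 = q + dl by rewrite /r; field.
rewrite rE in up.
near=> N; have /andP[lo _] := ramp_bounds r (mA N) h0.
have n1 : `|\int[P]_w ramp r (dl / 3) (T w) - \int[P]_w ramp r (dl / 3) (A N w)| < e / 4.
  by near: N.
have n2 : fine (P [set w | dl / 3 <= `|D N w - A N w - 0|]) < e / 4 by near: N.
have n3 : fine (P [set w | dl / 3 <= `|qh N w - q|]) < e / 4 by near: N.
have mE2 : measurable [set w | dl / 3 <= `|D N w - A N w - 0|].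
  by apply: measurable_norm_ge; apply: measurable_funB => //; exact: measurable_funB.
have mE3 : measurable [set w | dl / 3 <= `|qh N w - q|].
  by apply: measurable_norm_ge; exact: measurable_funB.
have mE1 : measurable [set w | A N w <= r] by exact: measurable_le.
have mE : measurable [set w | D N w <= qh N w].
  rewrite (_ : [set w | _] = [set w | D N w - qh N w <= 0]).
    by apply: measurable_le; exact: measurable_funB.
  by apply/seteqP; split => w /=; rewrite subr_le0.
have s1 : fine (P [set w | D N w <= qh N w]) <=
    fine (P [set w | A N w <= r]) + fine (P ([set w | dl / 3 <= `|D N w - A N w - 0|]
      `|` [set w | dl / 3 <= `|qh N w - q|])).
  apply: prob_leU => //; first exact: measurableU.
  move=> w /= Dq.
  have [d1|] := leP (dl / 3) `|D N w - A N w - 0|; first by right; left.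
  have [d2|] := leP (dl / 3) `|qh N w - q|; first by right; right.
  rewrite !ltr_norml subr0 => /andP[_ a2] /andP[a1 _]; left; rewrite /r; move: Dq a1 a2.
  move: (D N w) (qh N w) (A N w) => x y z; lra.
have s2 : fine (P ([set w | dl / 3 <= `|D N w - A N w - 0|]
      `|` [set w | dl / 3 <= `|qh N w - q|])) <=
    fine (P [set w | dl / 3 <= `|D N w - A N w - 0|]) +
    fine (P [set w | dl / 3 <= `|qh N w - q|]).
  by apply: prob_leU => //; exact: measurableU.
have := n1; rewrite ltr_norml => /andP[n1' _].
move: s1 s2 n1' n2 n3 lo up Tdl.
move: (fine _) (fine _) (fine _) (fine _) (Rintegral _ _ _) (Rintegral _ _ _) (fine _) (fine _).
move=> *; lra.
Unshelve. all: by end_near. Qed.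

End portmanteau.

(** The upper bound for the opposite variables, and complements. *)
Lemma near_liminf_ge A D qh T (q e : R) :
  (forall N, measurable_fun setT (A N)) -> (forall N, measurable_fun setT (D N)) ->
  (forall N, measurable_fun setT (qh N)) -> measurable_fun setT T ->
  cvg_lipschitz A T -> cvg_in_probability P (fun N w => D N w - A N w) 0 ->
  cvg_in_probability P qh q -> 0 < e ->
  \forall N \near \oo,
    fine (P [set w | T w < q]) - e <= fine (P [set w | D N w < qh N w]).
Proof.
move=> mA mD mqh mT AT DA qhq e0.
have mN (Y : Omega -> R) : measurable_fun setT Y -> measurable_fun setT (fun w => - Y w).
  by move=> mY; exact: measurableT_comp.
have DA' : cvg_in_probability P (fun N w => - D N w - - A N w) 0.
  have := cvg_in_probabilityN DA; rewrite oppr0.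
  by congr (cvg_in_probability P _ 0); apply/funext => N; apply/funext => w; rewrite opprB addrC opprK.
have := near_limsup_le (fun N => mN _ (mA N)) (fun N => mN _ (mD N))
  (fun N => mN _ (mqh N)) (mN _ mT) (cvg_lipschitzN AT) DA' (cvg_in_probabilityN qhq) e0.
apply: filterS => N.
have mDq : measurable [set w | D N w < qh N w].
  rewrite (_ : [set w | _] = [set w | D N w - qh N w < 0]).
    by apply: measurable_lt; exact: measurable_funB.
  by apply/seteqP; split => w /=; rewrite subr_lt0.
have -> : [set w | - D N w <= - qh N w] = ~` [set w | D N w < qh N w].
  by apply/seteqP; split => w /=; rewrite lerN2 leNgt => /negP.
have -> : [set w | - T w <= - q] = ~` [set w | T w < q].
  by apply/seteqP; split => w /=; rewrite lerN2 leNgt => /negP.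
rewrite !prob_setC//; last exact: measurable_lt.
by move: (fine _) (fine _) => *; lra.
Qed.

End lipschitz_convergence.

(** * From uniform expansions to convergence in probability *)

Section uniform_statements_in_probability.
Context {dO : measure_display} {Omega : measurableType dO} {R : realType}.
Variable P : probability Omega R.

Definition tight (S : nat -> Omega -> R) : Prop := forall e : R, 0 < e ->
  exists2 K, 0 <= K & \forall N \near \oo, fine (P [set w | K < S N w]) <= e.

Lemma near_prob_cvg0 (E : nat -> set Omega) : (forall N, measurable (E N)) ->
  (forall r : R, 0 < r -> \forall N \near \oo, fine (P (E N)) <= r) ->
  P (E N) @[N --> \oo] --> 0%E.
Proof.
move=> mE h; apply/fine_cvgP; split.
  by apply: nearW => N; rewrite fin_num_measure.
apply/cvgrPdist_le => r r0; apply: filterS (h r r0) => N.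
by rewrite sub0r normrN ger0_norm// fine_ge0.
Qed.

Variables (S1 S2 V1 V2 : nat -> Omega -> R) (v1 v2 : R).

(** The statements that hold at all late stages, uniformly over the outcomes at
    which [S1] and [S2] are at most [K] and [V1], [V2] are close to [v1], [v2]. *)
Definition controlled (K : R) : set_system (nat * Omega) :=
  [set A | exists eta N0, 0 < eta /\ forall N w, (N0 <= N)%N ->
     S1 N w <= K -> S2 N w <= K -> `|V1 N w - v1| < eta -> `|V2 N w - v2| < eta ->
     A (N, w)].

Instance controlled_filter K : Filter (controlled K).
Proof.
split.
- by exists 1, 0%N; split.
- move=> A B [ea [Na [ea0 hA]]] [eb [Nb [eb0 hB]]].
  exists (Num.min ea eb), (maxn Na Nb); split; first by rewrite lt_min ea0.
  move=> N w; rewrite geq_max !lt_min => /andP[Na' Nb'] s1 s2 /andP[? ?] /andP[? ?].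
  by split; [exact: hA|exact: hB].
- move=> A B AB [e [N0 [e0 hA]]]; exists e, N0; split => // N w *.
  by apply: AB; exact: hA.
Qed.

Lemma controlled_oo K : z.1 @[z --> controlled K] --> \oo.
Proof.
move=> A [N0 _ NA]; exists 1, N0; split => // N w N0N _ _ _ _.
by apply: NA.
Qed.

Lemma controlled_bounds K : (\forall z \near controlled K, S1 z.1 z.2 <= K) /\
  (\forall z \near controlled K, S2 z.1 z.2 <= K).
Proof. by split; exists 1, 0%N; split. Qed.

Lemma controlled_cvg K : V1 z.1 z.2 @[z --> controlled K] --> v1 /\
  V2 z.1 z.2 @[z --> controlled K] --> v2.
Proof.
by split; apply/cvgrPdist_lt => e e0; exists e, 0%N; split => // N w _ _ _ h1 h2;
  rewrite /= distrC.
Qed.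

Hypotheses (mS1 : forall N, measurable_fun setT (S1 N))
  (mS2 : forall N, measurable_fun setT (S2 N))
  (mV1 : forall N, measurable_fun setT (V1 N))
  (mV2 : forall N, measurable_fun setT (V2 N)).
Hypotheses (tS1 : tight S1) (tS2 : tight S2)
  (V1v : cvg_in_probability P V1 v1) (V2v : cvg_in_probability P V2 v2).

(** By tightness, the outcomes excluded by the filter have small probability when
    [K] is large. *)
Lemma controlled_in_probability (g : nat -> Omega -> R) (l : R) :
  (forall N, measurable_fun setT (g N)) ->
  (forall K dl, 0 <= K -> 0 < dl ->
     \forall z \near controlled K, `|g z.1 z.2 - l| <= dl) ->
  cvg_in_probability P g l.
Proof.
move=> mg near_g e e0.
have mE N : measurable [set w | e <= `|g N w - l|].
  by apply: measurable_norm_ge; exact: measurable_funB.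
apply: near_prob_cvg0 => // r r0; have r4 : 0 < r / 4 by rewrite divr_gt0.
have [K1 K10 t1] := tS1 r4; have [K2 K20 t2] := tS2 r4.
have K0 : 0 <= K1 + K2 by rewrite addr_ge0.
have [eta [N0 [eta0 hg]]] := near_g _ _ K0 (divr_gt0 e0 (ltr0n R 2)).
have p1 := near_cvg_in_probability V1v eta0 r4.
have p2 := near_cvg_in_probability V2v eta0 r4.
near=> N.
have b1 : fine (P [set w | K1 < S1 N w]) <= r / 4 by near: N.
have b2 : fine (P [set w | K2 < S2 N w]) <= r / 4 by near: N.
have b3 : fine (P [set w | eta <= `|V1 N w - v1|]) < r / 4 by near: N.
have b4 : fine (P [set w | eta <= `|V2 N w - v2|]) < r / 4 by near: N.
have NN0 : (N0 <= N)%N by near: N; exact: nbhs_infty_ge.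
set B1 := [set w | K1 < _] in b1; set B2 := [set w | K2 < _] in b2.
set B3 := [set w | eta <= _] in b3; set B4 := [set w | eta <= _] in b4.
have mB1 : measurable B1 by exact: measurable_gt.
have mB2 : measurable B2 by exact: measurable_gt.
have mB3 : measurable B3 by apply: measurable_norm_ge; exact: measurable_funB.
have mB4 : measurable B4 by apply: measurable_norm_ge; exact: measurable_funB.
have mB34 := measurableU _ _ mB3 mB4; have mB234 := measurableU _ _ mB2 mB34.
have s1 : fine (P [set w | e <= `|g N w - l|]) <=
    fine (P B1) + fine (P (B2 `|` (B3 `|` B4))).
  apply: prob_leU => // w /= ge.
  have [h1|h1] := leP (S1 N w) K1; last by left.
  have [h2|h2] := leP (S2 N w) K2; last by right; left.
  have [h3|h3] := leP eta `|V1 N w - v1|; first by right; right; left.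
  have [h4|h4] := leP eta `|V2 N w - v2|; first by right; right; right.
  have := hg N w NN0 (le_trans h1 _) (le_trans h2 _) h3 h4.
  rewrite lerDl lerDr => /(_ K20 K10)/= /(le_trans ge).
  by rewrite leNgt ltr_pdivrMr// ltr_pMr// ltr1n.
have s2 := prob_leU P mB234 mB2 mB34 (@subset_refl _ _).
have s3 := prob_leU P mB34 mB3 mB4 (@subset_refl _ _).
move: s1 s2 s3 b1 b2 b3 b4; move: (fine _) (fine _) (fine _) (fine _) (fine _) (fine _).
by move=> *; lra.
Unshelve. all: by end_near. Qed.

End uniform_statements_in_probability.

Section tightness.
Context {dO : measure_display} {Omega : measurableType dO} {R : realType}.
Variable P : probability Omega R.

Lemma measurable_norm_mx m n (U : Omega -> 'M[R]_(m, n)) :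
  measurable_fun setT U -> measurable_fun setT (fun w => `|U w|).
Proof.
move=> mU; apply: (measurableT_comp _ mU).
by apply: continuous_measurable_mx; exact: norm_continuous.
Qed.

(** The norms converge in law as well, so that their tails are eventually bounded
    by that of the limit. *)
Lemma cvg_in_law_tight p (U_ : nat -> Omega -> 'cV[R]_p) (U : Omega -> 'cV[R]_p) :
  (forall N, measurable_fun setT (U_ N)) -> measurable_fun setT U ->
  cvg_in_law P U_ U -> tight P (fun N w => `|U_ N w|).
Proof.
move=> mU_ mU lawU e e0; have e2 : 0 < e / 2 by rewrite divr_gt0.
have mnU := measurable_norm_mx mU.
have mnU_ N := measurable_norm_mx (mU_ N).
have [K K0 KP] := prob_tight P mnU e2.
exists (K + 1); first by rewrite addr_ge0// ltW.
have law : cvg_lipschitz P (fun N w => `|U_ N w|) (fun w => `|U w|).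
  move=> f L L0 f01 fL.
  apply: (cvg_in_law_Rintegral mU_ mU lawU (f := fun x => f `|x|) (C := 1)).
    move=> x; apply: continuous_comp; first exact: norm_continuous.
    exact: lipschitz_continuous L0 fL _.
  by move=> x; have /andP[? ?] := f01 `|x|; rewrite ger0_norm.
have c0 : cvg_in_probability P (fun N w => `|U_ N w| - `|U_ N w|) 0.
  by under eq_fun do under eq_fun do rewrite subrr; exact: cvg_in_probability_cst.
have := near_liminf_ge mnU_ mnU_ (fun=> measurable_cst _) mnU law c0
  (cvg_in_probability_cst P (K + 1)) e2.
have mKU : measurable [set w | K < `|U w|] by exact: measurable_gt.
apply: filterS => N; have mle := measurable_le (K + 1) (mnU_ N).
have s1 : fine (P [set w | `|U_ N w| < K + 1]) <= fine (P [set w | `|U_ N w| <= K + 1]).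
  by apply: prob_le => //; [exact: measurable_lt|move=> w /= /ltW].
have s2 : 1 - fine (P [set w | K < `|U w|]) <= fine (P [set w | `|U w| < K + 1]).
  rewrite -prob_setC//; apply: prob_le; [exact: measurableC|exact: measurable_lt|].
  by move=> w /= /negP; rewrite -leNgt => /le_lt_trans; apply; rewrite ltrDl.
have -> : [set w | K + 1 < `|U_ N w|] = ~` [set w | `|U_ N w| <= K + 1].
  by apply/seteqP; split => w /=; rewrite ltNge => /negP.
rewrite prob_setC//; have : fine (P [set w | K < `|U w|]) <= e / 2.
  by rewrite ltW// -lte_fin fineK// fin_num_measure.
by move: s1 s2; move: (fine _) (fine _) (fine _) (fine _) => *; lra.
Qed.

End tightness.

(** * Independence of the two groups *)

Section independence_of_groups.
Context {dO : measure_display} {Omega : measurableType dO} {R : realType}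
  {P : probability Omega R} {d : nat}.
Variables (g1 g2 : group P d).
Variables (Z1 : {RV P >-> 'cV[R]_(npar g1)}) (Z2 : {RV P >-> 'cV[R]_(npar g2)}).
Hypotheses (indep : mutual_indep P (noise Z1 Z2)) (ests : estimators g1 g2).

Lemma measurable_noise i : measurable_fun setT (noise Z1 Z2 i).
Proof.
have mz p (Z : {RV P >-> 'cV[R]_p}) a : measurable_fun setT (fun w => Z w a 0).
  by have /measurable_fun_mxP := measurable_funPT Z; exact.
by case: i => [[ij|ij]|[a|a]] /=; [exact: measurable_funPT..|exact: mz|exact: mz].
Qed.

(* Measurability with respect to finitely many of the noise variables is
   measurability on the type [g_sigma_algebraType G]. *)
Section generated.
Variable s : seq (('I_(ncov g1) * nat + 'I_(ncov g2) * nat) +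
  ('I_(npar g1) + 'I_(npar g2))).
Let G := preimages_of [set` s] (noise Z1 Z2).

Lemma measurable_noise_generated i : i \in s ->
  measurable_fun [set: g_sigma_algebraType G] (noise Z1 Z2 i : g_sigma_algebraType G -> R).
Proof.
move=> si _ A mA; apply: sub_sigma_algebra; exists i => //.
by exists A.
Qed.

Lemma sigma_sub_noise d' (H : set (set Omega)) (T : measurableType d') (f : Omega -> T) :
  (forall A, H A -> exists2 h : g_sigma_algebraType G -> R, measurable_fun setT h &
     exists2 B, measurable B & A = h @^-1` B) ->
  statistic_of H f -> statistic_of G f.
Proof.
move=> HG sf A mA; have HGs : H `<=` <<s G >>.
  move=> B /HG[h mh [C mC ->]].
  by have := mh measurableT C mC; rewrite setTI.
exact: (smallest_sub (smallest_sigma_algebra _ _) HGs) (sf A mA).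
Qed.

Lemma statistic_of_entries p (f : Omega -> 'cV[R]_p) (i : 'I_p -> _) :
  (forall a, i a \in s) -> (forall a w, f w a 0 = noise Z1 Z2 (i a) w) ->
  statistic_of G f.
Proof.
move=> si fE A mA.
have mf : measurable_fun setT (f : g_sigma_algebraType G -> 'cV[R]_p).
  apply: measurable_fun_mx => a j; rewrite (ord1 j).
  under eq_fun do rewrite fE.
  exact: measurable_noise_generated.
by have := mf measurableT A mA; rewrite setTI.
Qed.

End generated.

(** At stage [N] each estimator depends only on finitely many errors of its own
    group. *)
Lemma indep_est N : indep_var P (est g1 N) (est g2 N).
Proof.
pose s1 := [seq inl (inl (i, j)) : ('I_(ncov g1) * nat + 'I_(ncov g2) * nat) +
  ('I_(npar g1) + 'I_(npar g2)) | i <- enum 'I_(ncov g1), j <- iota 0 (nobs g1 N i)].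
pose s2 := [seq inl (inr (i, j)) : ('I_(ncov g1) * nat + 'I_(ncov g2) * nat) +
  ('I_(npar g1) + 'I_(npar g2)) | i <- enum 'I_(ncov g2), j <- iota 0 (nobs g2 N i)].
have us : uniq (s1 ++ s2).
  rewrite cat_uniq; apply/and3P; split.
  - apply: allpairs_uniq_dep; [exact: enum_uniq|by move=> *; exact: iota_uniq|].
    by move=> [i j] [i' j'] _ _ /= [-> ->].
  - apply/hasPn => x /allpairsPdep[i [j [_ _ ->]]]; apply/negP.
    by move=> /allpairsPdep[i' [j' [_ _]]].
  - apply: allpairs_uniq_dep; [exact: enum_uniq|by move=> *; exact: iota_uniq|].
    by move=> [i j] [i' j'] _ _ /= [-> ->].
have [e1 e2 _ _] := ests.
move=> A B mA mB; apply: (mutual_indep_sigma measurable_noise indep us).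
- apply: (sigma_sub_noise _ (e1 N)) => // _ [[i j] /= jN [C mC <-]].
  exists (obs g1 (i, j)); last by exists C => //; rewrite setTI.
  apply: measurable_funD => //.
  apply: (@measurable_noise_generated s1 (inl (inl (i, j)))).
  by apply/allpairsPdep; exists i, j; rewrite mem_enum mem_iota.
- apply: (sigma_sub_noise _ (e2 N)) => // _ [[i j] /= jN [C mC <-]].
  exists (obs g2 (i, j)); last by exists C => //; rewrite setTI.
  apply: measurable_funD => //.
  apply: (@measurable_noise_generated s2 (inl (inr (i, j)))).
  by apply/allpairsPdep; exists i, j; rewrite mem_enum mem_iota.
Qed.

Lemma indep_normals : indep_var P Z1 Z2.
Proof.
pose s1 := [seq inr (inl a) : ('I_(ncov g1) * nat + 'I_(ncov g2) * nat) +
  ('I_(npar g1) + 'I_(npar g2)) | a <- enum 'I_(npar g1)].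
pose s2 := [seq inr (inr a) : ('I_(ncov g1) * nat + 'I_(ncov g2) * nat) +
  ('I_(npar g1) + 'I_(npar g2)) | a <- enum 'I_(npar g2)].
have us : uniq (s1 ++ s2).
  rewrite cat_uniq; apply/and3P; split.
  - by rewrite map_inj_uniq ?enum_uniq// => a b [].
  - by apply/hasPn => x /mapP[a _ ->]; apply/negP => /mapP[b _].
  - by rewrite map_inj_uniq ?enum_uniq// => a b [].
move=> A B mA mB; apply: (mutual_indep_sigma measurable_noise indep us).
- apply: (@statistic_of_entries s1 _ _ (fun a => inr (inl a))) => // a.
  by apply/mapP; exists a; rewrite ?mem_enum.
- apply: (@statistic_of_entries s2 _ _ (fun a => inr (inr a))) => // a.
  by apply/mapP; exists a; rewrite ?mem_enum.
Qed.

End independence_of_groups.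

(** * Asymptotics of the distance and of the quantile *)

Lemma lipschitz_pair_comp (R : realType) p1 p2 q1 q2
    (t : 'cV[R]_p1 -> 'cV[R]_p2 -> R) (f : 'cV[R]_q1 -> 'cV[R]_p1)
    (g : 'cV[R]_q2 -> 'cV[R]_p2) (L C1 C2 : R) :
  0 <= L -> 0 <= C1 -> 0 <= C2 ->
  (forall x y x' y', `|t x y - t x' y'| <= L * `|x - x'| + L * `|y - y'|) ->
  (forall x x', `|f x - f x'| <= C1 * `|x - x'|) ->
  (forall y y', `|g y - g y'| <= C2 * `|y - y'|) ->
  forall x y x' y', `|t (f x) (g y) - t (f x') (g y')| <=
    (L * (C1 + C2)) * `|x - x'| + (L * (C1 + C2)) * `|y - y'|.
Proof.
move=> L0 C10 C20 tL fC gC x y x' y'; rewrite (le_trans (tL _ _ _ _))// -!mulrA.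
apply: lerD; rewrite ler_wpM2l//.
  by rewrite (le_trans (fC _ _))// ler_wpM2r// lerDl.
by rewrite (le_trans (gC _ _))// ler_wpM2r// lerDr.
Qed.

Section asymptotics.
Context {dO : measure_display} {Omega : measurableType dO} {R : realType}
  {P : probability Omega R} {d : nat}.
Variables (X : set 'rV[R]_d) (g1 g2 : group P d).
Variables (Z1 : {RV P >-> 'cV[R]_(npar g1)}) (Z2 : {RV P >-> 'cV[R]_(npar g2)}).
Variables (kappa c alpha : R).
Hypotheses (design1 : design g1 X) (design2 : design g2 X)
  (indep : mutual_indep P (noise Z1 Z2))
  (normal1 : std_normal_coords Z1) (normal2 : std_normal_coords Z2)
  (ests : estimators g1 g2)
  (A1_1 : assumption1 g1) (A1_2 : assumption1 g2) (cX : compact X)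
  (A3_1 : assumption3 g1) (A3_2 : assumption3 g2)
  (A4_1 : assumption4 g1 X) (A4_2 : assumption4 g2 X)
  (A6_1 : assumption6 g1) (A6_2 : assumption6 g2)
  (A6_kappa : kappa_hat g1 g2 N @[N --> \oo] --> kappa)
  (kappa_gt1 : 1 < kappa)
  (A7_1 : assumption7 g1 Z1) (A7_2 : assumption7 g2 Z2)
  (c_gt0 : 0 < c) (alpha01 : 0 < alpha < 1).

Let d1 := dist1 g1 g2 X (par g1) (par g2).
Let rootn N : R := Num.sqrt (total_size g1 g2 N)%:R.
Let T := T_limit X Z1 Z2 kappa.
Let s1 := Num.sqrt kappa.
Let s2 := Num.sqrt (kappa / (kappa - 1)).
Let H1 := scaled_error g1.
Let H2 := scaled_error g2.
Let Y1 w := invsqrtmx (Sigma g1) *m Z1 w.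
Let Y2 w := invsqrtmx (Sigma g2) *m Z2 w.
(* The functional of which T is the value at the limits Y1, Y2 of H1, H2. *)
Let t (x : 'cV[R]_(npar g1)) (y : 'cV[R]_(npar g2)) := dist_deriv X (s1 *: x) (s2 *: y).
Let A N w := t (H1 N w) (H2 N w).
Let D N w := rootn N * (d_hat g1 g2 X N w - d1).

Let mH1 N : measurable_fun setT (H1 N).
Proof. by apply: measurable_scaled_error => n; exact: (measurable_est1 ests). Qed.

Let mH2 N : measurable_fun setT (H2 N).
Proof. by apply: measurable_scaled_error => n; exact: (measurable_est2 ests). Qed.

Let mY1 : measurable_fun setT Y1.
Proof. by apply: measurable_mulmx; [exact: measurable_cst|exact: measurable_funPT]. Qed.

Let mY2 : measurable_fun setT Y2.
Proof. by apply: measurable_mulmx; [exact: measurable_cst|exact: measurable_funPT]. Qed.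

Let t_lipschitz : exists2 L, 0 <= L &
  forall x y x' y', `|t x y - t x' y'| <= L * `|x - x'| + L * `|y - y'|.
Proof.
have [L L0 tL] := dist_deriv_lipschitz cX A4_1 A4_2.
have s10 : 0 <= s1 by exact: sqrtr_ge0.
have s20 : 0 <= s2 by exact: sqrtr_ge0.
exists (L * (s1 + s2)); first by rewrite mulr_ge0// addr_ge0.
apply: (lipschitz_pair_comp L0 s10 s20 tL) => x x';
  by rewrite -scalerBr normrZ ger0_norm.
Qed.

Let measurable_t U V : measurable_fun setT U -> measurable_fun setT V ->
  measurable_fun [set: Omega] (fun w => t (U w) (V w)).
Proof.
move=> mU mV; have [L L0 tL] := t_lipschitz.
have ct := lipschitz_continuous_pair L0 tL.
have mt := within_continuous_measurable_mx_pair measurableT (continuous_subspaceT ct).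
exact: (measurableT_comp mt (measurable_fun_pair mU mV)).
Qed.

Let mA N : measurable_fun setT (A N). Proof. exact: measurable_t. Qed.

Let TE w : T w = t (Y1 w) (Y2 w). Proof. exact: T_limitE. Qed.

Lemma measurable_T_limit : measurable_fun setT T.
Proof. by rewrite (_ : T = fun w => t (Y1 w) (Y2 w)); [exact: measurable_t|apply/funext => w; exact: TE]. Qed.

Lemma measurable_centered_dist N : measurable_fun setT (D N).
Proof.
apply: measurable_funM => //; apply: measurable_funB => //.
exact: (measurable_d_hat cX ests A3_1 A3_2 A4_1 A4_2).
Qed.

Lemma cvg_lipschitz_dist_deriv : cvg_lipschitz P A T.
Proof.
move=> f L L0 f01 fL.
have mrescale p (k : R) (b : 'cV[R]_p) : measurable_fun setT (fun e : 'cV[R]_p => k *: (e - b)).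
  apply: measurable_scalemx => //; apply/measurable_fun_mxP => i j.
  under eq_fun do rewrite mxBE.
  by apply: measurable_funB => //; exact: measurable_entry.
have [M M0 tM] := t_lipschitz.
have -> : (fun w => f (T w)) = (fun w => f (t (Y1 w) (Y2 w))).
  by apply/funext => w; rewrite TE.
apply: (@cvg_in_law_joint _ _ _ P _ _ (fun x y => f (t x y)) (L * M)) => //.
- by rewrite mulr_ge0.
- move=> x y x' y'; rewrite (le_trans (fL _ _))// -!mulrA -mulrDr ler_wpM2l//.
- move=> N; apply: (indep_var_comp (f := fun e : 'cV[R]_(npar g1) => Num.sqrt (size_of g1 N)%:R *: (e - par g1))
    (g := fun e : 'cV[R]_(npar g2) => Num.sqrt (size_of g2 N)%:R *: (e - par g2)) _ _ (indep_est indep ests N)).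
    exact: mrescale.
  exact: mrescale.
- apply: (indep_var_comp (f := mulmx (invsqrtmx (Sigma g1)))
    (g := mulmx (invsqrtmx (Sigma g2))) _ _ (indep_normals indep)).
    by apply: measurable_mulmx; [exact: measurable_cst|exact: measurable_id].
  by apply: measurable_mulmx; [exact: measurable_cst|exact: measurable_id].
- by case: A7_1 => -[].
- by case: A7_2 => -[].
Qed.

Let S1 N w := `|H1 N w|.
Let S2 N w := `|H2 N w|.

(** The filter [controlled K] satisfies the requirements on [F] under which the
    expansions were proved. *)
Lemma in_probability_of_expansion (g : nat -> Omega -> R) (l : R) :
  (forall N, measurable_fun setT (g N)) ->
  (forall F K, Filter F -> z.1 @[z --> F] --> \oo -> 0 <= K ->
    (\forall z \near F, `|scaled_error g1 z.1 z.2| <= K) ->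
    (\forall z \near F, `|scaled_error g2 z.1 z.2| <= K) ->
    varest g1 z.1 z.2 @[z --> F] --> var g1 ->
    varest g2 z.1 z.2 @[z --> F] --> var g2 ->
    forall dl, 0 < dl -> \forall z \near F, `|g z.1 z.2 - l| <= dl) ->
  cvg_in_probability P g l.
Proof.
move=> mg near_g.
have mS1 N : measurable_fun setT (S1 N) by exact: measurable_norm_mx.
have mS2 N : measurable_fun setT (S2 N) by exact: measurable_norm_mx.
have [[_ _ _ _ law1] var1] := A7_1; have [[_ _ _ _ law2] var2] := A7_2.
apply: (controlled_in_probability mS1 mS2 (measurable_varest1 ests)
  (measurable_varest2 ests) (cvg_in_law_tight mH1 mY1 law1)
  (cvg_in_law_tight mH2 mY2 law2) var1 var2 mg) => K dl K0 dl0.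
have [b1 b2] := controlled_bounds S1 S2 (varest g1) (varest g2) (var g1) (var g2) K.
have [c1 c2] := controlled_cvg S1 S2 (varest g1) (varest g2) (var g1) (var g2) K.
exact: (near_g _ K (controlled_filter _ _ _ _ _ _ _) (controlled_oo _ _ _ _ _ _ _) K0 b1 b2 c1 c2).
Qed.

Lemma dist_expansion_in_probability :
  cvg_in_probability P (fun N w => D N w - A N w) 0.
Proof.
apply: in_probability_of_expansion => [N|F K FF F_oo K0 b1 b2 _ _ dl dl0].
  by apply: measurable_funB => //; exact: measurable_centered_dist.
have := dist_expansion cX A3_1 A3_2 A4_1 A4_2 A6_1 A6_2 A6_kappa kappa_gt1
  F_oo K0 b1 b2 dl0.
move=> /(_ FF); apply: filterS => z; rewrite subr0; exact.
Qed.

(** Given the data, [T_hat] is close to [T] as a random variable in the normal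
    vectors, and the quantile is continuous at [T]. *)
Lemma q_hat_consistent :
  cvg_in_probability P (q_hat X Z1 Z2 c alpha) (quantile P T alpha).
Proof.
apply: in_probability_of_expansion => [N|F K FF F_oo K0 b1 b2 v1 v2 dl dl0].
  exact: (measurable_q_hat _ _ _ cX design1 design2 ests A3_1 A3_2 A4_1 A4_2).
pose W w := `|Z1 w| + `|Z2 w|.
have mW : measurable_fun setT W.
  by apply: measurable_funD; apply: measurable_norm_mx; exact: measurable_funPT.
have [L L0 tL] := t_lipschitz.
have q_lt : (alpha%:E < P [set w | (T w <= quantile P T alpha + dl / 2)%R])%E.
  pose C1 := (npar g1)%:R * `|invsqrtmx (Sigma g1)|.
  pose C2 := (npar g2)%:R * `|invsqrtmx (Sigma g2)|.
  have C10 : 0 <= C1 by rewrite mulr_ge0.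
  have C20 : 0 <= C2 by rewrite mulr_ge0.
  have mulL p (M : 'M[R]_p) (x x' : 'cV[R]_p) : `|M *m x - M *m x'| <= p%:R * `|M| * `|x - x'|.
    by rewrite -mulmxBr; exact: norm_mulmx_le.
  have tYL := lipschitz_pair_comp L0 C10 C20 tL (mulL _ _) (mulL _ _).
  have := gaussian_quantile_lt indep normal1 normal2 _ tYL _ alpha01 (divr_gt0 dl0 (ltr0n R 2)).
  rewrite (_ : T = fun w => t (Y1 w) (Y2 w)); last by apply/funext => w; exact: TE.
  by apply; [rewrite mulr_ge0// addr_ge0|exact: measurable_t].
have [s s0 stable] := quantile_stable measurable_T_limit mW alpha01 dl0 q_lt.
have := T_hat_expansion cX design1 design2 A1_1 A1_2 A3_1 A3_2 A4_1 A4_2 A6_1 A6_2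
  A6_kappa kappa_gt1 c_gt0 F_oo K0 b1 b2 v1 v2 Z1 Z2 s0.
move=> /(_ FF); apply: filterS => z h; apply: stable => //.
exact: (measurable_T_hat_section _ _ _ cX design1 design2 ests A3_1 A3_2 A4_1 A4_2).
Qed.

Let q := quantile P T alpha.
Let qh := q_hat X Z1 Z2 c alpha.

Let mqh N : measurable_fun setT (qh N).
Proof. exact: (measurable_q_hat _ _ _ cX design1 design2 ests A3_1 A3_2 A4_1 A4_2). Qed.

Let mqhM M N : measurable_fun setT (fun w => qh N w + M).
Proof. exact: measurable_funD. Qed.

Let qhM M : cvg_in_probability P (fun N w => qh N w + M) (q + M).
Proof.
exact: cvg_in_probability_shift q_hat_consistent.
Qed.

(** The shift [M] of the quantile accounts for the difference between [epsilon]
    and [d1], which is magnified by the factor [sqrt n]. *)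
Lemma near_prob_le M e : 0 < e -> \forall N \near \oo,
  fine (P [set w | D N w <= qh N w + M]) <= fine (P [set w | T w <= q + M]) + e.
Proof.
exact: (near_limsup_le mA measurable_centered_dist (mqhM M) measurable_T_limit
  cvg_lipschitz_dist_deriv dist_expansion_in_probability (qhM M)).
Qed.

Lemma near_prob_ge M e : 0 < e -> \forall N \near \oo,
  fine (P [set w | T w < q + M]) - e <= fine (P [set w | D N w < qh N w + M]).
Proof.
exact: (near_liminf_ge mA measurable_centered_dist (mqhM M) measurable_T_limit
  cvg_lipschitz_dist_deriv dist_expansion_in_probability (qhM M)).
Qed.

Lemma near_rootn_ge M : \forall N \near \oo, M <= rootn N.
Proof.
have [_ size_oo _ _] := A6_1.
move/cvgnyPge : size_oo => /(_ (Num.truncn (M ^+ 2)).+1).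
apply: filterS => N /= hN; apply: (le_trans (ler_norm M)).
rewrite -sqrtr_sqr ler_wsqrtr//; apply: (le_trans (ltW (truncnS_gt _))).
by rewrite ler_nat (leq_trans hN)// leq_addr.
Qed.

Lemma measurable_dist_lt M N : measurable [set w | D N w < qh N w + M].
Proof.
rewrite (_ : [set w | _] = [set w | D N w - (qh N w + M) < 0]).
  by apply: measurable_lt; apply: measurable_funB => //; exact: measurable_centered_dist.
by apply/seteqP; split => w /=; rewrite subr_lt0.
Qed.

Lemma measurable_dist_le M N : measurable [set w | D N w <= qh N w + M].
Proof.
rewrite (_ : [set w | _] = [set w | D N w - (qh N w + M) <= 0]).
  by apply: measurable_le; apply: measurable_funB => //; exact: measurable_centered_dist.
by apply/seteqP; split => w /=; rewrite subr_le0.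
Qed.

Lemma rejectE e N : 0 < rootn N ->
  [set w | d_hat g1 g2 X N w < e + qh N w / rootn N] =
  [set w | D N w < qh N w + rootn N * (e - d1)].
Proof.
move=> r0; have E x y : (x < e + y / rootn N) = (rootn N * (x - d1) < y + rootn N * (e - d1)).
  rewrite -(ltr_pM2l r0) mulrDr mulrCA divff ?gt_eqF// mulr1.
  by rewrite !mulrBr addrA ltrD2r addrC.
by apply/seteqP; split => w /=; rewrite E.
Qed.

Lemma in_intervalE N : 0 < rootn N ->
  [set w | d1 \in `[0, d_hat g1 g2 X N w - qh N w / rootn N[ ] =
  ~` [set w | D N w <= qh N w + 0].
Proof.
move=> r0; have d10 : 0 <= d1 by exact: Rintegral_ge0.
have E x y : (d1 \in `[0, x - y / rootn N[) = ~~ (rootn N * (x - d1) <= y + 0).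
  rewrite in_itv/= d10/= addr0 -ltNge ltrBrDr -ltrBrDl -(ltr_pM2l r0).
  by rewrite mulrCA divff ?gt_eqF// mulr1.
by apply/seteqP; split => w /=; rewrite E => /negP.
Qed.

End asymptotics.

(** * Limits of the probabilities *)

Lemma dist_one_le (R : realFieldType) (x y z e : R) :
  1 - e / 2 <= x -> x - e / 2 <= y -> y <= z -> z <= 1 -> `|z - 1| <= e.
Proof. by move=> *; rewrite ler_norml; apply/andP; split; lra. Qed.

Section limits_of_probabilities.
Context {dO : measure_display} {Omega : measurableType dO} {R : realType}.
Variable P : probability Omega R.
Variable E : nat -> set Omega.
Hypothesis mE : forall N, measurable (E N).

Lemma cvg_prob (a : R) :
  (forall e, 0 < e -> \forall N \near \oo, `|fine (P (E N)) - a| <= e) ->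
  P (E N) @[N --> \oo] --> a%:E.
Proof.
move=> h; apply/fine_cvgP; split; first by apply: nearW => N; rewrite fin_num_measure.
by apply/cvgrPdist_le => e e0; apply: filterS (h e e0) => N; rewrite distrC.
Qed.

Lemma limn_esup_prob_le (a : R) :
  (forall e, 0 < e -> \forall N \near \oo, fine (P (E N)) <= a + e) ->
  (limn_esup (fun N => P (E N)) <= a%:E)%E.
Proof.
move=> h; apply/lee_addgt0Pr => e e0.
apply: (@le_trans _ _ (ereal_sup ((fun N => P (E N)) @`
    [set N | fine (P (E N)) <= a + e]))).
  by apply: ereal_inf_lbound; exists [set N | fine (P (E N)) <= a + e] => //; exact: h.
apply: ge_ereal_sup => _ [N /= hN <-].
by rewrite -(fineK (fin_num_measure P _ (mE N))) -EFinD lee_fin.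
Qed.

End limits_of_probabilities.

(* no_atom: the alpha-quantile of the limit law T of sqrt n (d_hat - d1) is    *)
(* not an atom of T. Without it the first two claims fail: if d1(b1, b2) is   *)
(* constant near the true parameters, e.g. m_1 = b1 x, m_2 = 1 + b2 x on      *)
(* [-1, 1] with |beta1 - beta2| < 1, then d_hat = d1 and q_hat = 0 with       *)
(* probability tending to 1, and the interval misses d1.                      *)
Theorem theorem2p2 (dO : measure_display) (Omega : measurableType dO)
    (R : realType) (P : probability Omega R) (d : nat) (X : set 'rV[R]_d)
    (g1 g2 : group P d)
    (Z1 : {RV P >-> 'cV[R]_(npar g1)}) (Z2 : {RV P >-> 'cV[R]_(npar g2)})
    (kappa c alpha epsilon : R)
    (design1 : design g1 X) (design2 : design g2 X)
    (indep : mutual_indep P (noise Z1 Z2))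
    (normal1 : std_normal_coords Z1) (normal2 : std_normal_coords Z2)
    (ests : estimators g1 g2)
    (A1_1 : assumption1 g1) (A1_2 : assumption1 g2)
    (A2 : compact X)
    (A3_1 : assumption3 g1) (A3_2 : assumption3 g2)
    (A4_1 : assumption4 g1 X) (A4_2 : assumption4 g2 X)
    (A5_1 : assumption5 g1) (A5_2 : assumption5 g2)
    (A6_1 : assumption6 g1) (A6_2 : assumption6 g2)
    (A6_kappa : kappa_hat g1 g2 N @[N --> \oo] --> kappa)
    (kappa_gt1 : 1 < kappa)
    (A7_1 : assumption7 g1 Z1) (A7_2 : assumption7 g2 Z2)
    (c_gt0 : 0 < c) (alpha01 : 0 < alpha < 1) (epsilon_gt0 : 0 < epsilon) :
  let d1 := dist1 g1 g2 X (par g1) (par g2) in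
  let dhat := d_hat g1 g2 X in
  let qhat := q_hat X Z1 Z2 c alpha in
  let rootn N : R := Num.sqrt (total_size g1 g2 N)%:R in
  let T := T_limit X Z1 Z2 kappa in
  let no_atom := P [set w | T w = quantile P T alpha] = 0%E in
  [/\ no_atom ->
        P [set w | d1 \in `[0, dhat N w - qhat N w / rootn N[ ]
          @[N --> \oo] --> (1 - alpha)%:E,
      (d1 = epsilon -> no_atom) -> epsilon <= d1 ->
        (limn_esup (fun N =>
           P [set w | (dhat N w < epsilon + qhat N w / rootn N)%R]) <=
         alpha%:E)%E &
      d1 < epsilon ->
        limn_einf (fun N =>
           P [set w | (dhat N w < epsilon + qhat N w / rootn N)%R]) = 1%E].
Proof.
move=> d1 dhat qhat rootn T no_atom; pose q := quantile P T alpha.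
pose D N w := rootn N * (dhat N w - d1).
have mT : measurable_fun setT T by exact: measurable_T_limit.
have up M e : 0 < e -> \forall N \near \oo,
    fine (P [set w | D N w <= qhat N w + M]) <= fine (P [set w | T w <= q + M]) + e.
  exact: near_prob_le.
have lo M e : 0 < e -> \forall N \near \oo,
    fine (P [set w | T w < q + M]) - e <= fine (P [set w | D N w < qhat N w + M]).
  exact: near_prob_ge.
have mlt M N : measurable [set w | D N w < qhat N w + M] by exact: measurable_dist_lt.
have mle M N : measurable [set w | D N w <= qhat N w + M] by exact: measurable_dist_le.
have mq N : measurable_fun setT (qhat N).
  exact: (measurable_q_hat _ _ _ A2 design1 design2 ests A3_1 A3_2 A4_1 A4_2).
have md N : measurable_fun setT (dhat N).
  exact: (measurable_d_hat A2 ests A3_1 A3_2 A4_1 A4_2).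
have root_ge M : \forall N \near \oo, M <= rootn N by exact: (near_rootn_ge g2 A6_1).
have root_gt0 : \forall N \near \oo, 0 < rootn N.
  by apply: filterS (root_ge 1) => N; exact: lt_le_trans.
have rejE N : 0 < rootn N -> [set w | dhat N w < epsilon + qhat N w / rootn N] =
    [set w | D N w < qhat N w + rootn N * (epsilon - d1)] by exact: rejectE.
have intE N : 0 < rootn N -> [set w | d1 \in `[0, dhat N w - qhat N w / rootn N[ ] =
    ~` [set w | D N w <= qhat N w + 0] by exact: in_intervalE.
have mrej N : measurable [set w | dhat N w < epsilon + qhat N w / rootn N].
  rewrite (_ : [set w | _] = [set w | dhat N w - (epsilon + qhat N w / rootn N) < 0]).
    apply: measurable_lt; apply: measurable_funB => //; apply: measurable_funD => //.
    exact: measurable_funM.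
  by apply/seteqP; split => w /=; rewrite subr_lt0.
have atom_free : no_atom -> fine (P [set w | T w <= q + 0]) = alpha /\
    fine (P [set w | T w < q + 0]) = alpha.
  by move=> /(quantile_no_atom mT alpha01); rewrite addr0 => -[-> ->].
have le_lt M N : fine (P [set w | D N w < qhat N w + M]) <=
    fine (P [set w | D N w <= qhat N w + M]).
  by apply: prob_le => // w /= /ltW.
split.
- move=> /atom_free[Tle Tlt].
  have mI N : measurable [set w | d1 \in `[0, dhat N w - qhat N w / rootn N[ ].
    have mdq : measurable_fun setT (fun w => dhat N w - qhat N w / rootn N).
      by apply: measurable_funB => //; exact: measurable_funM.
    have [d10|d10] := leP 0 d1.
      rewrite (_ : [set w | _] = [set w | d1 < dhat N w - qhat N w / rootn N]).
        exact: measurable_gt.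
      by apply/seteqP; split => w /=; rewrite in_itv/= d10.
    rewrite (_ : [set w | _] = set0)//.
    by apply/seteqP; split => w //=; rewrite in_itv/= leNgt d10.
  apply: cvg_prob => // e e0; near=> N.
  have r0 : 0 < rootn N by near: N.
  rewrite intE// prob_setC//.
  have u : fine (P [set w | D N w <= qhat N w + 0]) <= alpha + e.
    by rewrite -Tle; near: N; exact: up.
  have l : alpha - e <= fine (P [set w | D N w < qhat N w + 0]).
    by rewrite -{1}Tlt; near: N; exact: lo.
  have := le_lt 0 N; rewrite ler_norml; move: u l.
  by move: (fine _) (fine _) => x y *; apply/andP; split; lra.
- move=> hatom; rewrite le_eqVlt => /orP[/eqP ed|ed].
  + have [Tle _] := atom_free (hatom (esym ed)).
    apply: limn_esup_prob_le => // e e0; near=> N.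
    have r0 : 0 < rootn N by near: N.
    rewrite rejE// ed subrr mulr0 (le_trans (le_lt _ _))// -Tle.
    by near: N; exact: up.
  (* The shift tends to -oo, and below the quantile already the shift -1 makes
     the probability less than alpha. *)
  + have qlt : fine (P [set w | T w <= q - 1]) <= alpha.
      rewrite -lee_fin fineK ?fin_num_measure//; last exact: measurable_le.
      rewrite leNgt; apply/negP => /ltW /(le_quantileP _ _ mT alpha01).
      by rewrite -/q lerBrDr -lerBrDl subrr ler10.
    have d0 : 0 < d1 - epsilon by rewrite subr_gt0.
    apply: limn_esup_prob_le => // e e0; near=> N.
    have r0 : 0 < rootn N by near: N.
    have r1 : (d1 - epsilon)^-1 <= rootn N by near: N; exact: root_ge.
    rewrite rejE//; apply: (@le_trans _ _ (fine (P [set w | D N w <= qhat N w - 1]))).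
      apply: prob_le => // w /= /ltW /le_trans; apply; rewrite lerD2l.
      by rewrite -opprB mulrN lerN2 -ler_pdivrMr// mul1r.
    apply: (@le_trans _ _ (fine (P [set w | T w <= q - 1]) + e)); last by rewrite lerD2r.
    by near: N; exact: up.
- move=> de; have d0 : 0 < epsilon - d1 by rewrite subr_gt0.
  suff : P [set w | dhat N w < epsilon + qhat N w / rootn N] @[N --> \oo] --> 1%E.
    by move=> h; rewrite is_cvg_limn_einfE; [exact/cvg_lim|exact: cvgP h].
  apply: cvg_prob => // e e0; have e2 : 0 < e / 2 by rewrite divr_gt0.
  (* The shift tends to +oo and so exceeds M, which is chosen such that T reaches
     q + M with probability at most e / 2. *)
  have [K K0 TK] := prob_tight P mT e2.
  pose M := K - q + 1.
  have TM : 1 - e / 2 <= fine (P [set w | T w < q + M]).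
    have mK : measurable [set w | K < T w] by exact: measurable_gt.
    apply: (@le_trans _ _ (fine (P (~` [set w | K < T w])))).
      rewrite prob_setC// lerD2l lerN2 ltW// -lte_fin fineK//; exact: fin_num_measure.
    apply: prob_le; [exact: measurableC|exact: measurable_lt|].
    move=> w /= /negP; rewrite -leNgt => /le_lt_trans; apply.
    by rewrite /M addrCA addrA subrK -ltrBlDl subrr.
  near=> N.
  have r0 : 0 < rootn N by near: N.
  have rM : M / (epsilon - d1) <= rootn N by near: N; exact: root_ge.
  have l : fine (P [set w | T w < q + M]) - e / 2 <=
      fine (P [set w | D N w < qhat N w + M]) by near: N; exact: lo.
  have l2 : fine (P [set w | D N w < qhat N w + M]) <=
      fine (P [set w | dhat N w < epsilon + qhat N w / rootn N]).
    apply: prob_le => //; rewrite rejE// => w /= /lt_le_trans; apply.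
    by rewrite lerD2l -ler_pdivrMr.
  have l3 : fine (P [set w | dhat N w < epsilon + qhat N w / rootn N]) <= 1.
    by rewrite -lee_fin fineK ?fin_num_measure//; exact: probability_le1.
  exact: dist_one_le TM l l2 l3.
Unshelve. all: by end_near. Qed.
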